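(* Let $a<b$, $c<d$ and $N=\left[\begin{smallmatrix}0&0&0\\N_{10}&N_{11}&N_{12}\\N_{20}&N_{21}&N_{22}\end{smallmatrix}\right]\in\mathcal N_{2D}^{n\times m}$ where $N_{10},N_{20}\in H_1^{n\times m}[x,y,\theta]$ and $N_{11},N_{12},N_{21},N_{22}\in H_1^{n\times m}[x,y,\theta,\nu]$. Define $M=(M_{ij})_{i,j=0}^2\in\mathcal N_{2D}^{n\times m}$ by $$\begin{aligned}&M_{00}(x,y)=N_{10}(x,y,x)-N_{20}(x,y,x),\\&M_{01}(x,y,\nu)=N_{11}(x,y,x,\nu)-N_{21}(x,y,x,\nu),\\&M_{02}(x,y,\nu)=N_{12}(x,y,x,\nu)-N_{22}(x,y,x,\nu),\\&M_{i0}(x,y,\theta)=\partial_xN_{i0}(x,y,\theta),\quad M_{ij}(x,y,\theta,\nu)=\partial_xN_{ij}(x,y,\theta,\nu)\qquad(i,j\in\{1,2\}).\end{aligned}$$ Then for any $u\in L_2^m([a,b]\times[c,d])$, $$\partial_x(\mathcal P[N]u)(x,y)=(\mathcal P[M]u)(x,y).$$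
   Context: $\mathcal N_{2D}^{n\times m}$ is the set of $3\times3$ arrays $(N_{ij})_{i,j\in\{0,1,2\}}$ of square-integrable $\mathbb R^{n\times m}$-valued functions $N_{00}(x,y)$, $N_{01}(x,y,\nu)$, $N_{02}(x,y,\nu)$, $N_{10}(x,y,\theta)$, $N_{20}(x,y,\theta)$, and $N_{11},N_{12},N_{21},N_{22}$ of $(x,y,\theta,\nu)$, with $x,\theta\in[a,b]$, $y,\nu\in[c,d]$. The 2D-PI operator is $$\begin{aligned}(\mathcal P[N]u)(x,y)=\;&N_{00}(x,y)u(x,y)+\int_a^xN_{10}(x,y,\theta)u(\theta,y)d\theta+\int_x^bN_{20}(x,y,\theta)u(\theta,y)d\theta\\&+\int_c^yN_{01}(x,y,\nu)u(x,\nu)d\nu+\int_y^dN_{02}(x,y,\nu)u(x,\nu)d\nu\\&+\int_a^x\!\!\int_c^yN_{11}(x,y,\theta,\nu)u(\theta,\nu)d\nu d\theta+\int_x^b\!\!\int_c^yN_{21}(x,y,\theta,\nu)u(\theta,\nu)d\nu d\theta\\&+\int_a^x\!\!\int_y^dN_{12}(x,y,\theta,\nu)u(\theta,\nu)d\nu d\theta+\int_x^b\!\!\int_y^dN_{22}(x,y,\theta,\nu)u(\theta,\nu)d\nu d\theta.\end{aligned}$$ $H_1$ denotes the space of functions all of whose mixed (weak) partial derivatives of order at most one in each variable separately are in $L_2$; e.g. $H_1[x,y]=\{u:\partial_x^{\alpha_1}\partial_y^{\alpha_2}u\in L_2\ \forall\,\max(\alpha_1,\alpha_2)\le1\}$,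 and likewise in three and four variables. Derivatives are weak derivatives and equalities hold almost everywhere. *)

(* Defs.v *)
From HB Require Import structures.
From mathcomp Require Import all_boot all_order all_algebra.
From mathcomp Require Import all_classical all_reals all_analysis.
Set Implicit Arguments.
Unset Strict Implicit.
Unset Printing Implicit Defensive.
Import Order.TTheory GRing.Theory Num.Theory numFieldNormedType.Exports.
Local Open Scope classical_set_scope.
Local Open Scope ring_scope.

Section test_functions.
Context {R : realType} {V : normedModType R}.

Definition iter_derive (vs : seq V) (phi : V -> R) : V -> R :=
  foldr (fun v psi => 'D_v psi) phi vs.

(* In finite dimension this is C^oo on the whole space: all iterated
   directional derivatives exist everywhere and are continuous. *)
Definition smooth (phi : V -> R) :=
  forall vs : seq V, continuous (iter_derive vs phi) /\
    forall z v, derivable (iter_derive vs phi) z v.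

Definition test_function (Omega : set V) (phi : V -> R) :=
  let supp := closure [set z | phi z != 0] in
  [/\ smooth phi, compact supp & supp `<=` Omega].

End test_functions.

(* The measurable structure carrying the product Lebesgue measures lives on
   products of [measurableTypeR R], the norm and the topology on products of
   [R].  In [loc_integrable], [weak_derivative], [H1] and [continuous_version]
   the map [e : T -> V] identifies the two; it is only ever used as
   the identity between convertible types ([chart2], [chart3], [chart4]). *)
Section weak_derivatives.
Context d {T : measurableType d} {R : realType} {V : normedModType R}.
Variables (mu : {measure set T -> \bar R}) (e : T -> V).

Definition square_integrable (D : set T) (f : T -> R) :=
  f \_ D \in Lfun mu 2%:E.

Definition loc_integrable (Omega : set T) (f : T -> R) :=
  measurable_fun Omega f /\
  forall K : set T, K `<=` Omega -> compact (e @` K) ->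
    mu.-integrable K (EFin \o f).

(* [g] is the weak derivative of [f] on [Omega], once along each of the
   directions listed in [vs]. *)
Definition weak_derivative (Omega : set T) (vs : seq V) (f g : T -> R) :=
  [/\ loc_integrable Omega f, loc_integrable Omega g &
      forall phi : V -> R, test_function (e @` Omega) phi ->
        \int[mu]_(z in Omega) (f z * iter_derive vs phi (e z)) =
        (-1) ^+ size vs * \int[mu]_(z in Omega) (g z * phi (e z))].

(* [basis] lists the coordinate directions; its subsequences are exactly the
   multi-indices of order at most one in each variable separately. *)
Definition H1 (Omega : set T) (basis : seq V) (f : T -> R) :=
  square_integrable Omega f /\
  forall vs, subseq vs basis ->
    exists2 g, square_integrable Omega g & weak_derivative Omega vs f g.

End weak_derivatives.

Section matrix_valued.
Context d {T : measurableType d} {R : realType} {V : normedModType R}.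
Variables (mu : {measure set T -> \bar R}) (e : T -> V) (p q : nat).

Definition mx_integral (D : set T) (F : T -> 'M[R]_(p, q)) : 'M[R]_(p, q) :=
  \matrix_(i, j) \int[mu]_(z in D) F z i j.

Definition mx_square_integrable (D : set T) (F : T -> 'M[R]_(p, q)) :=
  forall i j, square_integrable mu D (fun z => F z i j).

Definition mx_weak_derivative Omega (vs : seq V) (F G : T -> 'M[R]_(p, q)) :=
  forall i j,
    weak_derivative mu e Omega vs (fun z => F z i j) (fun z => G z i j).

Definition mx_H1 Omega (basis : seq V) (F : T -> 'M[R]_(p, q)) :=
  forall i j, H1 mu e Omega basis (fun z => F z i j).

(* Used to give a meaning to restrictions to null sets: [G] is the (on a
   closed box, unique) continuous element of the a.e. class of [F]. *)
Definition continuous_version (D : set T) (F : T -> 'M[R]_(p, q))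
    (G : V -> 'M[R]_(p, q)) :=
  (forall i j, {within e @` D, continuous (fun z => G z i j)}) /\
  F = G \o e %[ae mu in D].

End matrix_valued.

(* Lebesgue measure on R^2, R^3, R^4, the latter two as (R * R) * R and
   ((R * R) * R) * R. *)
Notation leb R := (@lebesgue_measure R) (only parsing).
Notation leb2 R := (@lebesgue_measure R \x @lebesgue_measure R)%E (only parsing).
Notation leb3 R :=
  (@lebesgue_measure R \x @lebesgue_measure R \x @lebesgue_measure R)%E (only parsing).
Notation leb4 R :=
  (@lebesgue_measure R \x @lebesgue_measure R \x @lebesgue_measure R
   \x @lebesgue_measure R)%E (only parsing).

Section boxes.
Context {R : realType}.
Local Notation mR := (measurableTypeR R).

Definition chart2 : mR * mR -> R * R := fun z => z.
Definition chart3 : mR * mR * mR -> R * R * R := fun z => z.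
Definition chart4 : mR * mR * mR * mR -> R * R * R * R := fun z => z.

Definition dx2 : R * R := (1, 0).
Definition basis3 : seq (R * R * R) := [:: (1, 0, 0); (0, 1, 0); (0, 0, 1)].
Definition dx3 : R * R * R := (1, 0, 0).
Definition basis4 : seq (R * R * R * R) :=
  [:: (1, 0, 0, 0); (0, 1, 0, 0); (0, 0, 1, 0); (0, 0, 0, 1)].
Definition dx4 : R * R * R * R := (1, 0, 0, 0).

Variables a b c d : R.

Definition box_xy : set (R * R) := `[a, b] `*` `[c, d].
Definition box_xyt : set (R * R * R) := box_xy `*` `[a, b].
Definition box_xyv : set (R * R * R) := box_xy `*` `[c, d].
Definition box_xytv : set (R * R * R * R) := box_xyt `*` `[c, d].

Definition obox_xy : set (R * R) := `]a, b[ `*` `]c, d[.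
Definition obox_xyt : set (R * R * R) := obox_xy `*` `]a, b[.
Definition obox_xytv : set (R * R * R * R) := obox_xyt `*` `]c, d[.

End boxes.

(* Arguments are ordered (x, y), (x, y, theta) for [k10, k20], (x, y, nu) for
   [k01, k02], and (x, y, theta, nu). *)
Record kernel2D (R : realType) (n m : nat) := Kernel2D {
  k00 : R * R -> 'M[R]_(n, m);
  k01 : R * R * R -> 'M[R]_(n, m);
  k02 : R * R * R -> 'M[R]_(n, m);
  k10 : R * R * R -> 'M[R]_(n, m);
  k20 : R * R * R -> 'M[R]_(n, m);
  k11 : R * R * R * R -> 'M[R]_(n, m);
  k12 : R * R * R * R -> 'M[R]_(n, m);
  k21 : R * R * R * R -> 'M[R]_(n, m);
  k22 : R * R * R * R -> 'M[R]_(n, m) }.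

Section PI_operators.
Context {R : realType} {n m : nat}.
Variables a b c d : R.

Definition N2D (N : kernel2D R n m) :=
  [/\ mx_square_integrable (leb2 R) (box_xy a b c d) (k00 N),
      [/\ mx_square_integrable (leb3 R) (box_xyv a b c d) (k01 N)
        & mx_square_integrable (leb3 R) (box_xyv a b c d) (k02 N)],
      [/\ mx_square_integrable (leb3 R) (box_xyt a b c d) (k10 N)
        & mx_square_integrable (leb3 R) (box_xyt a b c d) (k20 N)]
    & [/\ mx_square_integrable (leb4 R) (box_xytv a b c d) (k11 N),
          mx_square_integrable (leb4 R) (box_xytv a b c d) (k12 N),
          mx_square_integrable (leb4 R) (box_xytv a b c d) (k21 N)
        & mx_square_integrable (leb4 R) (box_xytv a b c d) (k22 N)]].

Definition PI2D (N : kernel2D R n m) (u : R * R -> 'cV[R]_m) (z : R * R) :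
    'cV[R]_n :=
  let x := z.1 in let y := z.2 in
  k00 N (x, y) *m u (x, y)
  + mx_integral (leb R) `[a, x] (fun t => k10 N (x, y, t) *m u (t, y))
  + mx_integral (leb R) `[x, b] (fun t => k20 N (x, y, t) *m u (t, y))
  + mx_integral (leb R) `[c, y] (fun v => k01 N (x, y, v) *m u (x, v))
  + mx_integral (leb R) `[y, d] (fun v => k02 N (x, y, v) *m u (x, v))
  + mx_integral (leb R) `[a, x] (fun t =>
      mx_integral (leb R) `[c, y] (fun v => k11 N (x, y, t, v) *m u (t, v)))
  + mx_integral (leb R) `[x, b] (fun t =>
      mx_integral (leb R) `[c, y] (fun v => k21 N (x, y, t, v) *m u (t, v)))
  + mx_integral (leb R) `[a, x] (fun t =>
      mx_integral (leb R) `[y, d] (fun v => k12 N (x, y, t, v) *m u (t, v)))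
  + mx_integral (leb R) `[x, b] (fun t =>
      mx_integral (leb R) `[y, d] (fun v => k22 N (x, y, t, v) *m u (t, v))).

Definition kernel_H1_xyt (K : R * R * R -> 'M[R]_(n, m)) :=
  mx_H1 (leb3 R) chart3 (obox_xyt a b c d) basis3 K.

Definition kernel_H1_xytv (K : R * R * R * R -> 'M[R]_(n, m)) :=
  mx_H1 (leb4 R) chart4 (obox_xytv a b c d) basis4 K.

Definition is_dx_xyt (K L : R * R * R -> 'M[R]_(n, m)) :=
  mx_weak_derivative (leb3 R) chart3 (obox_xyt a b c d) [:: dx3] K L.

Definition is_dx_xytv (K L : R * R * R * R -> 'M[R]_(n, m)) :=
  mx_weak_derivative (leb4 R) chart4 (obox_xytv a b c d) [:: dx4] K L.

(* L(x, y) = K1(x, y, x) - K2(x, y, x) *)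
Definition is_jump_xyt (K1 K2 : R * R * R -> 'M[R]_(n, m))
    (L : R * R -> 'M[R]_(n, m)) :=
  exists G1 G2 : R * R * R -> 'M[R]_(n, m),
  [/\ continuous_version (leb3 R) chart3 (box_xyt a b c d) K1 G1,
      continuous_version (leb3 R) chart3 (box_xyt a b c d) K2 G2
    & L = (fun z => let: (x, y) := z in G1 (x, y, x) - G2 (x, y, x))
        %[ae leb2 R in box_xy a b c d]].

(* L(x, y, nu) = K1(x, y, x, nu) - K2(x, y, x, nu) *)
Definition is_jump_xytv (K1 K2 : R * R * R * R -> 'M[R]_(n, m))
    (L : R * R * R -> 'M[R]_(n, m)) :=
  exists G1 G2 : R * R * R * R -> 'M[R]_(n, m),
  [/\ continuous_version (leb4 R) chart4 (box_xytv a b c d) K1 G1,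
      continuous_version (leb4 R) chart4 (box_xytv a b c d) K2 G2
    & L = (fun z => let: (x, y, v) := z in G1 (x, y, x, v) - G2 (x, y, x, v))
        %[ae leb3 R in box_xyv a b c d]].

(* The kernels of the derivative, determined up to null sets. *)
Definition dx_kernels (N M : kernel2D R n m) :=
  [/\ is_jump_xyt (k10 N) (k20 N) (k00 M),
      is_jump_xytv (k11 N) (k21 N) (k01 M),
      is_jump_xytv (k12 N) (k22 N) (k02 M),
      [/\ is_dx_xyt (k10 N) (k10 M) & is_dx_xyt (k20 N) (k20 M)]
    & [/\ is_dx_xytv (k11 N) (k11 M), is_dx_xytv (k12 N) (k12 M),
          is_dx_xytv (k21 N) (k21 M) & is_dx_xytv (k22 N) (k22 M)]].

End PI_operators.

(* Main.v *)
(* Test PI[N] u against the x-derivative of a test function and use Fubini to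
   make x the innermost variable. For almost every value p of the other
   variables, the section x |-> K(x, p) of a kernel K of N is, up to a null set,
   the section of its continuous version, and this is an indefinite integral of
   the section of the weak derivative of K. Integrating by parts the two kernels
   over [t, b] and [a, t], the boundary terms at x = t add up to the jump of the
   continuous versions, hence to the kernels k00, k01, k02 of the derivative.

   The continuous version of an H1 function comes from a representation formula.
   In one variable, if w is smooth with compact support and integral 1, and
   k(x, s) = int_a^s w - 1_{s > x}, then f(x) = int w f + int k(x, s) f'(s) ds.
   Tensoring these kernels writes f as a sum of integrals of its mixed
   derivatives against bounded kernels; by dominated convergence each of them is
   continuous. That the sum agrees with f is checked on tensor products of
   one-variable test functions. *)
Require Import Defs.
From HB Require Import structures.
From mathcomp Require Import all_boot all_order all_algebra.
From mathcomp Require Import all_classical all_reals all_analysis.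
From mathcomp Require Import ring lra measurable_realfun.
Set Implicit Arguments.
Unset Strict Implicit.
Unset Printing Implicit Defensive.
Import Order.TTheory GRing.Theory Num.Theory numFieldNormedType.Exports.
Local Open Scope classical_set_scope.
Local Open Scope ring_scope.

(** The jump lives on theta = x, a null set, where almost everywhere information on a kernel and its
    weak derivative says nothing. On almost every section, however, the continuous version and the
    indefinite integral are both continuous on [a, b]; agreeing almost everywhere, they agree at
    every point, x = t included. For this the exceptional null set must not depend on the test
    function. Sections are therefore controlled through one identity on the product space, tested on
    products rho(p) phi(x).

    Kernels and states are extended by zero outside their boxes, and the moving limits of
    integration become 0-1 factors of the integrand, so that integrals run over whole spaces and
    Fubini meets no moving domain. The state depends on fewer variables than the kernel that it
    multiplies; the bounded boxes make the product integrable all the same. Density of test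
    functions and the representation formula are stated as properties of a class of functions that
    pass to tensor products, so that two, three and four variables are reached from one. *)

Notation L1 mu f := (mu.-integrable setT (EFin \o f)).

(** * Integrable real-valued functions *)

Section L1_theory.
Context d (T : measurableType d) (R : realType).
Variable mu : {measure set T -> \bar R}.
Implicit Types f g h : T -> R.

Lemma L1_measurable f : L1 mu f -> measurable_fun setT f.
Proof. by move=> /measurable_int /measurable_EFinP. Qed.

Lemma L1_patch D f : measurable D ->
  mu.-integrable D (EFin \o f) <-> L1 mu (f \_ D).
Proof. by move=> mD; rewrite -restrict_EFin; exact: integrable_mkcond. Qed.

Lemma L1_le f g : measurable_fun setT f -> (forall x, `|f x| <= `|g x|) ->
  L1 mu g -> L1 mu f.
Proof.
move=> mf fg; apply: le_integrable => //; first exact/measurable_EFinP.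
by move=> x _ /=; rewrite lee_fin.
Qed.

Lemma L1D f g : L1 mu f -> L1 mu g -> L1 mu (fun x => f x + g x).
Proof. by move=> lf lg; exact: (integrableD measurableT lf lg). Qed.

Lemma L1Z k f : L1 mu f -> L1 mu (fun x => k * f x).
Proof. by move=> lf; exact: (integrableZl measurableT k lf). Qed.

Lemma L1N f : L1 mu f -> L1 mu (fun x => - f x).
Proof. by move=> lf; exact: (integrableN lf). Qed.

Lemma L1B f g : L1 mu f -> L1 mu g -> L1 mu (fun x => f x - g x).
Proof. by move=> lf /L1N; exact: L1D. Qed.

Lemma L1_sum I (s : seq I) (F : I -> T -> R) :
  (forall i, L1 mu (F i)) -> L1 mu (fun x => \sum_(i <- s) F i x).
Proof.
move=> LF; elim: s => [|i s IH].
  by under eq_fun do rewrite big_nil; exact: integrable0.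
by under eq_fun do rewrite big_cons; exact: L1D.
Qed.

Lemma L1M_bounded h f : measurable_fun setT h ->
  (exists M, forall x, `|h x| <= M) -> L1 mu f -> L1 mu (fun x => h x * f x).
Proof.
move=> mh [M hM] lf; apply: (@integrableMr _ _ _ mu setT _ h (EFin \o f)) => //.
by exists M; split; [exact: num_real|move=> r Mr x _; exact: le_trans (hM x) (ltW Mr)].
Qed.

Lemma Rint_sum I (s : seq I) (F : I -> T -> R) :
  (forall i, L1 mu (F i)) ->
  \int[mu]_x (\sum_(i <- s) F i x) = \sum_(i <- s) \int[mu]_x F i x.
Proof.
move=> LF; elim: s => [|i s IH].
  by under eq_Rintegral do rewrite big_nil; rewrite big_nil Rintegral_cst// mul0r.
under eq_Rintegral do rewrite big_cons; rewrite big_cons.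
by rewrite RintegralD// ?IH//; exact: L1_sum.
Qed.

Lemma ae_eq_Rintegral f g : measurable_fun setT f -> measurable_fun setT g ->
  ae_eq mu setT f g -> \int[mu]_x f x = \int[mu]_x g x.
Proof.
move=> mf mg fg; congr fine; apply: ae_eq_integral => //; try exact/measurable_EFinP.
by apply: filterS fg => x + xT => ->.
Qed.

Lemma L1_ae_eq f g : measurable_fun setT g -> ae_eq mu setT f g ->
  L1 mu f -> L1 mu g.
Proof.
move=> mg fg lf; have mf := L1_measurable lf; apply/integrableP; split.
  exact/measurable_EFinP.
move/integrableP : lf => [_]; congr (_ < _)%E.
apply: ae_eq_integral => //.
- by apply/measurableT_comp => //; exact/measurable_EFinP.
- by apply/measurableT_comp => //; exact/measurable_EFinP.
- by apply: filterS fg => x /= + xT => ->.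
Qed.

Lemma L1_ae_zero f : L1 mu f ->
  (forall A, measurable A -> \int[mu]_(x in A) f x = 0) ->
  ae_eq mu setT f (cst 0).
Proof.
move=> lf f0; have : ae_eq mu setT (EFin \o f) (cst 0%E).
  apply: integral_ae_eq => // A _ mA.
  (* A real integral is [fine] of the extended one and is also 0 at infinite values; integrability
     rules these out. *)
  rewrite [RHS]integral0_eq// -[LHS]fineK; first by have := f0 _ mA; rewrite /Rintegral => ->.
  by apply: integrable_fin_num => //; exact: integrableS lf.
by apply: filterS => x /= /[apply] -[].
Qed.

End L1_theory.

Lemma Rint_zero d (T : measurableType d) (R : realType)
  (mu : {measure set T -> \bar R}) : \int[mu]_x (0 : R) = 0.
Proof. by rewrite /Rintegral integral0. Qed.

Lemma indic_bounded d (T : measurableType d) (R : realType) (A : set T) :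
  exists M : R, forall x, `|\1_A x : R| <= M.
Proof. by exists 1 => x; rewrite indicE; case: (_ \in _); rewrite ?normr1 ?normr0. Qed.

Lemma Rintegral_indic d (T : measurableType d) (R : realType)
    (mu : {measure set T -> \bar R}) (A : set T) (f : T -> R) :
  \int[mu]_(x in A) f x = \int[mu]_x (\1_A x * f x).
Proof.
rewrite Rintegral_mkcond; apply: eq_Rintegral => x _.
by rewrite patchE indicE; case: (x \in A); rewrite ?mul1r ?mul0r.
Qed.

Lemma L1_indic d (T : measurableType d) (R : realType)
    (mu : {measure set T -> \bar R}) (A : set T) :
  measurable A -> (mu A < +oo)%E -> L1 mu (\1_A : T -> R).
Proof.
move=> mA Aoo; apply/integrableP; split; first exact/measurable_EFinP.
rewrite (_ : (\int[mu]_x _)%E = (\int[mu]_x (\1_A x)%:E)%E).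
  by rewrite integral_indic// setIT.
by apply: eq_integral => x _; rewrite gee0_abs// lee_fin indicE.
Qed.

Lemma Rdominated_cvg d (T : measurableType d) (R : realType)
    (mu : {measure set T -> \bar R}) (f_ : nat -> T -> R) (f g : T -> R) :
  (forall n, measurable_fun setT (f_ n)) -> measurable_fun setT f ->
  {ae mu, forall x, f_ n x @[n --> \oo] --> f x} -> L1 mu g ->
  (forall n x, `|f_ n x| <= g x) ->
  \int[mu]_x f_ n x @[n --> \oo] --> \int[mu]_x f x.
Proof.
move=> mf_ mf f_f lg f_g.
have [|||||lf _ h] := @dominated_convergence _ _ _ mu setT measurableT
  (fun n => EFin \o f_ n) (EFin \o f) (EFin \o g).
- by move=> n; exact/measurable_EFinP.
- exact/measurable_EFinP.
- by apply: filterS f_f => x /= fx _; apply: cvg_EFin => //; exact: nearW.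
- exact: lg.
- by apply: aeW => x n _ /=; rewrite lee_fin.
have fin : (\int[mu]_x (f x)%:E)%E = (fine (\int[mu]_x (f x)%:E)%E)%:E.
  by rewrite fineK//; exact: integrable_fin_num.
apply: fine_cvg; rewrite /Rintegral -fin; exact: h.
Qed.

(** Dominated convergence speaks of sequences; this turns it into continuity on a normed space. A
    failure at [v] yields, by choice, points within 1/(n+1) of [v] whose images stay at distance
    [e]. *)
Lemma sequential_continuity (R : realType) (V W : normedModType R) (F : V -> W) v :
  (forall u : nat -> V, u n @[n --> \oo] --> v -> F (u n) @[n --> \oo] --> F v) ->
  {for v, continuous F}.
Proof.
move=> hF; apply/cvgrPdist_lt => e e0; apply: contrapT => h.
have hn (n : nat) : exists w, `|v - w| < n.+1%:R^-1 /\ e <= `|F v - F w|.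
  apply: contrapT => hn; apply: h.
  have : nbhs v (fun w => `|v - w| < n.+1%:R^-1).
    by apply/nbhs_ballP; exists n.+1%:R^-1 => [|w]; rewrite /= ?invr_gt0// -ball_normE.
  apply: filterS => w vw; rewrite ltNge; apply/negP => eF.
  by apply: hn; exists w.
have [u hu] := choice hn.
have /hF/cvgrPdist_lt/(_ e e0)[N _ /(_ N (leqnn N))/=] : u n @[n --> \oo] --> v.
  apply/cvgrPdist_lt => r r0; near=> n; apply: lt_trans (hu n).1 _.
  by near: n; exact: near_infty_natSinv_lt (PosNum r0).
by rewrite ltNge (hu N).2.
Unshelve. all: by end_near. Qed.

(** * Measure-preserving maps and product measures *)

Section measure_preserving.
Context d1 d2 (X : measurableType d1) (Y : measurableType d2) (R : realType).

Definition measure_preserving (mu : {measure set X -> \bar R})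
    (nu : {measure set Y -> \bar R}) (phi : X -> Y) :=
  measurable_fun setT phi /\
  forall A, measurable A -> mu (phi @^-1` A) = nu A.

Variables (mu : {measure set X -> \bar R}) (nu : {measure set Y -> \bar R}).
Variable phi : X -> Y.
Hypothesis mp : measure_preserving mu nu phi.

Lemma mp_L1 f : L1 nu f -> L1 mu (f \o phi).
Proof.
case: mp => mphi phiE lf; have mf := L1_measurable lf.
apply/integrableP; split; first exact/measurable_EFinP/measurableT_comp.
move/integrableP : lf => [_]; congr (_ < _)%E.
have -> : (\int[nu]_x `|(EFin \o f) x|)%E =
    (\int[pushforward mu phi]_x `|(EFin \o f) x|)%E.
  by apply: eq_measure_integral => // A mA _; rewrite -phiE.
rewrite ge0_integral_pushforward//.
by apply/measurableT_comp => //; exact/measurable_EFinP.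
Qed.

Lemma mp_Rint f : L1 nu f -> \int[nu]_x f x = \int[mu]_x f (phi x).
Proof.
case: (mp) => mphi phiE lf; have mf := L1_measurable lf; congr fine.
have -> : (\int[nu]_x (EFin \o f) x)%E =
    (\int[pushforward mu phi]_x (EFin \o f) x)%E.
  by apply: eq_measure_integral => // A mA _; rewrite -phiE.
by rewrite integral_pushforward//; [exact/measurable_EFinP|exact: mp_L1].
Qed.

Lemma mp_ae (P : set Y) : {ae nu, forall y, P y} -> {ae mu, forall x, P (phi x)}.
Proof.
case: (mp) => mphi phiE [N [mN N0 NP]]; exists (phi @^-1` N); split.
- by rewrite -[X in measurable X]setTI; exact: mphi.
- by rewrite phiE.
- by move=> x /= nP; apply: NP.
Qed.

End measure_preserving.

(* In the library, the instance of subprobability measure on products shadows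
   the instance of sigma-finite measure. *)
Section sigma_finite_pack.
Context d (T : measurableType d) (R : realType).
Variables (m : {measure set T -> \bar R}) (sfm : sigma_finite setT m).

Definition sigma_finite_pack & sigma_finite setT m : set T -> \bar R := m.

HB.instance Definition _ := Measure.copy (sigma_finite_pack sfm) m.
HB.instance Definition _ :=
  Measure_isSigmaFinite.Build _ _ _ (sigma_finite_pack sfm) sfm.

End sigma_finite_pack.

Section sigma_finite_products.
Context d1 d2 (T1 : measurableType d1) (T2 : measurableType d2) (R : realType).

Lemma sigma_finite_prod (m1 : {measure set T1 -> \bar R})
    (m2 : {sigma_finite_measure set T2 -> \bar R}) :
  sigma_finite setT m1 -> sigma_finite setT (m1 \x m2)%E.
Proof.
move=> /sigma_finiteP[F [TF ndF Foo]].
have /sigma_finiteP[G [TG ndG Goo]] := sigma_finiteT m2.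
exists (fun n => F n `*` G n).
  rewrite -setXTT TF TG predeqE => -[x y]; split.
    (* Both exhausting sequences are nondecreasing, so the larger index serves both coordinates. *)
    move=> [/= [n _ Fnx] [k _ Gky]]; exists (maxn n k) => //; split.
    - by move: x Fnx; exact/subsetPset/ndF/leq_maxl.
    - by move: y Gky; exact/subsetPset/ndG/leq_maxr.
  by move=> [n _ []/= ? ?]; split; exists n.
move=> k; have [? ?] := Foo k; have [? ?] := Goo k.
split; first exact: measurableX.
by rewrite product_measure1E// lte_mul_pinfty// ge0_fin_numE.
Qed.

Lemma product_measure_eq (m1 : {measure set T1 -> \bar R})
    (m2 : {sigma_finite_measure set T2 -> \bar R})
    (m' : {measure set (T1 * T2) -> \bar R}) :
  sigma_finite setT m1 ->
  (forall A B, measurable A -> measurable B -> m' (A `*` B) = m1 A * m2 B)%E ->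
  forall A, measurable A -> m' A = (m1 \x m2)%E A.
Proof.
move=> sf1 mE A mA.
by rewrite -(@product_measure_unique _ _ _ _ _ (sigma_finite_pack sf1) m2 m' mE).
Qed.

End sigma_finite_products.

Section product_rearrangements.
Context d1 d2 d3 (T1 : measurableType d1) (T2 : measurableType d2)
  (T3 : measurableType d3) (R : realType).

Lemma mp_swap (m1 : {sigma_finite_measure set T1 -> \bar R})
    (m2 : {sigma_finite_measure set T2 -> \bar R}) :
  measure_preserving (m2 \x m1)%E (m1 \x m2)%E (fun z => (z.2, z.1)).
Proof.
have ms : measurable_fun [set: T2 * T1] (fun z => (z.2, z.1)).
  exact: measurable_fun_pair.
split => // A mA; apply: (@product_measure_eq _ _ _ _ _ m1 m2
  [the {measure set _ -> \bar R} of pushforward (m2 \x m1)%E (fun z => (z.2, z.1))]) => //.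
- exact: sigma_finiteT.
- move=> B C mB mC /=; rewrite /pushforward muleC -product_measure1E//; congr (_ _).
  by apply/seteqP; split => -[x y] /= [].
Qed.

(** By uniqueness of product measures only sets [B] times [C] have to be compared, but [B] is an
    arbitrary measurable set of the first product, not a rectangle; Tonelli computes the measure of
    the preimage. *)
Lemma mp_swap_last (m1 : {measure set T1 -> \bar R})
    (m2 : {sigma_finite_measure set T2 -> \bar R})
    (m3 : {sigma_finite_measure set T3 -> \bar R}) :
  sigma_finite setT m1 ->
  measure_preserving (m1 \x m3 \x m2)%E (m1 \x m2 \x m3)%E
    (fun z => (z.1.1, z.2, z.1.2)).
Proof.
move=> sf1.
have ms : measurable_fun [set: T1 * T3 * T2] (fun z => (z.1.1, z.2, z.1.2)).
  apply/measurable_fun_pairP; split => /=; last first.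
    exact: (measurableT_comp measurable_snd measurable_fst).
  apply/measurable_fun_pairP; split; last exact: measurable_snd.
  exact: (measurableT_comp measurable_fst measurable_fst).
split => // A mA; apply: (@product_measure_eq _ _ _ _ _ (m1 \x m2)%E m3
  [the {measure set _ -> \bar R} of pushforward (m1 \x m3 \x m2)%E
    (fun z => (z.1.1, z.2, z.1.2))]) => //.
- exact: sigma_finite_prod.
- move=> B C mB mC /=.
  have mBx : measurable_fun setT (m2 \o xsection B) by exact: measurable_fun_xsection.
  rewrite /pushforward.
  (* The section of the preimage over (x, t) is the section of [B] over x if t lies in [C], and
     empty otherwise. *)
  transitivity (\int[(m1 \x m3)%E]_z (m2 (xsection B z.1) * (\1_C z.2)%:E))%E.
    apply: eq_integral => -[x t] _ /=.
    rewrite indicE; have [tC|tC] := boolP (t \in C).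
      rewrite mule1; congr (m2 _); apply/seteqP; split => y; rewrite /xsection/= !inE/=.
        by case.
      by move=> ?; split => //; exact: set_mem.
    rewrite mule0 -(measure0 m2); congr (m2 _); apply/seteqP; split => // y.
    by rewrite /xsection/= !inE/= => -[_]; rewrite notin_setE in tC.
  rewrite (@fubini_tonelli1 _ _ _ _ _ (sigma_finite_pack sf1) m3); last 2 first.
  - apply: emeasurable_funM; first exact: (measurableT_comp mBx measurable_fst).
    apply/measurable_EFinP.
    exact: (measurableT_comp (measurable_indic mC) measurable_snd).
  - by move=> z; rewrite mule_ge0.
  rewrite /product_measure1 -ge0_integralZr//.
  apply: eq_integral => x _ /=; rewrite /fubini_F/= ge0_integralZl//.
    by rewrite integral_indic// setIT.
  exact/measurable_EFinP.
Qed.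

Lemma mp_first (mu : {measure set T1 -> \bar R}) (nu : {measure set T2 -> \bar R})
    (rho : {sigma_finite_measure set T3 -> \bar R}) (phi : T1 -> T2) :
  sigma_finite setT nu ->
  measure_preserving mu nu phi ->
  measure_preserving (mu \x rho)%E (nu \x rho)%E (fun z => (phi z.1, z.2)).
Proof.
move=> sfn [mphi phiE].
have mphi1 : measurable_fun [set: T1 * T3] (fun z => (phi z.1, z.2)).
  by apply: measurable_fun_pair => //; exact: measurableT_comp.
split => // A mA; apply: (@product_measure_eq _ _ _ _ _ nu rho
  [the {measure set _ -> \bar R} of pushforward (mu \x rho)%E
    (fun z => (phi z.1, z.2))]) => //.
move=> B C mB mC /=; rewrite /pushforward -phiE// -product_measure1E//.
by rewrite -[X in measurable X]setTI; exact: mphi.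
Qed.

Lemma mp_comp (mu : {measure set T1 -> \bar R}) (nu : {measure set T2 -> \bar R})
    (rho : {measure set T3 -> \bar R}) (phi : T1 -> T2) (psi : T2 -> T3) :
  measure_preserving mu nu phi -> measure_preserving nu rho psi ->
  measure_preserving mu rho (psi \o phi).
Proof.
move=> [mphi phiE] [mpsi psiE]; split; first exact: measurableT_comp.
move=> A mA; rewrite -psiE// -phiE//.
by rewrite -[X in measurable X]setTI; exact: mpsi.
Qed.

End product_rearrangements.

(** * Fubini's theorem for real-valued integrals *)

Section Fubini_real.
Context d1 d2 (T1 : measurableType d1) (T2 : measurableType d2) (R : realType).
Variable m1 : {measure set T1 -> \bar R}.
Variable m2 : {sigma_finite_measure set T2 -> \bar R}.
Hypothesis sf1 : sigma_finite setT m1.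
Let n1 := [the {sigma_finite_measure set T1 -> \bar R} of sigma_finite_pack sf1].
Implicit Types f : T1 * T2 -> R.

Lemma abse_EFin_fine_le (x : \bar R) : (`|(fine x)%:E| <= `|x|)%E.
Proof. by case: x => [r| |] //=; rewrite normr0 leey. Qed.

Lemma L1_fubini1 f : L1 (m1 \x m2)%E f -> L1 m1 (fun x => \int[m2]_y f (x, y)).
Proof.
move=> lf; have iF := @integrable_fubini_F _ _ _ _ _ n1 m2 _ lf.
apply: le_integrable iF => //.
  apply: measurableT_comp => //; apply: measurableT_comp => //.
  exact: (@measurable_fubini_F _ _ _ _ _ n1 m2 _ lf).
by move=> x _; exact: abse_EFin_fine_le.
Qed.

(** The inner real integral is [fine] of the extended one. The two differ only where the latter is
    infinite, which happens on a null set. *)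
Lemma Rfubini1 f : L1 (m1 \x m2)%E f ->
  \int[m1]_x \int[m2]_y f (x, y) = \int[(m1 \x m2)%E]_z f z.
Proof.
move=> lf; have iF := @integrable_fubini_F _ _ _ _ _ n1 m2 _ lf.
rewrite [RHS]/Rintegral -(@integral12_prod_meas1 _ _ _ _ _ n1 m2 _ lf).
congr fine; apply: ae_eq_integral => //.
- exact: measurable_int (L1_fubini1 lf).
- exact: (@measurable_fubini_F _ _ _ _ _ n1 m2 _ lf).
have := @integrable_ae _ _ _ m1 _ measurableT _ iF.
by apply: filterS => x /= + _ => /(_ I) h; rewrite /Rintegral/= fineK.
Qed.

End Fubini_real.

Section Fubini_real2.
Context d1 d2 (T1 : measurableType d1) (T2 : measurableType d2) (R : realType).
Variable m1 : {measure set T1 -> \bar R}.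
Variable m2 : {sigma_finite_measure set T2 -> \bar R}.
Hypothesis sf1 : sigma_finite setT m1.
Let n1 := [the {sigma_finite_measure set T1 -> \bar R} of sigma_finite_pack sf1].
Implicit Types f : T1 * T2 -> R.

Lemma L1_fubini2 f : L1 (m1 \x m2)%E f -> L1 m2 (fun y => \int[m1]_x f (x, y)).
Proof.
move=> lf; have := mp_L1 (mp_swap n1 m2) (lf : L1 (n1 \x m2)%E f).
by move/(L1_fubini1 (sigma_finiteT m2)).
Qed.

Lemma Rfubini2 f : L1 (m1 \x m2)%E f ->
  \int[m2]_y \int[m1]_x f (x, y) = \int[(m1 \x m2)%E]_z f z.
Proof.
move=> lf; have lf' := lf : L1 (n1 \x m2)%E f.
have := Rfubini1 (sigma_finiteT m2) (mp_L1 (mp_swap n1 m2) lf').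
by rewrite -(mp_Rint (mp_swap n1 m2) lf').
Qed.

Lemma L1_fst_mul (h : T1 -> R) f : measurable_fun setT h ->
  (exists M, forall x, `|h x| <= M) -> L1 (m1 \x m2)%E f ->
  L1 (m1 \x m2)%E (fun z => h z.1 * f z).
Proof.
move=> mh [M hM] lf; apply: L1M_bounded => //; last by exists M.
exact: (measurableT_comp mh measurable_fst).
Qed.

Lemma L1_snd_mul (h : T2 -> R) f : measurable_fun setT h ->
  (exists M, forall x, `|h x| <= M) -> L1 (m1 \x m2)%E f ->
  L1 (m1 \x m2)%E (fun z => h z.2 * f z).
Proof.
move=> mh [M hM] lf; apply: L1M_bounded => //; last by exists M.
exact: (measurableT_comp mh measurable_snd).
Qed.

Lemma Rfubini1_mul (h : T1 -> R) f : measurable_fun setT h ->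
  (exists M, forall x, `|h x| <= M) -> L1 (m1 \x m2)%E f ->
  \int[m1]_x (h x * \int[m2]_y f (x, y)) = \int[(m1 \x m2)%E]_z (h z.1 * f z).
Proof.
move=> mh bh lf; have lhf := L1_fst_mul mh bh lf.
rewrite -(Rfubini1 sf1 lhf); apply: ae_eq_Rintegral.
- apply: measurable_funM => //; exact: L1_measurable (L1_fubini1 sf1 lf).
- exact: L1_measurable (L1_fubini1 sf1 lhf).
- have := @ae_integrable1 _ _ _ _ _ n1 m2 _ lf.
  by apply: filterS => x /= fx _; rewrite RintegralZl.
Qed.

Lemma Rfubini2_mul (h : T2 -> R) f : measurable_fun setT h ->
  (exists M, forall x, `|h x| <= M) -> L1 (m1 \x m2)%E f ->
  \int[m2]_y (h y * \int[m1]_x f (x, y)) = \int[(m1 \x m2)%E]_z (h z.2 * f z).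
Proof.
move=> mh bh lf; have lhf := L1_snd_mul mh bh lf.
rewrite -(Rfubini2 lhf); apply: ae_eq_Rintegral.
- apply: measurable_funM => //; exact: L1_measurable (L1_fubini2 lf).
- exact: L1_measurable (L1_fubini2 lhf).
- have := @ae_integrable2 _ _ _ _ _ n1 m2 _ lf.
  by apply: filterS => x /= fx _; rewrite RintegralZl.
Qed.

Lemma L1_tensor (f : T1 -> R) (g : T2 -> R) : L1 m1 f -> L1 m2 g ->
  L1 (m1 \x m2)%E (fun z => f z.1 * g z.2).
Proof.
move=> lf lg; have mf := L1_measurable lf; have mg := L1_measurable lg.
have mfg : measurable_fun setT (fun z : T1 * T2 => f z.1 * g z.2).
  by apply: measurable_funM; apply: measurableT_comp.
apply/(@integrable12ltyP _ _ _ _ _ n1 m2); first exact/measurable_EFinP.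
under eq_integral => x _.
  under eq_integral => y _ do rewrite /= normrM EFinM.
  rewrite ge0_integralZl//; last by apply/measurable_EFinP/measurableT_comp.
  over.
rewrite ge0_integralZr//; last 2 first.
- by apply/measurable_EFinP/measurableT_comp.
- exact: integral_ge0.
move/integrableP : lf => [_ lf]; move/integrableP : lg => [_ lg].
by rewrite lte_mul_pinfty// ?integral_ge0// ge0_fin_numE ?integral_ge0.
Qed.

Lemma Rint_tensor (f : T1 -> R) (g : T2 -> R) : L1 m1 f -> L1 m2 g ->
  \int[(m1 \x m2)%E]_z (f z.1 * g z.2) = (\int[m1]_x f x) * (\int[m2]_y g y).
Proof.
move=> lf lg; rewrite -Rfubini1//; last exact: L1_tensor.
under eq_Rintegral => x _ do rewrite /= RintegralZl//.
by rewrite RintegralZr.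
Qed.

(** The sets over which [f] integrates to zero form a Dynkin system. It contains the measurable
    rectangles, which are stable under intersection and generate the product sigma-algebra. *)
Lemma L1_prod_ae_zero f : L1 (m1 \x m2)%E f ->
  (forall A B, measurable A -> measurable B ->
    \int[(m1 \x m2)%E]_(z in A `*` B) f z = 0) ->
  ae_eq (m1 \x m2)%E setT f (cst 0).
Proof.
move=> lf f0; apply: L1_ae_zero => //.
have lfA A : measurable A -> (m1 \x m2)%E.-integrable A (EFin \o f).
  by move=> mA; apply: integrableS lf.
have fT : \int[(m1 \x m2)%E]_z f z = 0 by rewrite -setXTT f0.
rewrite measurable_prod_measurableType.
apply: (@dynkin_induction _ _ _ (fun X => \int[(m1 \x m2)%E]_(x in X) f x = 0)) => //.
- by rewrite measurable_prod_measurableType.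
- move=> _ _ [A1 mA1 [A2 mA2 <-]] [B1 mB1 [B2 mB2 <-]].
  exists (A1 `&` B1); first exact: measurableI.
  by exists (A2 `&` B2); [exact: measurableI|rewrite setXI].
- by move=> _ [A mA [B mB <-]]; exact: f0.
- move=> A mA A0; have := fT; rewrite -(setUv A) Rintegral_setU//.
  + by rewrite A0 add0r.
  + exact: measurableC.
  + by rewrite setUv.
  + by rewrite disj_set2E setICr.
- move=> F mF tF F0; rewrite /Rintegral integral_bigcup//; last first.
    by apply: lfA; exact: bigcup_measurable.
  rewrite eseries0// => i _ _.
  rewrite -[LHS]fineK; first by have := F0 i; rewrite /Rintegral => ->.
  by apply: integrable_fin_num => //; exact: lfA.
Qed.

End Fubini_real2.

(** * Smooth functions and bumps *)

Section smooth_functions.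
Context {R : realType}.
Implicit Types U V : normedModType R.

(** Smoothness concerns all iterated derivatives at once. Placing a function in a class stable under
    directional derivatives does the induction on the list of directions once and for all. *)
Lemma smooth_class V (C : set (V -> R)) :
  (forall f, C f -> continuous f) ->
  (forall f z v, C f -> derivable f z v) ->
  (forall f v, C f -> C ('D_v f)) -> forall f, C f -> smooth f.
Proof.
move=> cC dC DC f Cf vs; have Cvs : C (iter_derive vs f).
  by elim: vs => //= v vs; exact: DC.
by split=> [|z v]; [exact: cC|exact: dC].
Qed.

Lemma smooth_continuous V (f : V -> R) : smooth f -> continuous f.
Proof. by move=> /(_ [::])[]. Qed.

Lemma smooth_derivable V (f : V -> R) z v : smooth f -> derivable f z v.
Proof. by move=> /(_ [::])[_]; exact. Qed.

Lemma smooth_derive V (f : V -> R) v : smooth f -> smooth ('D_v f).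
Proof.
by move=> sf vs; have := sf (rcons vs v); rewrite /iter_derive foldr_rcons.
Qed.

(** The Leibniz rule produces sums of products, so sums and products have to be treated together, in
    one class stable under both. *)
Inductive smooth_algebra V : (V -> R) -> Prop :=
| smooth_alg f : smooth f -> smooth_algebra f
| smooth_algD f g : smooth_algebra f -> smooth_algebra g ->
    smooth_algebra (fun z => f z + g z)
| smooth_algM f g : smooth_algebra f -> smooth_algebra g ->
    smooth_algebra (fun z => f z * g z).

Lemma smooth_algebra_smooth V (f : V -> R) : smooth_algebra f -> smooth f.
Proof.
have dC (g : V -> R) z v : smooth_algebra g -> derivable g z v.
  elim=> {g}[g|g h _ dg _ dh|g h _ dg _ dh].
  - exact: smooth_derivable.
  - exact: (derivableD dg dh).
  - exact: (derivableM dg dh).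
apply: smooth_class => // g.
- elim=> {g}[g|g h _ cg _ ch|g h _ cg _ ch].
  + exact: smooth_continuous.
  + by move=> z; apply: continuousD; [exact: cg|exact: ch].
  + by move=> z; apply: continuousM; [exact: cg|exact: ch].
- move=> v; elim=> {g}[g|g h sg Dg sh Dh|g h sg Dg sh Dh].
  + by move=> /(smooth_derive v); exact: smooth_alg.
  + rewrite (_ : 'D_v _ = fun z => 'D_v g z + 'D_v h z).
      exact: smooth_algD.
    by apply/funext => z; rewrite deriveD//; exact: dC.
  + rewrite (_ : 'D_v _ = fun z => g z * 'D_v h z + h z * 'D_v g z).
      by apply: smooth_algD; exact: smooth_algM.
    by apply/funext => z; rewrite deriveM//; exact: dC.
Qed.

Lemma smoothD V (f g : V -> R) :
  smooth f -> smooth g -> smooth (fun z => f z + g z).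
Proof.
by move=> sf sg; apply/smooth_algebra_smooth/smooth_algD; exact: smooth_alg.
Qed.

Lemma smoothM V (f g : V -> R) :
  smooth f -> smooth g -> smooth (fun z => f z * g z).
Proof.
by move=> sf sg; apply/smooth_algebra_smooth/smooth_algM; exact: smooth_alg.
Qed.

Lemma smooth_cst V (r : R) : smooth (fun _ : V => r).
Proof.
apply: (@smooth_class V [set f | exists r, f = cst r]); last by exists r.
- by move=> _ [{}r ->]; exact: cst_continuous.
- by move=> _ z v [{}r ->]; exact: derivable_cst.
- move=> _ v [{}r ->]; exists 0.
  by apply/funext => z; exact: derive_cst.
Qed.

Section affine_composition.
Context {U V : normedModType R} (T L : U -> V).
Hypothesis cT : continuous T.
Hypothesis TL : forall h v z, T (h *: v + z) = h *: L v + T z.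

(** By [TL] both difference quotients are the same function of [h], so the equality does not depend
    on the existence of the limit. *)
Lemma derive_affine (f : V -> R) v z : 'D_v (f \o T) z = 'D_(L v) f (T z).
Proof.
rewrite /derive; suff -> : (fun h => h^-1 *: ((f \o T \o shift z) (h *: v) - (f \o T) z)) =
  (fun h => h^-1 *: ((f \o shift (T z)) (h *: L v) - f (T z))) by [].
by apply/funext => h /=; rewrite TL.
Qed.

Lemma derivable_affine (f : V -> R) v z :
  derivable f (T z) (L v) -> derivable (f \o T) z v.
Proof.
rewrite /derivable; suff -> : (fun h => h^-1 *: ((f \o T \o shift z) (h *: v) - (f \o T) z)) =
  (fun h => h^-1 *: ((f \o shift (T z)) (h *: L v) - f (T z))) by [].
by apply/funext => h /=; rewrite TL.
Qed.

Lemma smooth_affine (f : V -> R) : smooth f -> smooth (f \o T).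
Proof.
move=> sf; apply: (@smooth_class U [set g | exists2 f, smooth f & g = f \o T]).
- move=> _ [g sg ->] z; apply: continuous_comp; first exact: cT.
  exact: smooth_continuous.
- by move=> _ z v [g sg ->]; apply: derivable_affine; exact: smooth_derivable.
- move=> _ v [g sg ->]; exists ('D_(L v) g); first exact: smooth_derive.
  by apply/funext => z; exact: derive_affine.
- by exists f.
Qed.

End affine_composition.

End smooth_functions.

Section flat_function.
Context {R : realType}.

(** Each monomial satisfies y^i <= i! exp(y), by comparison with one term of the exponential
    series. *)
Lemma horner_le_expR (p : {poly R}) :
  exists C : R, forall y, 0 < y -> `|p.[y]| <= C * expR y.
Proof.
exists (\sum_(i < size p) `|p`_i| * i`!%:R) => y y0.
rewrite horner_coef mulr_suml (le_trans (ler_norm_sum _ _ _))//.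
apply: ler_sum => i _; rewrite normrM normrX (gtr0_norm y0) -mulrA ler_wpM2l//.
case: (nat_of_ord i) => [|n].
  by rewrite expr0 fact0 mul1r -expR0 ler_expR ltW.
have h := expR_ge1Dxn n (ltW y0).
have n0 : (0 : R) < n.+1`!%:R by rewrite ltr0n fact_gt0.
rewrite -(ler_pdivrMl _ _ n0) mulrC.
by rewrite (le_trans _ h)// lerDr.
Qed.

(** The polynomial in 1/x makes the family stable under differentiation, as [smooth_class]
    requires. *)
Definition flat (p : {poly R}) (x : R) : R :=
  if 0 < x then p.[x^-1] * expR (- x^-1) else 0.

(** A quadratic bound makes the difference quotients at 0 tend to 0. It is the exponential bound for
    [p * 'X^2], taken at 1/x. *)
Lemma flat_le (p : {poly R}) :
  exists2 C : R, 0 < C & forall x, `|flat p x| <= C * x ^+ 2.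
Proof.
have [C hC] := horner_le_expR (p * 'X^2).
exists (`|C| + 1) => [|x]; first by rewrite ltr_wpDl.
rewrite /flat; case: ifPn => [x0|_]; last first.
  by rewrite normr0 mulr_ge0 ?sqr_ge0// ltW// ltr_wpDl.
have := hC x^-1; rewrite invr_gt0 => /(_ x0).
rewrite hornerM hornerXn normrM (ger0_norm (sqr_ge0 _)).
rewrite normrM (gtr0_norm (expR_gt0 _)) expRN ler_pdivrMr ?expR_gt0//.
rewrite exprVn ler_pdivrMr ?exprn_gt0// => /le_trans; apply.
rewrite [leRHS]mulrAC ler_pM2r ?exprn_gt0// ler_pM2r ?expR_gt0//.
by rewrite (le_trans (ler_norm C))// lerDl.
Qed.

(** The derivative of p(1/x) exp(-1/x) in the same form: both factors contribute 1/x^2, with a minus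
    sign for p(1/x). *)
Definition flat_diff (p : {poly R}) : {poly R} := (p - p^`()) * 'X^2.

Lemma is_derive_dir (f : R -> R) (x v a : R) :
  is_derive x (1 : R) f a -> is_derive x v f (v * a).
Proof.
move=> [df <-]; move/derivable1_diffP : (df) => dif; apply: DeriveDef.
  exact: diff_derivable.
rewrite !deriveE//; have {1}-> : v = v *: (1 : R) by rewrite /GRing.scale/= mulr1.
by rewrite linearZ.
Qed.

Lemma is_derive_flat0 (p : {poly R}) : is_derive (0 : R) (1 : R) (flat p) 0.
Proof.
have [C C0 hC] := flat_le p.
have h0 : (fun h : R => h^-1 *: ((flat p \o shift (0 : R)) (h *: (1 : R)) - flat p 0))
    @ (0 : R)^' --> (0 : R).
  apply/cvgrPdist_lt => e e0; near=> h.
  have hN0 : h != 0 by near: h; exact: nbhs_dnbhs_neq.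
  rewrite sub0r normrN /flat/= ltxx subr0 addr0 /GRing.scale/= mulr1.
  rewrite -/(flat p h) normrM normfV mulrC ltr_pdivrMr ?normr_gt0//.
  rewrite (le_lt_trans (hC h))// -(real_normK (num_real h)) expr2 mulrA ltr_pM2r ?normr_gt0//.
  rewrite mulrC -ltr_pdivlMr//.
  near: h; apply: dnbhs0_lt.
  by rewrite divr_gt0.
by apply: DeriveDef; [apply/cvg_ex; exists 0|exact/cvg_lim].
Unshelve. all: by end_near. Qed.

Lemma is_derive_flat (p : {poly R}) (x : R) :
  is_derive x (1 : R) (flat p) (flat (flat_diff p) x).
Proof.
have [x0|x0|->] := ltgtP x 0.
- rewrite [X in is_derive _ _ _ X](_ : _ = 0); last by rewrite /flat ltNge ltW.
  apply: (@near_eq_is_derive _ _ _ (cst 0)) => //.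
  near=> y; rewrite /flat; have y0 : y < 0 by near: y; exact: lt_nbhsl.
  by rewrite ltNge ltW.
- rewrite /flat x0.
  have xN0 : x != 0 by rewrite gt_eqF.
  have dV : is_derive x (1 : R) (GRing.inv : R -> R) (- x ^- 2).
    apply: is_derive_eq; first exact: (is_deriveV xN0).
    by rewrite /GRing.scale/= mulr1.
  have dp : is_derive x^-1 (1 : R) (horner p) (p^`()).[x^-1].
    apply: DeriveDef; first exact: derivable_horner.
    by rewrite -derive1E -derivE.
  have dc := is_derive1_comp dp dV.
  have dN := is_deriveN dV.
  have de := @is_derive1_comp _ expR _ x _ _ (is_derive_expR _) dN.
  have dg := is_deriveM dc de.
  apply: (near_eq_is_derive _ (is_derive_eq dg _)).
    near=> y; have y0 : 0 < y by near: y; exact: lt_nbhsr.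
    by rewrite /flat y0.
  rewrite /GRing.scale/= /flat_diff !fctE hornerM hornerXn hornerD hornerN /=.
  rewrite exprVn; ring.
- rewrite [X in is_derive _ _ _ X](_ : _ = 0); last by rewrite /flat ltxx.
  exact: is_derive_flat0.
Unshelve. all: by end_near. Qed.

Lemma smooth_flat (p : {poly R}) : smooth (flat p).
Proof.
have dv (q : {poly R}) (x v : R) : is_derive x v (flat q) (flat (v%:P * flat_diff q) x).
  apply: is_derive_eq; first exact: (is_derive_dir _ (is_derive_flat q x)).
  by rewrite /flat; case: ifP => _; rewrite ?mulr0// hornerCM mulrA.
apply: (@smooth_class _ _ [set f | exists p, f = flat p]); last by exists p.
- move=> _ [q ->] x; apply: differentiable_continuous.
  by apply/derivable1_diffP; have [] := dv q x 1.
- by move=> _ z v [q ->]; have [] := dv q z v.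
- move=> _ v [q ->]; exists (v%:P * flat_diff q).
  by apply/funext => x; rewrite (@derive_val _ _ _ _ _ _ _ (dv q x v)).
Qed.

End flat_function.

Section bump.
Context {R : realType}.

(* [flat 1] is exp(-1/x) on the positive reals. *)
Definition bump (l p q x : R) : R :=
  flat 1 (l * (x - p)) * flat 1 (l * (q - x)).

Lemma flat1 (x : R) : flat 1 x = if 0 < x then expR (- x^-1) else 0.
Proof. by rewrite /flat hornerC mul1r. Qed.

Lemma flat1_ge0 (x : R) : 0 <= flat 1 x.
Proof. by rewrite flat1; case: ifP => // _; exact: expR_ge0. Qed.

Lemma flat1_le1 (x : R) : flat 1 x <= 1.
Proof.
rewrite flat1; case: ifPn => // x0.
by rewrite -expR0 ler_expR lerNl oppr0 invr_ge0 ltW.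
Qed.

Lemma smooth_bump l p q : smooth (bump l p q).
Proof.
apply: smoothM.
- apply: (@smooth_affine _ _ _ (fun x : R => l * (x - p)) (fun v => l * v)) => //.
  + move=> x; apply: cvgMr; apply: cvgB; [exact: cvg_id|exact: cvg_cst].
  + by move=> h v z; rewrite /GRing.scale/=; ring.
  + exact: smooth_flat.
- apply: (@smooth_affine _ _ _ (fun x : R => l * (q - x)) (fun v => - l * v)) => //.
  + move=> x; apply: cvgMr; apply: cvgB; [exact: cvg_cst|exact: cvg_id].
  + by move=> h v z; rewrite /GRing.scale/=; ring.
  + exact: smooth_flat.
Qed.

Lemma bump_ge0 l p q x : 0 <= bump l p q x.
Proof. by rewrite mulr_ge0// flat1_ge0. Qed.

Lemma bump_le1 l p q x : bump l p q x <= 1.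
Proof. by rewrite mulr_ile1 ?flat1_ge0// flat1_le1. Qed.

Lemma bump_out l p q x : 0 <= l -> ~~ (p < x < q) -> bump l p q x = 0.
Proof.
move=> l0; rewrite /bump negb_and -!leNgt => /orP[xp|qx]; rewrite !flat1.
  by rewrite ifF ?mul0r// ltNge mulr_ge0_le0// subr_le0.
by rewrite [X in _ * X]ifF ?mulr0// ltNge mulr_ge0_le0// subr_le0.
Qed.

Lemma bump_gt0 l p q x : 0 < l -> p < x < q -> 0 < bump l p q x.
Proof.
move=> l0 /andP[px xq]; rewrite /bump !flat1 !mulr_gt0 ?subr_gt0//.
  exact: expR_gt0.
exact: expR_gt0.
Qed.

End bump.

Lemma test_function_compact (R : realType) (V : normedModType R)
    (Omega K : set V) (phi : V -> R) :
  smooth phi -> compact K -> K `<=` Omega ->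
  (forall z, ~ K z -> phi z = 0) -> test_function Omega phi.
Proof.
move=> sphi cK KO phi0.
have clK : closure [set z | phi z != 0] `<=` K.
  have := compact_closed (@norm_hausdorff _ V) cK.
  move=> /closure_id clK; rewrite [X in _ `<=` X]clK; apply: closure_subset => z /=.
  by apply: contra_neqP; exact: phi0.
split => //; last exact: subset_trans KO.
apply: subclosed_compact cK clK; exact: closed_closure.
Qed.

(** * Test functions on an interval *)

Section test_functions_on_interval.
Context {R : realType}.
Local Notation mu := (@lebesgue_measure R).

(** Explicit points [p] and [q] record the compact support; sums, primitives and derivatives carry
    them along more easily than a closure. *)
Definition tests1 (a b : R) : set (R -> R) := [set phi | smooth phi /\
  exists p q, [/\ a < p, p < q, q < b & forall x, ~~ (p < x < q) -> phi x = 0]].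

Lemma tests1_test_function a b phi :
  tests1 a b phi -> test_function `]a, b[%classic phi.
Proof.
move=> [sphi [p [q [ap pq qb phi0]]]].
apply: (@test_function_compact _ _ _ `[p, q]%classic) => //.
- exact: segment_compact.
- move=> x /=; rewrite !in_itv/= => /andP[px xq].
  by rewrite (lt_le_trans ap)//= (le_lt_trans xq).
- move=> x /= /negP; rewrite in_itv/= => pxq; apply: phi0.
  by apply: contra pxq => /andP[px xq]; rewrite !ltW.
Qed.

Lemma tests1_continuous a b phi : tests1 a b phi -> continuous phi.
Proof. by case=> /smooth_continuous. Qed.

Lemma tests1_measurable a b (phi : R -> R) : tests1 a b phi ->
  measurable_fun setT (phi : measurableTypeR R -> measurableTypeR R).
Proof. by move=> /tests1_continuous; exact: continuous_measurable_fun. Qed.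

Lemma tests1_integrable a b phi : tests1 a b phi ->
  mu.-integrable setT (EFin \o phi).
Proof.
move=> tphi; have cphi := tests1_continuous tphi.
case: tphi => sphi [p [q [ap pq qb phi0]]].
have -> : phi = phi \_ `[p, q]%classic.
  apply/funext => x; rewrite patchE; case: ifPn => //.
  rewrite notin_setE/= => /negP; rewrite in_itv/= => pxq.
  by apply: phi0; apply: contra pxq => /andP[px xq]; rewrite !ltW.
apply: (proj1 (@L1_patch _ _ _ mu `[p, q]%classic phi _)) => //.
apply: continuous_compact_integrable; first exact: segment_compact.
exact: continuous_subspaceT.
Qed.

Lemma tests1D a b phi psi : tests1 a b phi -> tests1 a b psi ->
  tests1 a b (fun x => phi x + psi x).
Proof.
move=> [sphi [p [q [ap pq qb phi0]]]] [spsi [p' [q' [ap' pq' qb' psi0]]]].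
split; first exact: smoothD.
exists (Num.min p p'), (Num.max q q'); split.
- by rewrite lt_min ap.
- by rewrite lt_max gt_min pq.
- by rewrite gt_max qb.
- move=> x; rewrite negb_and -!leNgt le_min ge_max => h.
  rewrite phi0 ?psi0 ?addr0// negb_and -!leNgt.
    by case/orP : h => /andP[_ ->]; rewrite ?orbT.
  by case/orP : h => /andP[-> _]; rewrite ?orbT.
Qed.

Lemma tests1Z a b phi c : tests1 a b phi -> tests1 a b (fun x => c * phi x).
Proof.
move=> [sphi [p [q [ap pq qb phi0]]]].
split; first by apply: smoothM => //; exact: smooth_cst.
by exists p, q; split => // x /phi0 ->; rewrite mulr0.
Qed.

(** The lower limit -oo avoids a base point: for functions extended by zero the primitive starts at
    the left end of the support. *)
Definition primitive (h : R -> R) (x : R) : R := \int[mu]_(t in `]-oo, x]) h t.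

Lemma is_derive_primitive h (x v : R) : continuous h ->
  mu.-integrable setT (EFin \o h) -> is_derive x v (primitive h) (v * h x).
Proof.
move=> ch ih; apply: is_derive_dir.
have ih1 : mu.-integrable `]-oo, (x + 1)] (EFin \o h).
  exact: integrableS ih.
have x1 : x < x + 1 by rewrite ltrDl.
have [|d1 d2] := @continuous_FTC1 R h -oo%O x (x + 1) x1 ih1 _ (ch x); first exact: ltNyr.
by apply: (DeriveDef d1); rewrite -derive1E.
Qed.

(** To the left of the support of [h] the primitive vanishes in any case; mean zero makes it vanish
    again to the right. *)
Lemma tests1_primitive a b h : tests1 a b h -> \int[mu]_x h x = 0 ->
  tests1 a b (primitive h).
Proof.
move=> th h0; have ih := tests1_integrable th; have ch := tests1_continuous th.
case: (th) => sh [p [q [ap pq qb hpq]]]; split.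
(* The first derivative is already a multiple of the smooth function [h], so the primitive itself is
   the only new member of the class. *)
- apply: (@smooth_class _ _ [set f | f = primitive h \/ smooth f]).
  + move=> f [->|/smooth_continuous//] x; apply: differentiable_continuous.
    by apply/derivable1_diffP; have [] := is_derive_primitive x 1 ch ih.
  + move=> f z v [->|/smooth_derivable//].
    by have [] := is_derive_primitive z v ch ih.
  + move=> f v [->|sf]; right; last exact: smooth_derive.
    rewrite (_ : 'D_v _ = fun x => v * h x).
      by apply: smoothM => //; exact: smooth_cst.
    by apply/funext => x; have [_ ->] := is_derive_primitive x v ch ih.
  + by left.
- exists p, q; split => // x; rewrite negb_and -!leNgt => /orP[xp|qx].
  + rewrite /primitive -[RHS](Rintegral_set0 mu (cst 0)) [RHS]Rintegral_mkcond Rintegral_mkcond.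
    apply: eq_Rintegral => t _; rewrite !patchE mem_setE in_itv/= in_set0.
    case: ifPn => // tx; apply: hpq; rewrite negb_and -leNgt.
    by rewrite (le_trans tx).
  + rewrite -h0 /primitive Rintegral_mkcond.
    apply: eq_Rintegral => t _; rewrite patchE mem_setE in_itv/=.
    case: ifPn => //; rewrite -ltNge => xt; apply/esym/hpq.
    by rewrite negb_and -!leNgt (ltW (le_lt_trans qx xt)) orbT.
Qed.

Lemma tests1_bump a b l p q : 0 <= l -> a < p -> p < q -> q < b ->
  tests1 a b (bump l p q).
Proof.
move=> l0 ap pq qb; split; first exact: smooth_bump.
by exists p, q; split => // x; exact: bump_out.
Qed.

Lemma exists_weight a b : a < b -> exists w, [/\ tests1 a b w,
  \int[mu]_x w x = 1, forall x, 0 <= w x & exists M, forall x, w x <= M].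
Proof.
move=> ab; set p := a + (b - a) / 3; set q := b - (b - a) / 3.
have ap : a < p by rewrite /p; lra.
have pq : p < q by rewrite /p /q; lra.
have qb : q < b by rewrite /q; lra.
have tb : tests1 a b (bump 1 p q) by apply: tests1_bump.
have ib := tests1_integrable tb.
set c := \int[mu]_x bump 1 p q x.
have c0 : 0 < c.
  rewrite lt0r Rintegral_ge0 ?andbT; last by move=> x _; exact: bump_ge0.
  (* A nonnegative function with integral zero vanishes almost everywhere, whereas the bump is
     positive on ]p, q[, a set of positive measure. *)
  apply/eqP => c0.
  have : (\int[mu]_x `|(bump 1 p q x)%:E| = 0)%E.
    under eq_integral => x _ do rewrite gee0_abs ?lee_fin ?bump_ge0//.
    rewrite -[LHS]fineK; first by rewrite -/(Rintegral mu setT (bump 1 p q)) -/c c0.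
    exact: integrable_fin_num.
  move/ae_eq_integral_abs => /(_ measurableT).
  have mb : measurable_fun setT (fun x => (bump 1 p q x)%:E).
    by apply/measurable_EFinP; exact: tests1_measurable tb.
  move=> /(_ mb) [N [mN N0 hN]].
  have : (mu `]p, q[%classic <= mu N)%E.
    apply: le_measure; rewrite ?inE// => x/=; rewrite in_itv/= => pxq.
    apply: hN => /= /(_ I)/eqP; rewrite eqe gt_eqF//.
    by apply: bump_gt0.
  by rewrite N0 lebesgue_measure_itv/= lte_fin pq -EFinB lee_fin leNgt subr_gt0 pq.
exists (fun x => c^-1 * bump 1 p q x); split.
- exact: tests1Z.
- by rewrite RintegralZl// -/c mulVf// gt_eqF.
- by move=> x; rewrite mulr_ge0 ?bump_ge0// invr_ge0 ltW.
- by exists c^-1 => x; rewrite ler_piMr ?bump_le1// invr_ge0 ltW.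
Qed.

End test_functions_on_interval.

(** * Classes of test functions that determine an integrable function *)

Section dense_tests.
Context d (T : measurableType d) (R : realType) (V : normedModType R).
Variables (mu : {measure set T -> \bar R}) (e : T -> V).

(** The conclusion of the fundamental lemma of the calculus of variations, taken as a property of
    the class [C] so that it can be passed on to tensor products. *)
Definition dense_tests (Omega : set T) (C : set (V -> R)) :=
  forall g, L1 mu g -> (forall z, ~ Omega z -> g z = 0) ->
    (forall phi, C phi -> \int[mu]_z (g z * phi (e z)) = 0) ->
    ae_eq mu setT g (cst 0).

Definition bounded_measurable (phi : V -> R) :=
  measurable_fun setT (phi \o e) /\ exists M, forall v, `|phi v| <= M.

Definition tests_on (Omega : set T) (C : set (V -> R)) :=
  forall phi, C phi -> [/\ test_function (e @` Omega) phi,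
    bounded_measurable phi & L1 mu (phi \o e)].

Lemma test_function_out (Omega : set V) (phi : V -> R) v :
  test_function Omega phi -> ~ Omega v -> phi v = 0.
Proof.
move=> [_ _ sO] Ov; apply/eqP/negPn/negP => phi0.
by apply/Ov/sO/subset_closure.
Qed.

Lemma bounded_measurable_L1 (phi : V -> R) f :
  bounded_measurable phi -> L1 mu f -> L1 mu (fun z => f z * phi (e z)).
Proof.
move=> [mphi [M hM]] lf; under eq_fun do rewrite mulrC.
by apply: L1M_bounded => //; exists M.
Qed.

End dense_tests.

Definition tensor (R : realType) (V1 V2 : normedModType R)
    (f : V1 -> R) (g : V2 -> R) (v : V1 * V2) : R := f v.1 * g v.2.

Definition tensors (R : realType) (V1 V2 : normedModType R)
    (C : set (V1 -> R)) (D : set (V2 -> R)) : set (V1 * V2 -> R) :=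
  [set h | exists2 f, C f & exists2 g, D g & h = tensor f g].

Section dense_tensors.
Context d1 d2 (T1 : measurableType d1) (T2 : measurableType d2) (R : realType).
Context (V1 V2 : normedModType R).
Variable m1 : {measure set T1 -> \bar R}.
Variable m2 : {sigma_finite_measure set T2 -> \bar R}.
Hypothesis sf1 : sigma_finite setT m1.
Variables (e1 : T1 -> V1) (e2 : T2 -> V2).
Variables (C : set (V1 -> R)) (D : set (V2 -> R)).
Variables (O1 : set T1) (O2 : set T2).
Hypotheses (tC : tests_on m1 e1 O1 C) (tD : tests_on m2 e2 O2 D).
Hypotheses (dC : dense_tests m1 e1 O1 C) (dD : dense_tests m2 e2 O2 D).

Lemma bounded_measurable_tensor phi psi :
  bounded_measurable e1 phi -> bounded_measurable e2 psi ->
  bounded_measurable (fun z => (e1 z.1, e2 z.2)) (tensor phi psi).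
Proof.
move=> [mphi [M hM]] [mpsi [N hN]]; split.
  apply: measurable_funM.
    exact: (measurableT_comp mphi measurable_fst).
  exact: (measurableT_comp mpsi measurable_snd).
exists (M * N) => v; rewrite normrM; apply: ler_pM => //.
Qed.

(** The property is used once in each factor. For fixed [psi] the integral of g psi over the second
    variable vanishes for almost every first variable. Integrating over [A] and letting [psi] vary,
    the integral of g over [A] in the first variable vanishes for almost every second variable.
    Hence [g] integrates to zero over every rectangle. *)
Lemma dense_tensors :
  dense_tests (m1 \x m2)%E (fun z => (e1 z.1, e2 z.2)) (O1 `*` O2) (tensors C D).
Proof.
move=> g lg g0 gT; apply: L1_prod_ae_zero => // A B mA mB.
have lgpsi psi : D psi -> L1 (m1 \x m2)%E (fun z => g z * psi (e2 z.2)).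
  move=> Dpsi; have [_ [mpsi [M hM]] _] := tD Dpsi.
  under eq_fun do rewrite mulrC; apply: L1M_bounded => //; last by exists M.
  exact: (measurableT_comp mpsi measurable_snd).
have h0 psi : D psi ->
    ae_eq m1 setT (fun z => \int[m2]_t (g (z, t) * psi (e2 t))) (cst 0).
  move=> Dpsi; apply: dC.
  - exact: (L1_fubini1 sf1 (lgpsi _ Dpsi)).
  - move=> z Oz; rewrite -[RHS](Rint_zero m2); apply: eq_Rintegral => t _.
    by rewrite g0 ?mul0r// => -[].
  - move=> phi Cphi; have [_ [mphi bphi] _] := tC Cphi.
    rewrite -[RHS](gT (tensor phi psi)); last by exists phi => //; exists psi.
    under eq_Rintegral do rewrite mulrC.
    rewrite (@Rfubini1_mul _ _ _ _ _ m1 m2 sf1 (phi \o e1)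
      (fun z => g z * psi (e2 z.2)))//; last 2 first.
    + by move: bphi => [M hM]; exists M => x; exact: hM.
    + exact: lgpsi.
    by apply: eq_Rintegral => z _; rewrite /tensor/=; ring.
have mA1 : measurable_fun setT (\1_A : T1 -> R) by exact: measurable_indic.
have lgA : L1 (m1 \x m2)%E (fun z => \1_A z.1 * g z).
  by apply: L1_fst_mul => //; exact: indic_bounded.
have k0 : ae_eq m2 setT (fun t => \int[m1]_z (\1_A z * g (z, t))) (cst 0).
  apply: dD.
  - exact: (L1_fubini2 sf1 lgA).
  - move=> t Ot; rewrite -[RHS](Rint_zero m1); apply: eq_Rintegral => z _.
    by rewrite g0 ?mulr0// => -[].
  - move=> psi Dpsi; have [_ [mpsi bpsi] _] := tD Dpsi.
    under eq_Rintegral do rewrite mulrC.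
    rewrite (@Rfubini2_mul _ _ _ _ _ m1 m2 sf1 (psi \o e2)
      (fun z => \1_A z.1 * g z))//; last first.
      by move: bpsi => [M hM]; exists M => x; exact: hM.
    transitivity (\int[m1]_z (\1_A z * \int[m2]_t (g (z, t) * psi (e2 t)))).
      rewrite (@Rfubini1_mul _ _ _ _ _ m1 m2 sf1 (\1_A)
        (fun z => g z * psi (e2 z.2)))//; last 2 first.
      + exact: indic_bounded.
      + exact: lgpsi.
      by apply: eq_Rintegral => z _ /=; ring.
    rewrite -[RHS](Rint_zero m1); apply: ae_eq_Rintegral => //.
      apply: measurable_funM => //.
      exact: L1_measurable (L1_fubini1 sf1 (lgpsi _ Dpsi)).
    by have := h0 _ Dpsi; apply: filterS => z /= + _ => -> //; rewrite mulr0.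
rewrite Rintegral_indic.
have mB1 : measurable_fun setT (\1_B : T2 -> R) by exact: measurable_indic.
transitivity (\int[(m1 \x m2)%E]_z (\1_B z.2 * (\1_A z.1 * g z))).
  apply: eq_Rintegral => -[x y] _ /=; rewrite mulrA; congr (_ * _).
  by rewrite !indicE in_setX/=; case: (x \in A); case: (y \in B); rewrite ?(mulr0, mul0r, mulr1).
rewrite -(@Rfubini2_mul _ _ _ _ _ m1 m2 sf1 (\1_B)
  (fun z => \1_A z.1 * g z))//; last exact: indic_bounded.
rewrite -[RHS](Rint_zero m2); apply: ae_eq_Rintegral => //.
  by apply: measurable_funM => //; exact: L1_measurable (L1_fubini2 sf1 lgA).
by move: k0; apply: filterS => z /= + _ => -> //; rewrite mulr0.
Qed.

End dense_tensors.

(** * Representation of functions by kernels *)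

Section reproducing_systems.
Context d (T : measurableType d) (R : realType) (V : normedModType R).
Variables (mu : {measure set T -> \bar R}) (e : T -> V).

(** What dominated convergence and Fubini ask for. Joint measurability serves Fubini, separate
    measurability serves a fixed argument in [V]. The last clause lets the kernel jump, provided
    that for each [v] the jumps at [v] concern only a null set of second arguments. *)
Definition reproducing_kernel (k : V -> V -> R) :=
  [/\ exists M, forall v w, `|k v w| <= M,
      measurable_fun setT (fun z : T * T => k (e z.1) (e z.2)),
      forall w, measurable_fun setT (fun z => k (e z) w),
      forall v, measurable_fun setT (fun z => k v (e z)) &
      forall v, {ae mu, forall z, k ^~ (e z) @ v --> k v (e z)}].

(** Integration is over the first argument: this is the transpose of the operator that represents
    [f], acting on test functions. *)
Definition potential (k : V -> V -> R) (phi : V -> R) (w : V) : R :=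
  \int[mu]_z (k (e z) w * phi (e z)).

(* Testing f against phi, the last identity rewrites f as the sum over i of the
   functions v |-> int k_i(v, .) D^(al i) f. *)
Definition reproducing (Omega : set T) (basis : seq V) (C : set (V -> R)) :=
  exists (I : finType) (al : I -> seq V) (k : I -> V -> V -> R),
  [/\ forall i, subseq (al i) basis,
      forall i, reproducing_kernel (k i) &
      forall phi, C phi ->
      [/\ forall i, test_function (e @` Omega) (potential (k i) phi),
          forall i,
            bounded_measurable e (iter_derive (al i) (potential (k i) phi)) &
          forall w, phi w = \sum_i (-1) ^+ size (al i) *
            iter_derive (al i) (potential (k i) phi) w]].

End reproducing_systems.

Section tensor_derivatives.
Context (R : realType) (V1 V2 : normedModType R).
Implicit Types (f : V1 -> R) (g : V2 -> R).

Lemma iter_derive_cat (V : normedModType R) (s1 s2 : seq V) (f : V -> R) :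
  iter_derive (s1 ++ s2) f = iter_derive s1 (iter_derive s2 f).
Proof. by rewrite /iter_derive foldr_cat. Qed.

Lemma smooth_iter_derive (V : normedModType R) (s : seq V) (f : V -> R) :
  smooth f -> smooth (iter_derive s f).
Proof. by move=> sf; elim: s => // v s IH; exact: (smooth_derive v IH). Qed.

Lemma smooth_fst f : smooth f -> smooth (fun v : V1 * V2 => f v.1).
Proof.
apply: (@smooth_affine _ _ _ (fun v : V1 * V2 => v.1) (fun v => v.1)) => //.
by move=> v; exact: cvg_fst.
Qed.

Lemma smooth_snd g : smooth g -> smooth (fun v : V1 * V2 => g v.2).
Proof.
apply: (@smooth_affine _ _ _ (fun v : V1 * V2 => v.2) (fun v => v.2)) => //.
by move=> v; exact: cvg_snd.
Qed.

Lemma smooth_tensor f g : smooth f -> smooth g -> smooth (tensor f g).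
Proof. by move=> sf sg; apply: smoothM; [exact: smooth_fst|exact: smooth_snd]. Qed.

Lemma derive_tensor f g v : smooth f -> smooth g ->
  'D_v (tensor f g) = (fun z => f z.1 * 'D_(v.2) g z.2 + g z.2 * 'D_(v.1) f z.1).
Proof.
move=> sf sg; apply/funext => z.
rewrite [LHS]deriveM; last 2 first.
- by apply: smooth_derivable; exact: smooth_fst.
- by apply: smooth_derivable; exact: smooth_snd.
by congr (_ * _ + _ * _).
Qed.

Lemma iter_derive_tensor s1 s2 f g : smooth f -> smooth g ->
  iter_derive ([seq (v, 0) | v <- s1] ++ [seq (0, v) | v <- s2]) (tensor f g) =
  tensor (iter_derive s1 f) (iter_derive s2 g).
Proof.
move=> sf sg; rewrite iter_derive_cat.
have -> : iter_derive [seq (0, v) | v <- s2] (tensor f g) = tensor f (iter_derive s2 g).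
  elim: s2 => //= v s ->; rewrite derive_tensor//; last exact: smooth_iter_derive.
  by apply/funext => z; rewrite /tensor/= derive0 mulr0 addr0.
elim: s1 => //= v s ->; rewrite derive_tensor//; last 2 first.
- exact: smooth_iter_derive.
- exact: smooth_iter_derive.
by apply/funext => z; rewrite /tensor/= derive0 mulr0 add0r mulrC.
Qed.

Lemma test_function_tensor (O1 : set V1) (O2 : set V2) f g :
  test_function O1 f -> test_function O2 g ->
  test_function (O1 `*` O2) (tensor f g).
Proof.
move=> tf tg; have [sf cf Of] := tf; have [sg cg Og] := tg.
apply: (@test_function_compact _ _ _ (closure [set z | f z != 0] `*`
    closure [set z | g z != 0])).
- exact: smooth_tensor.
- exact: compact_setX.
- by move=> z [z1 z2]; split; [exact: Of|exact: Og].
- move=> z /not_andP[] h; apply/eqP; rewrite mulf_eq0.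
    by apply/orP; left; apply/negPn/negP => f0; apply/h/subset_closure.
  by apply/orP; right; apply/negPn/negP => f0; apply/h/subset_closure.
Qed.

End tensor_derivatives.

Section reproducing_tensors.
Context d1 d2 (T1 : measurableType d1) (T2 : measurableType d2) (R : realType).
Context (V1 V2 : normedModType R).
Variable m1 : {measure set T1 -> \bar R}.
Variable m2 : {sigma_finite_measure set T2 -> \bar R}.
Hypothesis sf1 : sigma_finite setT m1.
Variables (e1 : T1 -> V1) (e2 : T2 -> V2).
Local Notation e12 := (fun z : T1 * T2 => (e1 z.1, e2 z.2)).

Lemma ae_fst (P : set T1) : {ae m1, forall x, P x} ->
  {ae (m1 \x m2)%E, forall z, P z.1}.
Proof.
move=> [N [mN N0 NP]]; exists (N `*` setT); split.
- exact: measurableX.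
- by rewrite product_measure1E// N0 mul0e.
- by move=> z /= Pz; split => //; exact: NP.
Qed.

Lemma ae_snd (P : set T2) : {ae m2, forall x, P x} ->
  {ae (m1 \x m2)%E, forall z, P z.2}.
Proof.
move=> [N [mN N0 NP]]; exists (setT `*` N); split.
- exact: measurableX.
- by rewrite product_measure1E// N0 mule0.
- by move=> z /= Pz; split => //; exact: NP.
Qed.

Lemma reproducing_kernel_tensor k1 k2 :
  reproducing_kernel m1 e1 k1 -> reproducing_kernel m2 e2 k2 ->
  reproducing_kernel (m1 \x m2)%E e12
    (fun v w => k1 v.1 w.1 * k2 v.2 w.2).
Proof.
move=> [[M1 hM1] m1k m1l m1r c1] [[M2 hM2] m2k m2l m2r c2]; split.
- by exists (M1 * M2) => v w; rewrite normrM ler_pM.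
- apply: measurable_funM => /=.
    apply: (@measurableT_comp _ _ _ _ _ _ (fun z : T1 * T1 => k1 (e1 z.1) (e1 z.2)) _
      (fun z : (T1 * T2) * (T1 * T2) => (z.1.1, z.2.1))) => //.
    by apply: measurable_fun_pair;
      exact: (measurableT_comp measurable_fst).
  apply: (@measurableT_comp _ _ _ _ _ _ (fun z : T2 * T2 => k2 (e2 z.1) (e2 z.2)) _
      (fun z : (T1 * T2) * (T1 * T2) => (z.1.2, z.2.2))) => //.
  by apply: measurable_fun_pair; exact: (measurableT_comp measurable_snd).
- move=> w; apply: measurable_funM.
    exact: (measurableT_comp (m1l w.1) measurable_fst).
  exact: (measurableT_comp (m2l w.2) measurable_snd).
- move=> v; apply: measurable_funM.
    exact: (measurableT_comp (m1r v.1) measurable_fst).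
  exact: (measurableT_comp (m2r v.2) measurable_snd).
- move=> v; have := ae_snd (c2 v.2); have := ae_fst (c1 v.1).
  apply: filterS2 => z h1 h2; apply: cvgM.
    by apply: cvg_comp h1; exact: cvg_fst.
  by apply: cvg_comp h2; exact: cvg_snd.
Qed.

Lemma potential_tensor k1 k2 phi psi :
  reproducing_kernel m1 e1 k1 -> reproducing_kernel m2 e2 k2 ->
  L1 m1 (phi \o e1) -> L1 m2 (psi \o e2) ->
  potential (m1 \x m2)%E e12 (fun v w => k1 v.1 w.1 * k2 v.2 w.2)
    (tensor phi psi) =
  tensor (potential m1 e1 k1 phi) (potential m2 e2 k2 psi).
Proof.
move=> [[M1 hM1] _ m1l _ _] [[M2 hM2] _ m2l _ _] l1 l2; apply/funext => w.
rewrite [RHS]/tensor /potential -Rint_tensor//.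
- by apply: eq_Rintegral => z _; rewrite /tensor/=; ring.
- by apply: L1M_bounded => //; exists M1 => z.
- by apply: L1M_bounded => //; exists M2 => z.
Qed.

Variables (C : set (V1 -> R)) (D : set (V2 -> R)).
Variables (O1 : set T1) (O2 : set T2).
Variables (b1 : seq V1) (b2 : seq V2).
Hypotheses (tC : tests_on m1 e1 O1 C) (tD : tests_on m2 e2 O2 D).

Lemma image_setX : e12 @` (O1 `*` O2) = (e1 @` O1) `*` (e2 @` O2).
Proof.
apply/seteqP; split => [_ [z [z1 z2] <-]|v [[x Ox xv] [y Oy yv]]].
  by split => /=; [exists z.1|exists z.2].
by exists (x, y) => //=; rewrite xv yv; case: (v).
Qed.

Lemma tests_on_tensors : tests_on (m1 \x m2)%E e12 (O1 `*` O2) (tensors C D).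
Proof.
move=> _ [phi Cphi [psi Dpsi ->]].
have [t1 bm1 l1] := tC Cphi; have [t2 bm2 l2] := tD Dpsi.
split.
- by rewrite image_setX; exact: test_function_tensor.
- exact: bounded_measurable_tensor.
- exact: (L1_tensor sf1 l1 l2).
Qed.

(** The representation of [tensor phi psi] is the product of the two sums. Pairs of indices
    correspond to concatenated lists of directions, and the signs multiply accordingly. *)
Lemma reproducing_tensors :
  reproducing m1 e1 O1 b1 C -> reproducing m2 e2 O2 b2 D ->
  reproducing (m1 \x m2)%E e12 (O1 `*` O2)
    ([seq (v, 0) | v <- b1] ++ [seq (0, v) | v <- b2]) (tensors C D).
Proof.
move=> [I [al [k [sal rk rC]]]] [J [be [l [sbe rl rD]]]].
exists (I * J)%type, (fun ij => [seq (v, 0) | v <- al ij.1] ++ [seq (0, v) | v <- be ij.2]),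
  (fun ij v w => k ij.1 v.1 w.1 * l ij.2 v.2 w.2); split.
- by move=> [i j]; apply: cat_subseq; apply: map_subseq.
- by move=> [i j]; exact: reproducing_kernel_tensor.
move=> _ [phi Cphi [psi Dpsi ->]].
have [t1 bm1 l1] := tC Cphi; have [t2 bm2 l2] := tD Dpsi.
have [tk bk sk] := rC _ Cphi; have [tl bl sl] := rD _ Dpsi.
have E i j := potential_tensor (rk i) (rl j) l1 l2.
have sP i : smooth (potential m1 e1 (k i) phi) by case: (tk i).
have sQ j : smooth (potential m2 e2 (l j) psi) by case: (tl j).
split.
- by move=> [i j]; rewrite E image_setX; exact: test_function_tensor.
- move=> [i j]; rewrite E iter_derive_tensor//; exact: bounded_measurable_tensor.
- move=> w; rewrite {1}/tensor sk sl big_distrlr/= pair_big/=.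
  apply: eq_bigr => -[i j] _ /=; rewrite E iter_derive_tensor// size_cat !size_map.
  by rewrite exprD /tensor; ring.
Qed.

End reproducing_tensors.

(** * Density and representation in one variable *)

Section interval_system.
Context {R : realType}.
Local Notation mR := (measurableTypeR R).
Local Notation mu := (@lebesgue_measure R).

Definition chart1 : mR -> R := fun x => x.

Lemma image_chart1 (A : set R) : chart1 @` A = A.
Proof. exact: image_id. Qed.

Lemma tests1_bounded a b phi : tests1 a b phi ->
  exists M, forall x : R, `|phi x| <= M.
Proof.
move=> tphi; have cphi := tests1_continuous tphi.
case: tphi => sphi [p [q [ap pq qb phi0]]].
have [|c _ hc] := @EVT_max R (Num.norm \o phi) p q (ltW pq).
  apply: continuous_subspaceT => x; apply: continuous_comp; first exact: cphi.
  exact: norm_continuous.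
exists `|phi c| => x; have [pxq|/phi0->] := boolP (p < x < q); last by rewrite normr0.
by apply: hc; rewrite in_itv/=; case/andP : pxq => /ltW -> /ltW ->.
Qed.

Lemma tests1_on a b : tests_on mu chart1 (`]a, b[%classic : set R) (tests1 a b).
Proof.
move=> phi tphi; split.
- by rewrite image_chart1; exact: tests1_test_function.
- by split; [exact: tests1_measurable tphi|exact: tests1_bounded tphi].
- exact: tests1_integrable tphi.
Qed.

Lemma flat1_cvg (y : nat -> R) : y n @[n --> \oo] --> +oo ->
  flat 1 (y n) @[n --> \oo] --> (1 : R).
Proof.
move=> yoo; apply/cvgrPdist_lt => e e0; near=> n.
have yn : e^-1 < y n by near: n; move/cvgryPgt : yoo; exact.
have y0 : 0 < y n by rewrite (lt_trans _ yn)// invr_gt0.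
rewrite flat1 y0 ger0_norm; last by rewrite subr_ge0 expR_le1 lerNl oppr0 invr_ge0 ltW.
rewrite (@le_lt_trans _ _ (y n)^-1)//; last by rewrite -(invrK e) ltf_pV2 ?posrE// invr_gt0.
by rewrite lerBlDr -lerBlDl expR_ge1Dx.
Unshelve. all: by end_near. Qed.

(** Each end moves inwards by (q - p)/(n+3), at most a third of the length, so the support stays
    inside ]p, q[ and is never empty. The steepness n+1 lets the bumps tend to the indicator of ]p,
    q[. *)
Definition inner_bump p q (n : nat) : R -> R :=
  bump n.+1%:R (p + (q - p) / n.+3%:R) (q - (q - p) / n.+3%:R).

Lemma inner_bump_tests1 (a b p q : R) n : a <= p -> p < q -> q <= b ->
  tests1 a b (inner_bump p q n).
Proof.
move=> ap pq qb; have n3 : 0 < (n.+3%:R : R) by [].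
have d0 : 0 < (q - p) / n.+3%:R by rewrite divr_gt0// subr_gt0.
have d1 : (q - p) / n.+3%:R <= (q - p) / 3.
  by rewrite ler_pM2l ?subr_gt0// lef_pV2 ?posrE// ler_nat.
rewrite /inner_bump; move: ((q - p) / n.+3%:R) d0 d1 => d d0 d1.
apply: tests1_bump => //; lra.
Qed.

Lemma cvg_inner_bump (p q x : R) : p < q ->
  inner_bump p q n x @[n --> \oo] --> (\1_(`]p, q[%classic : set R) x : R).
Proof.
move=> pq; have n3 n : 0 < (n.+3%:R : R) by [].
have d0 n : 0 < (q - p) / n.+3%:R by rewrite divr_gt0// subr_gt0.
rewrite indicE mem_setE in_itv/=; have [/andP[px xq]|pxq] := boolP (p < x < q); last first.
  rewrite (_ : (fun n => _) = cst 0); first exact: cvg_cst.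
  apply/funext => n; apply: bump_out => //; apply: contra pxq => /andP[h1 h2].
  move: ((q - p) / n.+3%:R) (d0 n) h1 h2 => d d1 h1 h2.
  by apply/andP; split; lra.
have yoo (y : R) : 0 < y ->
      (fun n : nat => n.+1%:R * (y - (q - p) / n.+3%:R)) n @[n --> \oo] --> +oo.
  move=> y0; apply/cvgryPge => A; near=> n.
  (* Moving the ends costs (n+1)(q - p)/(n+3) <= q - p, which the growth of (n+1) y absorbs. *)
  have h : A + (q - p) <= n.+1%:R * y.
    rewrite -ler_pdivrMr// (@le_trans _ _ n%:R)// ?ler_nat//.
    by near: n; exact: nbhs_infty_ger.
  rewrite mulrBr lerBrDr (le_trans _ h)// lerD2l.
  rewrite mulrCA ler_piMr ?subr_ge0 ?(ltW pq)// ler_pdivrMr// mul1r ler_nat.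
  by rewrite ltnW.
rewrite -[X in _ --> X]mulr1; apply: cvgM.
  rewrite (_ : (fun n => _) = (fun n => flat 1 (n.+1%:R * (x - p - (q - p) / n.+3%:R)))).
    by apply: flat1_cvg; apply: yoo; rewrite subr_gt0.
  by apply/funext => n; congr flat; ring.
rewrite (_ : (fun n => _) = (fun n => flat 1 (n.+1%:R * (q - x - (q - p) / n.+3%:R)))).
  by apply: flat1_cvg; apply: yoo; rewrite subr_gt0.
by apply/funext => n; congr flat; ring.
Unshelve. all: by end_near. Qed.

(** Inner bumps converge boundedly to the indicator of an open interval, so [g] integrates to zero
    over each open subinterval of ]a, b[. The half-open intervals generate the measurable sets and
    are stable under intersection, which starts a Dynkin argument. *)
Lemma dense_tests1 a b : dense_tests mu chart1 (`]a, b[%classic : set R) (tests1 a b).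
Proof.
move=> g lg g0 gphi; apply: L1_ae_zero => //.
have goo p q : a <= p -> p < q -> q <= b -> \int[mu]_(x in `]p, q[) g x = 0.
  move=> ap pq qb; have mg := L1_measurable lg.
  have h : \int[mu]_x (g x * inner_bump p q n x) @[n --> \oo] -->
      \int[mu]_x (g x * \1_(`]p, q[%classic : set R) x).
    apply: (@Rdominated_cvg _ _ _ _ _ _ (fun x => `|g x|)).
    - move=> n; apply: measurable_funM => //.
      exact: tests1_measurable (inner_bump_tests1 n ap pq qb).
    - by apply: measurable_funM => //.
    - by apply: aeW => x; apply: cvgMr; exact: cvg_inner_bump.
    - exact: (integrable_norm lg).
    - by move=> n x; rewrite normrM ler_piMr// ger0_norm ?bump_ge0 ?bump_le1.
  rewrite Rintegral_indic; under eq_Rintegral do rewrite mulrC.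
  move: h; rewrite (_ : (fun n => _) = cst 0); last first.
    by apply/funext => n; apply: gphi; exact: inner_bump_tests1.
  by move=> /(cvg_lim (@Rhausdorff R)) <-; exact: (lim_cst (@Rhausdorff R)).
(* Endpoints are null sets, and the interval can be clipped to ]a, b[ because [g] vanishes
   outside. *)
have goc p q : \int[mu]_(x in `]p, q]) g x = 0.
  rewrite -Rintegral_itv_bndo_bndc; last exact: integrableS lg.
  have [h|h] := ltP (Num.max a p) (Num.min b q).
    rewrite -[RHS](goo _ _ _ h) ?le_max ?lexx ?ge_min ?lexx//.
    rewrite [LHS]Rintegral_indic [RHS]Rintegral_indic; apply: eq_Rintegral => x _.
    rewrite !indicE !mem_setE !in_itv/= gt_max lt_min.
    case: (boolP (a < x < b)) => [/andP[-> ->]//|axb].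
    by rewrite g0 ?mulr0// /= in_itv/=; exact/negP.
  rewrite Rintegral_mkcond -[RHS](Rint_zero mu); apply: eq_Rintegral => x _.
  rewrite patchE mem_setE in_itv/=; case: ifPn => // /andP[px xq].
  apply: g0; rewrite /= in_itv/= => /andP[ax xb].
  have : Num.max a p < Num.min b q.
    by rewrite (@lt_trans _ _ x)// ?gt_max ?lt_min ?ax ?xb.
  by rewrite ltNge h.
(* The total integral is what gives stability under complements. *)
have gT : \int[mu]_x g x = 0.
  rewrite -[RHS](goc a b) [RHS]Rintegral_mkcond; apply: eq_Rintegral => x _.
  rewrite patchE mem_setE in_itv/=; case: ifPn => // axb.
  apply: g0; rewrite /= in_itv/= => /andP[ax xb].
  by rewrite ax (ltW xb) in axb.
have lgA A : measurable A -> mu.-integrable A (EFin \o g).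
  by move=> mA; apply: integrableS lg.
apply: (@dynkin_induction _ mR (@ocitv R) (fun X => \int[mu]_(x in X) g x = 0)) => //.
- exact: ocitvI.
- by move=> _ [[p q] _ <-] /=; exact: goc.
- move=> A mA A0; have := gT; rewrite -(setUv A) Rintegral_setU//.
  + by rewrite A0 add0r.
  + exact: measurableC.
  + by rewrite setUv.
  + by rewrite disj_set2E setICr.
- move=> F mF tF F0; rewrite /Rintegral integral_bigcup//; last first.
    by apply: lgA; exact: bigcup_measurable.
  rewrite eseries0// => i _ _.
  rewrite -[LHS]fineK; first by have := F0 i; rewrite /Rintegral => ->.
  by apply: integrable_fin_num => //; exact: lgA.
Qed.

(** With c the integral of [phi], the function h = c w - phi has mean zero, so its primitive is a
    test function. This primitive is the potential of [k true], and c w that of [k false]; the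
    identity to prove reads phi = c w - h. *)
Lemma reproducing_tests1 a b : a < b ->
  reproducing mu chart1 (`]a, b[%classic : set R) [:: (1 : R)] (tests1 a b).
Proof.
move=> ab; have [w [tw w1 w0 [M wM]]] := exists_weight ab.
have lw := tests1_integrable tw; have cw := tests1_continuous tw.
have mw := tests1_measurable tw.
pose W := primitive w.
have cW : continuous W.
  move=> x; apply: differentiable_continuous.
  by apply/derivable1_diffP; have [] := is_derive_primitive x 1 cw lw.
have mW : measurable_fun setT (W : mR -> mR) by exact: continuous_measurable_fun.
have W01 x : 0 <= W x <= 1.
  rewrite /W /primitive; apply/andP; split; first exact: Rintegral_ge0.
  rewrite -w1 Rintegral_indic; apply: le_Rintegral => //.
    apply: L1M_bounded => //; exact: indic_bounded.
  by move=> t _; rewrite indicE; case: (_ \in _); rewrite ?mul1r ?mul0r.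
pose k (i : bool) (v s : R) : R := if i then W s - (v < s)%R%:R else w s.
have mlt d (T : measurableType d) (f g : T -> mR) :
      measurable_fun setT f -> measurable_fun setT g ->
    measurable_fun setT (fun z => ((f z < g z)%R%:R : R)).
  move=> mf mg; apply: (@measurableT_comp _ _ _ _ _ _ (fun b : bool => (b%:R : R))) => //.
  exact: measurable_fun_ltr.
exists bool, (fun i : bool => if i then [:: (1 : R)] else [::]), k; split.
- by case.
- case; split.
  + exists 2 => v s; rewrite /k; case/andP : (W01 s) => W0 W1.
    move: (W s) W0 W1 => t W0 W1.
    case: (v < s)%R; rewrite ler_norml/= ?mulr1n ?mulr0n; apply/andP; split; lra.
  + apply: measurable_funB; first exact: (measurableT_comp mW measurable_snd).
    by apply: (mlt _ _ (fun z : mR * mR => z.1) (fun z => z.2));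
        [exact: measurable_fst|exact: measurable_snd].
  + move=> s; apply: measurable_funB => //.
    by apply: (mlt _ _ (fun z : mR => z) (fun=> s)).
  + move=> s; apply: measurable_funB => //.
    by apply: (mlt _ _ (fun=> s) (fun z : mR => z)).
  (* In its first argument the kernel jumps only at [s], so for given [v] the single bad value is s
     = v. *)
  + move=> v; exists [set v]; split => //; first exact: lebesgue_measure_set1.
    move=> s /= h; apply: contrapT => sv; apply: h; rewrite /k/chart1.
    apply: cvgB; first exact: cvg_cst.
    have [vs|sv'|/esym//] := ltgtP v s.
      apply: cvg_near_cst; near=> x; have -> // : x < s.
      by near: x; exact: lt_nbhsl.
    apply: cvg_near_cst; near=> x; have : s < x by near: x; exact: lt_nbhsr.
    by move=> sx; rewrite ltNge (ltW sx).
  + by exists M => v s; rewrite /k ger0_norm.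
  + exact: (measurableT_comp mw measurable_snd).
  + by move=> s; exact: measurable_cst.
  + by move=> s.
  + by move=> v; apply: aeW => s; exact: cvg_cst.
- move=> phi tphi; have lphi := tests1_integrable tphi.
  have mphi := tests1_measurable tphi.
  pose c := \int[mu]_x phi x.
  pose h s := c * w s + -1 * phi s.
  have th : tests1 a b h by apply: tests1D; exact: tests1Z.
  have lh := tests1_integrable th.
  have h0 : \int[mu]_x h x = 0.
    rewrite /h RintegralD//; [|exact: L1Z|exact: L1Z].
    by rewrite !RintegralZl// w1 -/c; ring.
  have potw : potential mu chart1 (k false) phi = (fun s => c * w s).
    by apply/funext => s; rewrite /potential/= RintegralZl// mulrC.
  have potW : potential mu chart1 (k true) phi = primitive h.
    apply/funext => s; rewrite /potential /k /chart1.
    have l1 : L1 mu (fun z : mR => \1_(`]-oo, s[%classic : set R) z * phi z).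
      by apply: L1M_bounded => //; exact: indic_bounded.
    transitivity (\int[mu]_z (W s * phi z + -1 * (\1_(`]-oo, s[%classic : set R) z * phi z))).
      apply: eq_Rintegral => z _; rewrite indicE mem_setE in_itv/=; ring.
    rewrite RintegralD//; [|exact: L1Z|exact: L1Z].
    rewrite !RintegralZl// -Rintegral_indic Rintegral_itv_bndo_bndc; last first.
      exact: integrableS lphi.
    rewrite /primitive /h RintegralD//; last 2 first.
      by apply: integrableS (L1Z c lw).
      by apply: integrableS (L1Z (-1) lphi).
    rewrite !RintegralZl//; last 2 first.
      exact: integrableS lphi.
      exact: integrableS lw.
    by rewrite -/c -/(primitive w s) -/(W s); ring.
  have dP s : 'D_1 (primitive h) s = h s.
    have [_ ->] := is_derive_primitive s 1 (tests1_continuous th) lh.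
    by rewrite mul1r.
  have tcw : tests1 a b (fun s => c * w s) by exact: tests1Z.
  split.
  + case; rewrite image_chart1 ?potW ?potw; apply: tests1_test_function => //.
    exact: tests1_primitive.
  + case; rewrite ?potW ?potw /=; last first.
      by split; [exact: tests1_measurable tcw|exact: tests1_bounded tcw].
    have -> : 'D_(1 : R) (primitive h) = h by exact/funext.
    by split; [exact: tests1_measurable th|exact: tests1_bounded th].
  + move=> s; rewrite big_bool/= potW potw dP /h expr1 expr0; ring.
Unshelve. all: by end_near. Qed.

End interval_system.

(** * Continuous representatives of H1 functions *)

Section square_integrable_theory.
Context d (T : measurableType d) (R : realType).
Variable mu : {measure set T -> \bar R}.

Lemma square_integrableP (D : set T) (f : T -> R) :
  square_integrable mu D f <->
  measurable_fun setT (f \_ D) /\ L1 mu (fun x => (f \_ D) x ^+ 2).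
Proof.
rewrite /square_integrable; split=> [h|[mf lf]].
  split; last exact: Lfun2_integrable_sqr.
  by move: h; rewrite inE => /andP[/[!inE]].
rewrite inE; apply/andP; split; rewrite inE//= /finite_norm unlock.
apply: poweR_lty; move/integrableP : lf => [_]; congr (_ < _)%E.
apply: eq_integral => x _ /=; rewrite ger0_norm ?sqr_ge0//.
by rewrite -[X in _ = (X `^ _)%:E]normr_id powR_mulrn// normr_id real_normK// num_real.
Qed.

(** The bound t <= 1 + t^2 suffices, since the constant 1 is integrable over a set of finite
    measure. *)
Lemma square_integrable_L1 (D : set T) (f : T -> R) :
  measurable D -> (mu D < +oo)%E -> square_integrable mu D f -> L1 mu (f \_ D).
Proof.
move=> mD Doo /square_integrableP[mf lf2].
have l1 : L1 mu (\1_D : T -> R) by exact: L1_indic.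
apply: (L1_le mf _ (L1D l1 lf2)) => x.
rewrite patchE indicE; case: (x \in D) => /=; last by rewrite normr0.
rewrite mulr1n [leRHS]ger0_norm ?addr_ge0 ?sqr_ge0//.
rewrite -(real_normK (num_real (f x))).
by move: (`|f x|) (normr_ge0 (f x)) => t t0; have := sqr_ge0 (t - 1); nra.
Qed.

End square_integrable_theory.

Section continuous_representative.
Context d (T : measurableType d) (R : realType) (V : normedModType R).
Variables (mu : {measure set T -> \bar R}) (e : T -> V).
Hypothesis einj : injective e.
Hypothesis sfmu : sigma_finite setT mu.
Let nu := [the {sigma_finite_measure set T -> \bar R} of sigma_finite_pack sfmu].
Variables (Omega : set T) (basis : seq V) (C : set (V -> R)).
Hypotheses (mO : measurable Omega) (Ooo : (mu Omega < +oo)%E).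
Hypotheses (tC : tests_on mu e Omega C) (dC : dense_tests mu e Omega C).
Hypothesis rC : reproducing mu e Omega basis C.

(** The integrands are dominated by M |g|. The null set where the kernels fail to converge may
    depend on [v], which does no harm for sequences tending to that [v]. *)
Lemma potential_continuous k (g : T -> R) : reproducing_kernel mu e k ->
  L1 mu g -> continuous (fun v => \int[mu]_z (k v (e z) * g z)).
Proof.
move=> [[M hM] _ _ mk ck] lg v; apply: sequential_continuity => u uv.
have mg := L1_measurable lg.
apply: (@Rdominated_cvg _ _ _ _ _ _ (fun z => M * `|g z|)).
- by move=> n; exact: measurable_funM.
- exact: measurable_funM.
- have := ck v; apply: filterS => z kz; apply: cvgMl.
  exact: (cvg_comp _ _ uv kz).
- exact: (L1Z _ (integrable_norm lg)).
- by move=> n z; rewrite normrM ler_wpM2r.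
Qed.

Lemma L1_kernel k (g h : T -> R) : reproducing_kernel mu e k ->
  L1 mu g -> L1 mu h ->
  L1 (nu \x nu)%E (fun z : T * T => k (e z.1) (e z.2) * (h z.1 * g z.2)).
Proof.
move=> [[M hM] mk _ _ _] lg lh; apply: L1M_bounded => //.
  by exists M => z.
exact: (@L1_tensor _ _ _ _ _ mu nu sfmu).
Qed.

Lemma Rint_kernel k (g h : T -> R) : reproducing_kernel mu e k ->
  L1 mu g -> L1 mu h ->
  \int[mu]_z (h z * \int[mu]_w (k (e z) (e w) * g w)) =
  \int[mu]_w (g w * \int[mu]_z (k (e z) (e w) * h z)).
Proof.
move=> rk lg lh; have lk := L1_kernel rk lg lh.
have [[M hM] _ ml mr _] := rk.
transitivity (\int[mu]_z \int[mu]_w (k (e z) (e w) * (h z * g w))).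
  apply: eq_Rintegral => z _; rewrite -RintegralZl//; last first.
    by apply: L1M_bounded => //; exists M.
  by apply: eq_Rintegral => w _; ring.
rewrite (@Rfubini1 _ _ _ _ _ mu nu sfmu _ lk) -(@Rfubini2 _ _ _ _ _ mu nu sfmu _ lk).
apply: eq_Rintegral => w _; rewrite -RintegralZl//; last first.
  by apply: L1M_bounded => //; exists M.
by apply: eq_Rintegral => z _; ring.
Qed.

Lemma L1_fubini_kernel k (g h : T -> R) : reproducing_kernel mu e k ->
  L1 mu g -> L1 mu h -> L1 mu (fun z => h z * \int[mu]_w (k (e z) (e w) * g w)).
Proof.
move=> rk lg lh; have lk := L1_kernel rk lg lh.
have [[M hM] _ ml mr _] := rk.
rewrite (_ : (fun z => _) = fun z => \int[mu]_w (k (e z) (e w) * (h z * g w))).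
  exact: (@L1_fubini1 _ _ _ _ _ mu nu sfmu _ lk).
apply/funext => z; rewrite -RintegralZl//; last first.
  by apply: L1M_bounded => //; exists M.
by apply: eq_Rintegral => w _; ring.
Qed.

Lemma weak_derivativeE vs f g phi :
  weak_derivative mu e Omega vs f g -> test_function (e @` Omega) phi ->
  \int[mu]_z ((f \_ Omega) z * iter_derive vs phi (e z)) =
  (-1) ^+ size vs * \int[mu]_z ((g \_ Omega) z * phi (e z)).
Proof.
move=> [_ _ h] tphi; have := h _ tphi.
rewrite !(Rintegral_mkcond _ Omega) => hE.
transitivity (\int[mu]_x ((fun z => f z * iter_derive vs phi (e z)) \_ Omega) x).
  by apply: eq_Rintegral => z _; rewrite !patchE; case: ifP; rewrite ?mul0r.
rewrite hE; congr (_ * _).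
by apply: eq_Rintegral => z _; rewrite !patchE; case: ifP; rewrite ?mul0r.
Qed.

(** [G] sums the kernels against the weak derivatives of [f]. Expanding a test function, moving the
    derivatives onto [f] and exchanging the integrals shows that [f] and [G], both cut off to
    [Omega], have the same integral against every member of [C]; density concludes. *)
Lemma exists_continuous_representative f : H1 mu e Omega basis f ->
  exists2 G : V -> R, continuous G & ae_eq mu Omega f (G \o e).
Proof.
move=> [sf hf]; have [I [al [k [sal rk kC]]]] := rC.
have [g hg] : {g : I -> T -> R & forall i, square_integrable mu Omega (g i) /\
    weak_derivative mu e Omega (al i) f (g i)}.
  apply: (@choice _ _ (fun i g => square_integrable mu Omega g /\
    weak_derivative mu e Omega (al i) f g)) => i.
  by have [gi sgi wgi] := hf _ (sal i); exists gi.
pose g' i := g i \_ Omega.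
have lg i : L1 mu (g' i) by apply: square_integrable_L1 => //; case: (hg i).
have lf : L1 mu (f \_ Omega) by exact: square_integrable_L1.
pose G v := \sum_i \int[mu]_z (k i v (e z) * g' i z).
have cG : continuous G.
  move=> v; rewrite /G.
  have cGi i : {for v, continuous (fun v => \int[mu]_z (k i v (e z) * g' i z))}.
    exact: potential_continuous.
  elim: (index_enum I) => [|i s IH].
    by under eq_fun do rewrite big_nil; exact: cvg_cst.
  rewrite (_ : (fun v => _) = (fun v => \int[mu]_z (k i v (e z) * g' i z) +
      \sum_(i <- s) \int[mu]_z (k i v (e z) * g' i z))).
    exact: (cvgD (cGi i) IH).
  by apply/funext => u; rewrite big_cons.
exists G => //.
have l1 : L1 mu (\1_Omega : T -> R) by exact: L1_indic.
have lG : L1 mu (fun z => \1_Omega z * G (e z)).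
  rewrite /G; under eq_fun do rewrite mulr_sumr.
  by apply: L1_sum => i; exact: L1_fubini_kernel.
have : ae_eq mu setT (fun z => (f \_ Omega) z - \1_Omega z * G (e z)) (cst 0).
  apply: dC.
  - exact: L1B.
  - move=> z Oz; rewrite patchE memNset// indicE memNset//.
    by rewrite mul0r subr0.
  - move=> phi Cphi; have [tphi bphi lphi] := tC Cphi.
    have [tk bk phiE] := kC _ Cphi.
    rewrite (_ : (fun z => _) = (fun z => (f \_ Omega) z * phi (e z) -
        \1_Omega z * G (e z) * phi (e z))); last by apply/funext => z; ring.
    rewrite RintegralB//; [|exact: bounded_measurable_L1|exact: bounded_measurable_L1].
    apply/eqP; rewrite subr_eq0; apply/eqP.
    transitivity (\sum_i \int[mu]_z (g' i z * potential mu e (k i) phi (e z))).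
      transitivity (\int[mu]_z (\sum_i (-1) ^+ size (al i) * ((f \_ Omega) z *
          iter_derive (al i) (potential mu e (k i) phi) (e z)))).
        apply: eq_Rintegral => z _; rewrite {1}phiE mulr_sumr.
        by apply: eq_bigr => i _; ring.
      rewrite Rint_sum; last first.
        by move=> i; apply: L1Z; exact: bounded_measurable_L1.
      apply: eq_bigr => i _; rewrite RintegralZl//; last exact: bounded_measurable_L1.
      (* The sign of the weak derivative cancels the one in the representation of [phi]. *)
      rewrite (weak_derivativeE (hg i).2 (tk i)) mulrA -exprD addnn -mul2n.
      by rewrite exprM sqrrN !expr1n mul1r.
    transitivity (\int[mu]_z (\sum_i (phi (e z) * \int[mu]_w (k i (e z) (e w) * g' i w)))).
      rewrite Rint_sum; last by move=> i; exact: (L1_fubini_kernel (rk i) (lg i) lphi).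
      apply: eq_bigr => i _.
      by rewrite (Rint_kernel (rk i) (lg i) lphi).
    apply: eq_Rintegral => z _; rewrite -mulr_sumr -/(G (e z)).
    have [Oz|Oz] := pselect (Omega z); first by rewrite indicE mem_set// mul1r mulrC.
    (* Off [Omega] only the vanishing of [phi] helps; as [phi] lives on the image of [Omega],
       injectivity of [e] is what places [e z] outside. *)
    rewrite (test_function_out tphi) ?mul0r ?mulr0// => -[z' Oz' /einj zz'].
    by apply: Oz; rewrite -zz'.
apply: filterS => z /= h Oz; have := h Logic.I.
by rewrite patchE indicE mem_set// mul1r => /eqP; rewrite subr_eq0 => /eqP.
Qed.

End continuous_representative.

(** * Integration by parts in one variable *)

Section one_dimensional_integration_by_parts.
Context {R : realType}.
Local Notation mR := (measurableTypeR R).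
Local Notation mu := (@lebesgue_measure R).

Lemma measurable_indic_le d (T : measurableType d) (f g : T -> mR) :
  measurable_fun setT f -> measurable_fun setT g ->
  measurable_fun setT (fun z => ((f z <= g z)%R%:R : R)).
Proof.
move=> mf mg; apply: (@measurableT_comp _ _ _ _ _ _ (fun b : bool => (b%:R : R))) => //.
exact: measurable_fun_ler.
Qed.

Lemma bool_bounded (b : bool) : `|b%:R : R| <= 1.
Proof. by case: b; rewrite ?normr1 ?normr0. Qed.

Lemma primitiveE (h : R -> R) x : primitive h x = \int[mu]_s ((s <= x)%R%:R * h s).
Proof.
rewrite /primitive Rintegral_indic; apply: eq_Rintegral => s _.
by rewrite indicE mem_setE in_itv.
Qed.

Lemma L1_indic_le (h : R -> R) x : L1 mu h -> L1 mu (fun s : mR => (s <= x)%R%:R * h s).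
Proof.
move=> lh; apply: L1M_bounded => //; last by exists 1 => s; exact: bool_bounded.
by apply: (measurable_indic_le (f := fun s : mR => s) (g := fun=> x)).
Qed.

Lemma L1_indic_ge (h : R -> R) x : L1 mu h -> L1 mu (fun s : mR => (x <= s)%R%:R * h s).
Proof.
move=> lh; apply: L1M_bounded => //; last by exists 1 => s; exact: bool_bounded.
by apply: (measurable_indic_le (f := fun=> x) (g := fun s : mR => s)).
Qed.

Lemma primitive_continuous (h : R -> R) : L1 mu h -> continuous (primitive h).
Proof.
move=> lh v; apply: sequential_continuity => u uv.
under eq_fun do rewrite primitiveE; rewrite primitiveE.
have mh := L1_measurable lh.
apply: (@Rdominated_cvg _ _ _ mu (fun n s => (s <= u n)%R%:R * h s) _ (fun z => `|h z|)).
- by move=> n; exact: L1_measurable (L1_indic_le _ lh).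
- exact: L1_measurable (L1_indic_le _ lh).
- exists [set v]; split => //; first exact: lebesgue_measure_set1.
  move=> s /= hs; apply: contrapT => sv; apply: hs; apply: cvgMl.
  have [vs|sv'|/esym//] := ltgtP v s.
    apply: cvg_near_cst; near=> n; suff -> : (s <= u n)%R = false by [].
    by apply/negbTE; rewrite -ltNge; near: n; exact: (cvgr_lt v).
  apply: cvg_near_cst; near=> n; suff -> : (s <= u n)%R = true by [].
  by apply: ltW; near: n; exact: (cvgr_gt v).
- exact: (integrable_norm lh).
- by move=> n s; rewrite normrM ler_piMl// bool_bounded.
Unshelve. all: by end_near. Qed.

Lemma tests1_derive a b (phi : R -> R) : tests1 a b phi -> tests1 a b ('D_(1 : R) phi).
Proof.
move=> [sphi [p [q [ap pq qb phi0]]]]; split; first exact: smooth_derive.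
(* Every point outside the larger interval has a whole neighbourhood on which [phi] vanishes, which
   may fail at [p] and [q]. *)
pose p' := (a + p) / 2; pose q' := (q + b) / 2.
exists p', q'; split; rewrite /p' /q'; [lra|lra|lra|move=> x xpq].
have [xp|xq] : x < p \/ q < x.
  move: xpq; rewrite negb_and -!leNgt => /orP[xp|qx]; [left|right]; lra.
- rewrite (@near_eq_derive _ _ _ _ (cst 0))//; first by rewrite derive_cst.
  near=> y; apply: phi0; rewrite negb_and -!leNgt; apply/orP; left; apply: ltW.
  by near: y; exact: lt_nbhsl.
- rewrite (@near_eq_derive _ _ _ _ (cst 0))//; first by rewrite derive_cst.
  near=> y; apply: phi0; rewrite negb_and -!leNgt; apply/orP; right; apply: ltW.
  by near: y; exact: lt_nbhsr.
Unshelve. all: by end_near. Qed.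

Lemma primitive_derive a b (phi : R -> R) : tests1 a b phi ->
  primitive ('D_(1 : R) phi) = phi.
Proof.
move=> tphi; have tD := tests1_derive tphi.
have lD := tests1_integrable tD; have cD := tests1_continuous tD.
have [sphi [p [q [ap pq qb phi0]]]] := tphi.
have [_ [p' [q' [ap' pq' qb' D0]]]] := tD.
apply/funext => x; have [xp|px] := leP x (Num.min p p').
  rewrite phi0; last by rewrite negb_and -!leNgt; move: xp; rewrite le_min => /andP[->].
  rewrite primitiveE -[RHS](Rint_zero mu); apply: eq_Rintegral => s _.
  have [sx|] := leP s x; last by rewrite mul0r.
  rewrite mul1r D0// negb_and -!leNgt.
  by move: xp; rewrite le_min => /andP[_ xp]; rewrite (le_trans sx).
(* Up to [r] both [phi] and its derivative vanish; from [r] on, the fundamental theorem of calculus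
   applies. *)
set r := Num.min p p' in px.
have E : primitive ('D_(1 : R) phi) x = \int[mu]_(t in `[r, x]) 'D_(1 : R) phi t.
  rewrite primitiveE [RHS]Rintegral_indic; apply: eq_Rintegral => s _.
  rewrite indicE mem_setE in_itv/=; have [rs//|sr] := leP r s.
  rewrite D0 ?mulr0// negb_and -!leNgt; apply/orP; left.
  by rewrite (le_trans (ltW sr))// /r ge_min lexx orbT.
rewrite E /Rintegral (@continuous_FTC2 _ _ phi)//.
- rewrite /= (phi0 r) ?subr0// negb_and -!leNgt /r ge_min lexx//.
- exact: continuous_subspaceT.
- split.
  + by move=> z _; exact: smooth_derivable.
  + by apply: cvg_at_right_filter; exact: tests1_continuous tphi r.
  + by apply: cvg_at_left_filter; exact: tests1_continuous tphi x.
- by move=> z _; rewrite derive1E.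
Qed.

Lemma Rint_derive a b (phi : R -> R) : tests1 a b phi ->
  \int[mu]_x 'D_(1 : R) phi x = 0.
Proof.
move=> tphi; have E := primitive_derive tphi.
have [_ [p [q [ap pq qb phi0]]]] := tphi.
have [_ [p' [q' [ap' pq' qb' D0]]]] := tests1_derive tphi.
rewrite -(phi0 (Num.max q q')); last first.
  by rewrite negb_and -!leNgt le_max lexx orbT.
rewrite -[in RHS]E primitiveE; apply: eq_Rintegral => s _.
have [|qs] := leP s (Num.max q q'); first by rewrite mul1r.
rewrite D0 ?mulr0// negb_and -!leNgt; apply/orP; right.
by rewrite (le_trans _ (ltW qs))// le_max lexx orbT.
Qed.

Lemma Rint_ge_derive a b (phi : R -> R) s : tests1 a b phi ->
  \int[mu]_x ((s <= x)%R%:R * 'D_(1 : R) phi x) = - phi s.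
Proof.
move=> tphi; have lD := tests1_integrable (tests1_derive tphi).
rewrite -[in RHS](primitive_derive tphi) primitiveE.
apply/eqP; rewrite -subr_eq0 opprK -RintegralD//; last 2 first.
- exact: L1_indic_ge.
- exact: L1_indic_le.
rewrite -(Rint_derive tphi); apply/eqP; apply: ae_eq_Rintegral.
- apply: measurable_funD; first exact: L1_measurable (L1_indic_ge _ lD).
  exact: L1_measurable (L1_indic_le _ lD).
- exact: L1_measurable lD.
exists [set s]; split => //; first exact: lebesgue_measure_set1.
move=> x /= hx; apply: contrapT => xs; apply: hx => _.
have [sx|xs'|/esym//] := ltgtP s x; by rewrite mul1r mul0r ?addr0 ?add0r.
Qed.

Lemma L1_mul_tests1 a b (h phi : R -> R) : L1 mu h -> tests1 a b phi ->
  L1 mu (fun x : mR => h x * phi x).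
Proof.
move=> lh tphi; under eq_fun do rewrite mulrC; apply: L1M_bounded => //.
  exact: tests1_measurable tphi.
exact: tests1_bounded tphi.
Qed.

(** As [h] is merely integrable, its primitive need not be differentiable everywhere. Fubini over
    the region s <= x integrates the derivative of [phi] from s on instead, which gives - phi(s). *)
Lemma integration_by_parts_primitive a b (h phi : R -> R) : L1 mu h -> tests1 a b phi ->
  \int[mu]_x (primitive h x * 'D_(1 : R) phi x) = - \int[mu]_x (h x * phi x).
Proof.
move=> lh tphi; have tD := tests1_derive tphi; have lD := tests1_integrable tD.
pose f (z : mR * mR) := (z.2 <= z.1)%R%:R * ('D_(1 : R) phi z.1 * h z.2).
have sf := sigma_finiteT mu.
have lf : L1 (mu \x mu)%E f.
  apply: (@L1M_bounded _ _ _ _ (fun z : mR * mR => (z.2 <= z.1)%R%:R)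
      (fun z => 'D_(1 : R) phi z.1 * h z.2)); last exact: (L1_tensor sf lD lh).
    by apply: (measurable_indic_le (f := fun z : mR * mR => z.2) (g := fun z => z.1));
      [exact: measurable_snd|exact: measurable_fst].
  by exists 1 => z; exact: bool_bounded.
transitivity (\int[mu]_x \int[mu]_s f (x, s)).
  apply: eq_Rintegral => x _; rewrite primitiveE mulrC -RintegralZl//.
    by apply: eq_Rintegral => s _; rewrite /f/=; ring.
  exact: L1_indic_le.
rewrite (Rfubini1 sf lf) -(Rfubini2 sf lf) -[RHS]mulN1r -RintegralZl//; last first.
  exact: L1_mul_tests1 tphi.
apply: eq_Rintegral => s _.
transitivity (h s * \int[mu]_x ((s <= x)%R%:R * 'D_(1 : R) phi x)).
  rewrite -RintegralZl//; last exact: L1_indic_ge.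
  by apply: eq_Rintegral => x _; rewrite /f/=; ring.
by rewrite (Rint_ge_derive _ tphi); ring.
Qed.

Lemma primitive_bounded (h : R -> R) : L1 mu h ->
  exists M, forall x, `|primitive h x| <= M.
Proof.
move=> lh; exists (\int[mu]_x `|h x|) => x; rewrite primitiveE.
rewrite (le_trans (le_normr_Rintegral _ _))//; first exact: L1_indic_le.
apply: le_Rintegral => //.
- exact: (integrable_norm (L1_indic_le _ lh)).
- exact: (integrable_norm lh).
- by move=> s _; rewrite normrM ler_piMl// bool_bounded.
Qed.

Lemma L1_primitive_mul (h f : R -> R) : L1 mu h -> L1 mu f ->
  L1 mu (fun x : mR => primitive h x * f x).
Proof.
move=> lh lf; apply: L1M_bounded => //; last exact: primitive_bounded.
exact: continuous_measurable_fun (primitive_continuous lh).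
Qed.

Lemma Rint_eq_except (f g : R -> R) (t : R) :
  measurable_fun setT (f : mR -> mR) -> measurable_fun setT (g : mR -> mR) ->
  (forall x, x != t -> f x = g x) -> \int[mu]_x f x = \int[mu]_x g x.
Proof.
move=> mf mg fg; apply: ae_eq_Rintegral => //.
exists [set t]; split => //; first exact: lebesgue_measure_set1.
by move=> x /= hx; apply: contrapT => /eqP xt; apply: hx => _; exact: fg.
Qed.

Lemma primitive_from (h : R -> R) (t x : R) : L1 mu h ->
  primitive (fun s => (t <= s)%R%:R * h s) x =
  (t <= x)%R%:R * (primitive h x - primitive h t).
Proof.
move=> lh; have lht := L1_indic_ge t lh.
have [tx|xt] := leP t x; last first.
  rewrite mul0r primitiveE -[RHS](Rint_zero mu); apply: eq_Rintegral => s _.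
  have [sx|] := leP s x; last by rewrite mul0r.
  by rewrite [(t <= s)%R]leNgt (le_lt_trans sx xt)/= mul0r mulr0.
rewrite mul1r !primitiveE -RintegralB//; [|exact: L1_indic_le|exact: L1_indic_le].
apply: (@Rint_eq_except _ _ t).
- exact: L1_measurable (L1_indic_le _ lht).
- by apply: measurable_funB; exact: L1_measurable (L1_indic_le _ lh).
- move=> s st; have [ts|st'|est] := ltgtP t s; last by rewrite est eqxx in st.
    by rewrite mul1r mul0r subr0.
  by rewrite mul0r mulr0 (le_trans (ltW st') tx) mul1r subrr.
Qed.

Section above_below.
Variables (a b : R) (g h phi : R -> R) (c t : R).
Hypotheses (lh : L1 mu h) (tphi : tests1 a b phi).
Hypothesis gE : forall x, a <= x <= b -> g x = c + primitive h x.
Hypothesis tab : a <= t <= b.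
Let tD := tests1_derive tphi.
Let lD := tests1_integrable tD.
Let Dout x : ~~ (a < x < b) -> 'D_(1 : R) phi x = 0.
Proof.
move=> xab; have [_ [p [q [ap pq qb D0]]]] := tD; apply: D0.
by apply: contra xab => /andP[px xq]; rewrite (lt_trans ap px) (lt_trans xq qb).
Qed.

Lemma Rint_inside (f : R -> R) :
  (forall x, a < x < b -> f x * 'D_(1 : R) phi x = g x * 'D_(1 : R) phi x) ->
  (fun x => \1_(`]a, b[%classic : set R) x * (g x * 'D_(1 : R) phi x)) =
  (fun x => f x * 'D_(1 : R) phi x).
Proof.
move=> fg; apply/funext => x; rewrite indicE mem_setE in_itv/=.
have [xab|xab] := boolP (a < x < b); first by rewrite mul1r fg.
by rewrite Dout// !mulr0.
Qed.

(** From [t] on, [g] is the constant [g t] plus the primitive of [h] cut off below [t]. The constant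
    produces the boundary term, the primitive is integrated by parts over the whole line. *)
Lemma integration_by_parts_above :
  \int[mu]_x ((t <= x)%R%:R * (\1_(`]a, b[%classic : set R) x * (g x * 'D_(1 : R) phi x))) =
  - (g t * phi t) - \int[mu]_x ((t <= x)%R%:R * (h x * phi x)).
Proof.
pose ht s := (t <= s)%R%:R * h s; have lht : L1 mu ht := L1_indic_ge t lh.
transitivity (\int[mu]_x (g t * ((t <= x)%R%:R * 'D_(1 : R) phi x) +
    primitive ht x * 'D_(1 : R) phi x)).
  apply: eq_Rintegral => x _; rewrite primitive_from// indicE mem_setE in_itv/=.
  have [xab|xab] := boolP (a < x < b); last by rewrite Dout//; ring.
  have xab' : a <= x <= b by case/andP : xab => /ltW -> /ltW ->.
  rewrite mul1r (gE xab') (gE tab); ring.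
rewrite RintegralD//; last 2 first.
- exact/L1Z/L1_indic_ge.
- exact: L1_primitive_mul.
rewrite RintegralZl//; last exact: L1_indic_ge.
rewrite (Rint_ge_derive _ tphi) (integration_by_parts_primitive lht tphi) mulrN.
by congr (_ - _); apply: eq_Rintegral => x _; rewrite /ht; ring.
Qed.

(** Over the whole line there is no boundary term, so subtracting the part above [t] leaves the part
    below with the opposite boundary term. *)
Lemma integration_by_parts_below :
  \int[mu]_x ((x <= t)%R%:R * (\1_(`]a, b[%classic : set R) x * (g x * 'D_(1 : R) phi x))) =
  g t * phi t - \int[mu]_x ((x <= t)%R%:R * (h x * phi x)).
Proof.
have E : (fun x => \1_(`]a, b[%classic : set R) x * (g x * 'D_(1 : R) phi x)) =
    (fun x => (c + primitive h x) * 'D_(1 : R) phi x).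
  by apply: Rint_inside => x /andP[ax xb]; rewrite -gE// !ltW.
have lP := L1_primitive_mul lh lD.
have lE : L1 mu (fun x : mR => \1_(`]a, b[%classic : set R) x * (g x * 'D_(1 : R) phi x)).
  by rewrite E; under eq_fun do rewrite mulrDl; apply: L1D => //; exact: L1Z.
have lhp := L1_mul_tests1 lh tphi.
have split_at (f : R -> R) : L1 mu f -> \int[mu]_x f x =
    \int[mu]_x ((t <= x)%R%:R * f x) + \int[mu]_x ((x <= t)%R%:R * f x).
  move=> lf; rewrite -RintegralD//; last 2 first.
  - exact: L1_indic_ge.
  - exact: L1_indic_le.
  apply: (@Rint_eq_except _ _ t); first exact: L1_measurable lf.
    apply: measurable_funD; first exact: L1_measurable (L1_indic_ge _ lf).
    exact: L1_measurable (L1_indic_le _ lf).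
  by move=> x xt; have [tx|xt'|ext] := ltgtP t x;
    rewrite ?mul1r ?mul0r ?addr0 ?add0r//; rewrite ext eqxx in xt.
have := split_at _ lE; rewrite integration_by_parts_above {1}E.
rewrite (_ : (\int[mu]_x ((c + primitive h x) * 'D_(1 : R) phi x)) =
    - (\int[mu]_x (h x * phi x))); last first.
  under eq_Rintegral do rewrite mulrDl; rewrite RintegralD//; last exact: L1Z.
  by rewrite RintegralZl// (Rint_derive tphi) mulr0 add0r (integration_by_parts_primitive lh tphi).
rewrite (split_at _ lhp).
move: (g t * phi t) (\int[mu]_x ((t <= x)%R%:R * (h x * phi x)))
  (\int[mu]_x ((x <= t)%R%:R * (h x * phi x))) => X Y Z.
by move: (\int[mu]_x _) => Q E1; lra.
Qed.

End above_below.

End one_dimensional_integration_by_parts.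

(** * Almost every section of a function and of its weak derivative *)

Lemma ae_section d1 d2 (T1 : measurableType d1) (T2 : measurableType d2)
    (R : realType) (m1 : {measure set T1 -> \bar R})
    (m2 : {sigma_finite_measure set T2 -> \bar R}) (Q : set (T1 * T2)) :
  {ae (m1 \x m2)%E, forall z, Q z} ->
  {ae m1, forall x, {ae m2, forall y, Q (x, y)}}.
Proof.
move=> [N [mN N0 NQ]].
have mNx : measurable_fun setT (m2 \o xsection N) by exact: measurable_fun_xsection.
(* The measure of [N] is the integral of the measures of its sections. *)
have : (\int[m1]_x `|(m2 \o xsection N) x| = 0)%E.
  by rewrite -N0; apply: eq_integral => x _; rewrite gee0_abs//=.
move/(ae_eq_integral_abs m1 measurableT mNx); apply: filterS => x /= /(_ Logic.I) x0.
exists (xsection N x); split => //; first exact: measurable_xsection.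
by move=> y /= nQ; rewrite /xsection/= inE; apply: NQ.
Qed.

Section weak_derivative_sections.
Context d (P : measurableType d) (R : realType) (V : normedModType R).
Local Notation mR := (measurableTypeR R).
Local Notation L := (@lebesgue_measure R).
Variables (pi : {measure set P -> \bar R}) (e : P -> V).
Hypothesis sfpi : sigma_finite setT pi.
Let n1 := [the {sigma_finite_measure set P -> \bar R} of sigma_finite_pack sfpi].
Variables (Omega : set P) (C : set (V -> R)).
Hypotheses (mO : measurable Omega) (Ooo : (pi Omega < +oo)%E).
Hypotheses (tC : tests_on pi e Omega C) (dC : dense_tests pi e Omega C).
Variables (a b : R).
Hypothesis ab : a < b.
Variables (F F' : P * mR -> R).
Hypotheses (lF : L1 (pi \x L)%E F) (lF' : L1 (pi \x L)%E F').
Hypothesis F0 : forall z, ~ (Omega `*` (`]a, b[%classic : set R)) z -> F z = 0.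
Hypothesis F'0 : forall z, ~ (Omega `*` (`]a, b[%classic : set R)) z -> F' z = 0.
Hypothesis FF' : forall rho phi, C rho -> tests1 a b phi ->
  \int[(pi \x L)%E]_z (F z * (rho (e z.1) * 'D_(1 : R) phi z.2)) =
  - \int[(pi \x L)%E]_z (F' z * (rho (e z.1) * phi z.2)).

Let Hs (z : P * mR) : R := primitive (fun s => F' (z.1, s)) z.2.

Local Notation I := (`]a, b[%classic : set R).

Let lI : L1 L (\1_I : mR -> R).
Proof.
have Ioo : (L `]a, b[%classic < +oo)%E.
  by rewrite lebesgue_measure_itv/= lte_fin ab -EFinB ltry.
by apply: L1_indic; [exact: measurable_itv|exact: Ioo].
Qed.

Let lIH : L1 (pi \x L)%E (fun z => \1_I z.2 * Hs z).
Proof.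
(* The variables are ((p, s), x). Integrating out s gives [Hs] cut off to [I], and with it the joint
   measurability and integrability of [Hs]. *)
pose Q (z : P * mR * mR) := (z.1.2 <= z.2)%R%:R * (F' z.1 * \1_I z.2).
have lQ : L1 (pi \x L \x L)%E Q.
  apply: (@L1M_bounded _ _ _ _ (fun z : P * mR * mR => (z.1.2 <= z.2)%R%:R)
    (fun z => F' z.1 * \1_I z.2)).
  - apply: (measurable_indic_le (f := fun z : P * mR * mR => z.1.2) (g := fun z => z.2)).
      exact: (measurableT_comp measurable_snd measurable_fst).
    exact: measurable_snd.
  - by exists 1 => z; exact: bool_bounded.
  - by apply: (L1_tensor (sigma_finite_prod L sfpi) lF' lI).
have lQ' := mp_L1 (mp_swap_last L L sfpi) lQ.
have := L1_fubini1 (sigma_finite_prod L sfpi) lQ'.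
congr (L1 _ _); apply/funext => -[p x] /=; rewrite /Q/= /Hs primitiveE indicE.
case: (x \in _); last first.
  by rewrite mul0r -[RHS](Rint_zero L); apply: eq_Rintegral => s _; rewrite !mulr0.
by rewrite mul1r; apply: eq_Rintegral => s _; rewrite mulr1.
Qed.

Let tests1_inside phi x : tests1 a b phi -> phi x = \1_I x * phi x.
Proof.
move=> tphi; rewrite indicE; have [|xI] := boolP (x \in I); first by rewrite mul1r.
rewrite mul0r; apply: (test_function_out (tests1_test_function tphi)).
by move=> xI'; rewrite mem_set in xI.
Qed.

Let lH phi : tests1 a b phi -> L1 (pi \x L)%E (fun z => phi z.2 * Hs z).
Proof.
move=> tphi; rewrite (_ : (fun z => _) = fun z => phi z.2 * (\1_I z.2 * Hs z)).
  by apply: L1_snd_mul => //; [exact: tests1_measurable tphi|exact: tests1_bounded tphi].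
by apply/funext => z; rewrite {1}(tests1_inside z.2 tphi); ring.
Qed.

Let lFt phi : tests1 a b phi -> L1 (pi \x L)%E (fun z => phi z.2 * F z).
Proof.
by move=> tphi; apply: L1_snd_mul => //;
  [exact: tests1_measurable tphi|exact: tests1_bounded tphi].
Qed.

Let lF't phi : tests1 a b phi -> L1 (pi \x L)%E (fun z => phi z.2 * F' z).
Proof.
by move=> tphi; apply: L1_snd_mul => //;
  [exact: tests1_measurable tphi|exact: tests1_bounded tphi].
Qed.

Lemma ae_sections_L1 (f : P * mR -> R) : L1 (pi \x L)%E f ->
  {ae pi, forall p, L1 L (fun x => f (p, x))}.
Proof. exact: (@ae_integrable1 _ _ _ _ _ n1 L). Qed.

(** The lemma of du Bois-Reymond with a parameter. What remains of [F] after subtracting [Hs] and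
    its weighted mean is orthogonal to all products of test functions, so it vanishes almost
    everywhere on the product; only then is it cut into sections, which yields a single null set of
    parameters. *)
Lemma ae_section_primitive : {ae pi, forall p, exists c,
  {ae L, forall x, a < x < b -> F (p, x) = c + primitive (fun s => F' (p, s)) x}}.
Proof.
have [w [tw w1 _ _]] := exists_weight ab.
have lw := tests1_integrable tw; have cw := tests1_continuous tw.
have m1O : measurable_fun setT (\1_Omega : P -> R) by exact: measurable_indic.
(* If F - Hs is constant on the section over p, then the weight [w], of integral 1, recovers this
   constant. *)
pose cE p := \int[L]_x (w x * (F (p, x) - Hs (p, x))).
have lcE : L1 pi cE.
  apply: (L1_fubini1 sfpi (f := fun z : P * mR => w z.2 * (F z - Hs z))).
  by under eq_fun do rewrite mulrBr; apply: L1B; [exact: lFt|exact: lH].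
pose E (z : P * mR) := \1_Omega z.1 * (\1_I z.2 * (F z - Hs z - cE z.1)).
have lE : L1 (pi \x L)%E E.
  apply: L1_fst_mul => //; first exact: indic_bounded.
  rewrite (_ : (fun z => _) = fun z => \1_I z.2 * F z - \1_I z.2 * Hs z - cE z.1 * \1_I z.2).
    apply: L1B; last exact: (L1_tensor sfpi lcE lI).
    apply: L1B => //; apply: L1_snd_mul => //; exact: indic_bounded.
  by apply/funext => z; ring.
(* phi minus (int phi) w is the derivative of a test function psi. *)
have inner phi : tests1 a b phi -> exists2 psi, tests1 a b psi &
    forall p, Omega p -> L1 L (fun x => F (p, x)) -> L1 L (fun x => F' (p, x)) ->
    \int[L]_x (E (p, x) * phi x) =
    \int[L]_x (F (p, x) * 'D_(1 : R) psi x + F' (p, x) * psi x).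
  move=> tphi; have lphi := tests1_integrable tphi.
  pose c := \int[L]_x phi x; pose h x := phi x + - c * w x.
  have th : tests1 a b h by apply: tests1D => //; exact: tests1Z.
  have lh := tests1_integrable th.
  have h0 : \int[L]_x h x = 0.
    by rewrite /h RintegralD//; [rewrite RintegralZl// w1 -/c; ring|exact: L1Z].
  have tpsi := tests1_primitive th h0; exists (primitive h) => // p Op lFp lF'p.
  have Dpsi x : 'D_(1 : R) (primitive h) x = h x.
    have [_ ->] := is_derive_primitive x 1 (tests1_continuous th) lh.
    by rewrite mul1r.
  have lFphi := L1_mul_tests1 lFp tphi; have lFw := L1_mul_tests1 lFp tw.
  have lHphi := L1_primitive_mul lF'p lphi; have lHw := L1_primitive_mul lF'p lw.
  have ibp : \int[L]_x (primitive (fun s => F' (p, s)) x * h x) =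
      - \int[L]_x (F' (p, x) * primitive h x).
    rewrite -(integration_by_parts_primitive lF'p tpsi).
    by apply: eq_Rintegral => x _; rewrite Dpsi.
  transitivity (\int[L]_x (F (p, x) * h x + F' (p, x) * primitive h x)); last first.
    by apply: eq_Rintegral => x _; rewrite Dpsi.
  rewrite RintegralD//; last 2 first.
  - exact: L1_mul_tests1 th.
  - exact: L1_mul_tests1 tpsi.
  rewrite -[X in _ = _ + X]opprK -ibp.
  have -> : \int[L]_x (F (p, x) * h x) =
      \int[L]_x (F (p, x) * phi x) - c * \int[L]_x (F (p, x) * w x).
    rewrite -RintegralZl// -RintegralB//; last exact: L1Z.
    by apply: eq_Rintegral => x _; rewrite /h; ring.
  have -> : \int[L]_x (primitive (fun s => F' (p, s)) x * h x) =
      \int[L]_x (primitive (fun s => F' (p, s)) x * phi x) -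
      c * \int[L]_x (primitive (fun s => F' (p, s)) x * w x).
    rewrite -RintegralZl// -RintegralB//; last exact: L1Z.
    by apply: eq_Rintegral => x _; rewrite /h; ring.
  have cEp : cE p = \int[L]_x (F (p, x) * w x) -
      \int[L]_x (primitive (fun s => F' (p, s)) x * w x).
    by rewrite -RintegralB//; apply: eq_Rintegral => x _; rewrite /Hs/=; ring.
  transitivity (\int[L]_x (F (p, x) * phi x -
      primitive (fun s => F' (p, s)) x * phi x - cE p * phi x)).
    apply: eq_Rintegral => x _; rewrite /E/= indicE mem_set// mul1r.
    by rewrite {2 3 4}(tests1_inside x tphi) /Hs/=; ring.
  rewrite RintegralB//; last 2 first.
  - exact: L1B.
  - exact: L1Z.
  by rewrite RintegralB// RintegralZl// -/c cEp; ring.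
have Eae : ae_eq (pi \x L)%E setT E (cst 0).
  apply: (dense_tensors sfpi tC (tests1_on (a:=a) (b:=b)) dC (dense_tests1 (a:=a) (b:=b))).
  - exact: lE.
  - move=> z Oz; rewrite /E.
    have [Op|Op] := pselect (Omega z.1); last by rewrite indicE memNset// mul0r.
    rewrite [\1_I _]indicE memNset ?mul0r ?mulr0// => Iz; exact: Oz.
  - move=> _ [rho Crho [phi tphi ->]]; have [_ [mrho brho] _] := tC Crho.
    have [psi tpsi innerE] := inner _ tphi; have tD := tests1_derive tpsi.
    have brho' : exists M, forall p, `|(rho \o e) p| <= M.
      by move: brho => [M hM]; exists M => p; exact: hM.
    have lEphi : L1 (pi \x L)%E (fun z => phi z.2 * E z).
      by apply: L1_snd_mul => //;
        [exact: tests1_measurable tphi|exact: tests1_bounded tphi].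
    transitivity (\int[pi]_p ((rho \o e) p * \int[L]_x (phi x * E (p, x)))).
      rewrite (@Rfubini1_mul _ _ _ _ _ pi L sfpi (rho \o e) (fun z => phi z.2 * E z))//.
      by apply: eq_Rintegral => z _; rewrite /tensor/=; ring.
    (* By [FF'], applied to [rho] and [psi], the integral of [K] against [rho] is zero. *)
    pose K (z : P * mR) := 'D_(1 : R) psi z.2 * F z + psi z.2 * F' z.
    have lK : L1 (pi \x L)%E K by apply: L1D; [exact: (lFt tD)|exact: (lF't tpsi)].
    transitivity (\int[pi]_p ((rho \o e) p * \int[L]_x K (p, x))).
      apply: ae_eq_Rintegral.
      + by apply: measurable_funM => //; exact: L1_measurable (L1_fubini1 sfpi lEphi).
      + by apply: measurable_funM => //; exact: L1_measurable (L1_fubini1 sfpi lK).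
      have := ae_sections_L1 lF'; have := ae_sections_L1 lF.
      apply: filterS2 => p lFp lF'p _; congr (_ * _).
      have [Op|Op] := pselect (Omega p).
        transitivity (\int[L]_x (E (p, x) * phi x)).
          by apply: eq_Rintegral => x _; rewrite mulrC.
        by rewrite innerE//; apply: eq_Rintegral => x _; rewrite /K/=; ring.
      apply: eq_Rintegral => x _; rewrite /E /K/= indicE memNset// mul0r.
      by rewrite F0 ?F'0; [ring|case|case].
    rewrite (@Rfubini1_mul _ _ _ _ _ pi L sfpi (rho \o e) K)//.
    have -> : \int[(pi \x L)%E]_z ((rho \o e) z.1 * K z) =
        \int[(pi \x L)%E]_z (F z * (rho (e z.1) * 'D_(1 : R) psi z.2)) +
        \int[(pi \x L)%E]_z (F' z * (rho (e z.1) * psi z.2)).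
      rewrite -RintegralD//; last 2 first.
      + have := L1_fst_mul mrho brho' (lFt tD).
        by congr (L1 _ _); apply/funext => z /=; ring.
      + have := L1_fst_mul mrho brho' (lF't tpsi).
        by congr (L1 _ _); apply/funext => z /=; ring.
      by apply: eq_Rintegral => z _; rewrite /K/=; ring.
    by rewrite FF'// addNr.
move/ae_section : Eae => Eae.
apply: filterS Eae => p Ep; have [Op|Op] := pselect (Omega p); last first.
  exists 0; apply: aeW => x _; rewrite F0; last by case.
  rewrite primitiveE add0r -[LHS](Rint_zero L); apply: eq_Rintegral => s _.
  by rewrite F'0 ?mulr0//; case.
exists (cE p); apply: filterS Ep => x /= /(_ Logic.I) + xab.
rewrite /E/= indicE mem_set// mul1r indicE mem_set ?mul1r/=; last by rewrite in_itv.
by rewrite /Hs/= => /eqP; rewrite subr_eq0 subr_eq => /eqP.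
Qed.

End weak_derivative_sections.

Section ae_continuous.
Context {R : realType}.
Local Notation L := (@lebesgue_measure R).

(** Were the functions different at [x], continuity would keep them apart on an open interval next
    to [x], to its right if x < b and to its left if x = b. Such an interval is not null. *)
Lemma ae_eq_within_continuous (a b : R) (f g : R -> R) : a < b ->
  {within `[a, b], continuous f} -> {within `[a, b], continuous g} ->
  {ae L, forall x, a < x < b -> f x = g x} ->
  forall x, a <= x <= b -> f x = g x.
Proof.
move=> ab cf cg [N [mN N0 NP]] x xab; apply: contrapT => fgx.
have xI : `[a, b]%classic x by rewrite /= in_itv.
have e0 : 0 < `|f x - g x| / 2 by rewrite divr_gt0// normr_gt0 subr_eq0; exact/eqP.
have near_x (h : R -> R) : {within `[a, b], continuous h} ->
    nbhs x (fun y => `[a, b]%classic y -> `|h x - h y| < `|f x - g x| / 2).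
  move=> ch; have := ch x => /cvgrPdist_lt/(_ _ e0) hx.
  rewrite -[nbhs x _]/(within `[a, b] (nbhs x) (fun y => `|h x - h y| < _)).
  by rewrite (nbhs_subspace_in xI).
have hf := near_x _ cf; have hg := near_x _ cg.
have /nbhs_ballP[d1 /= d10 hd1] := hf; have /nbhs_ballP[d2 /= d20 hd2] := hg.
pose d := Num.min d1 d2; have d0 : 0 < d by rewrite lt_min d10.
have fgN y : a < y < b -> `|x - y| < d -> N y.
  move=> yab xy; apply: NP => /= /(_ yab) fgy.
  have yI : `[a, b]%classic y.
    by rewrite /= in_itv/=; case/andP : yab => /ltW -> /ltW ->.
  have h1 : `|f x - f y| < `|f x - g x| / 2.
    by apply: hd1 => //; rewrite -ball_normE/= (lt_le_trans xy)// ge_min lexx.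
  have h2 : `|g x - g y| < `|f x - g x| / 2.
    by apply: hd2 => //; rewrite -ball_normE/= (lt_le_trans xy)// ge_min lexx orbT.
  have : `|f x - g x| < `|f x - g x|; last by rewrite ltxx.
  rewrite {1}(_ : f x - g x = (f x - f y) - (g x - g y)); last by rewrite fgy; ring.
  by rewrite (le_lt_trans (ler_normB _ _))// [ltRHS]splitr ltrD.
have [p [q [pq pqN]]] : exists p q, p < q /\ `]p, q[%classic `<=` N.
  case/andP : (xab) => ax xb.
  have [xb'|bx] := ltP x b.
    exists x, (Num.min b (x + d)); split; first by rewrite lt_min xb' ltrDl.
    move=> y /=; rewrite in_itv/= lt_min => /and3P[xy yb yd].
    apply: fgN; first by rewrite yb andbT (le_lt_trans ax).
    by rewrite distrC ger0_norm ?subr_ge0 ?ltW// ltrBlDl.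
  have xE : x = b by apply/eqP; rewrite eq_le xb bx.
  exists (Num.max a (x - d)), x; split.
    by rewrite gt_max ltrBlDr ltrDl d0 xE ab.
  move=> y /=; rewrite in_itv/= gt_max => /andP[/andP[ay dy] yx].
  apply: fgN; first by rewrite ay -xE.
  by rewrite ger0_norm ?subr_ge0 ?ltW// ltrBlDr -ltrBlDl.
have : (L `]p, q[%classic <= L N)%E by apply: le_measure; rewrite ?inE.
by rewrite N0 lebesgue_measure_itv/= lte_fin pq -EFinB lee_fin leNgt subr_gt0 pq.
Qed.

End ae_continuous.

(* Typeclass search fails to find [ae_filter] on [R] in place of
   [measurableTypeR R]. *)
Lemma leb_ae_and (R : realType) (P Q S : set R) :
  (forall x, P x -> Q x -> S x) ->
  {ae @lebesgue_measure R, forall x, P x} -> {ae @lebesgue_measure R, forall x, Q x} ->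
  {ae @lebesgue_measure R, forall x, S x}.
Proof.
move=> PQS hP hQ.
exact: (@filterS2 (measurableTypeR R) (almost_everywhere (@lebesgue_measure R)) _ P Q S).
Qed.

Section L2_theory.
Context d (T : measurableType d) (R : realType).
Variable mu : {measure set T -> \bar R}.

Definition L2 (f : T -> R) := measurable_fun setT f /\ L1 mu (fun x => f x ^+ 2).

Lemma square_integrable_L2 (D : set T) (f : T -> R) :
  square_integrable mu D f <-> L2 (f \_ D).
Proof. exact: square_integrableP. Qed.

Lemma L2_mul f g : L2 f -> L2 g -> L1 mu (fun x => f x * g x).
Proof.
move=> [mf lf] [mg lg]; apply: (L1_le _ _ (L1D lf lg)); first exact: measurable_funM.
move=> x; rewrite normrM [leRHS]ger0_norm ?addr_ge0 ?sqr_ge0//.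
rewrite -(real_normK (num_real (f x))) -(real_normK (num_real (g x))).
move: (`|f x|) (`|g x|) (normr_ge0 (f x)) (normr_ge0 (g x)) => s t s0 t0.
by have := sqr_ge0 (s - t); nra.
Qed.

Lemma L2_indic A : measurable A -> (mu A < +oo)%E -> L2 (\1_A).
Proof.
move=> mA Aoo; split; first exact: measurable_indic.
rewrite (_ : (fun x => _) = \1_A); first exact: L1_indic.
by apply/funext => x; rewrite indicE; case: (_ \in _); rewrite ?expr1n ?expr0n.
Qed.

Lemma L2M_bounded (h f : T -> R) : measurable_fun setT h ->
  (exists M, forall x, `|h x| <= M) -> L2 f -> L2 (fun x => h x * f x).
Proof.
move=> mh [M hM] [mf lf]; split; first exact: measurable_funM.
under eq_fun do rewrite exprMn; apply: L1M_bounded => //.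
  exact: measurable_funX.
exists (M ^+ 2) => x; rewrite normrX lerXn2r ?nnegrE//.
exact: le_trans (hM x).
Qed.

End L2_theory.

Lemma mp_L2 d1 d2 (X : measurableType d1) (Y : measurableType d2) (R : realType)
    (mu : {measure set X -> \bar R}) (nu : {measure set Y -> \bar R}) (phi : X -> Y)
    (f : Y -> R) : measure_preserving mu nu phi -> L2 nu f -> L2 mu (f \o phi).
Proof.
move=> mp [mf lf]; split; last exact: (mp_L1 mp lf).
by apply: measurableT_comp => //; case: mp.
Qed.

Lemma L2_tensor d1 d2 (T1 : measurableType d1) (T2 : measurableType d2) (R : realType)
    (m1 : {measure set T1 -> \bar R}) (m2 : {sigma_finite_measure set T2 -> \bar R})
    (f : T1 -> R) (g : T2 -> R) : sigma_finite setT m1 ->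
  L2 m1 f -> L2 m2 g -> L2 (m1 \x m2)%E (fun z => f z.1 * g z.2).
Proof.
move=> sf1 [mf lf] [mg lg]; split.
  apply: measurable_funM; first exact: (measurableT_comp mf measurable_fst).
  exact: (measurableT_comp mg measurable_snd).
by under eq_fun do rewrite exprMn; exact: (L1_tensor sf1 lf lg).
Qed.

Section sections_of_weak_derivatives.
Context dP (P : measurableType dP) (R : realType) (VP : normedModType R).
Context dT (T : measurableType dT) (V : normedModType R).
Local Notation mR := (measurableTypeR R).
Local Notation L := (@lebesgue_measure R).
Variables (pi : {measure set P -> \bar R}) (eP : P -> VP).
Variables (mu : {measure set T -> \bar R}) (e : T -> V).
Hypothesis sfpi : sigma_finite setT pi.
Variables (OP : set P) (C : set (VP -> R)).
Hypothesis mOP : measurable OP.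
Hypotheses (tC : tests_on pi eP OP C) (dC : dense_tests pi eP OP C).
Variables (a b : R).
Hypothesis ab : a < b.
Variables (O B : set T) (dx : V) (sg : P * mR -> T).
Hypotheses (mO : measurable O) (Ooo : (mu O < +oo)%E) (OB : O `<=` B).
Hypothesis mpsg : measure_preserving (pi \x L)%E mu sg.
Hypothesis sgO : forall p x, O (sg (p, x)) <-> OP p /\ a < x < b.
Hypothesis tests_sg : forall rho phi, C rho -> tests1 a b phi ->
  exists theta, [/\ test_function (e @` O) theta,
    bounded_measurable e theta, bounded_measurable e (iter_derive [:: dx] theta),
    forall p x, theta (e (sg (p, x))) = rho (eP p) * phi x &
    forall p x, iter_derive [:: dx] theta (e (sg (p, x))) =
      rho (eP p) * 'D_(1 : R) phi x].
Hypothesis section_sg : forall G : V -> R, {within e @` B, continuous G} ->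
  forall p, OP p -> {within `[a, b], continuous (fun x => G (e (sg (p, x))))}.

(** The map [sg] puts x last and is kept abstract, so that three and four variables are treated
    alike. On almost every section both [G] and the primitive agree with [K] almost everywhere;
    continuity makes them equal on all of [a, b], which gives a meaning to the value at the
    diagonal. *)
Lemma ae_section_continuous_version (K K' : T -> R) (G : V -> R) :
  square_integrable mu O K -> square_integrable mu O K' ->
  weak_derivative mu e O [:: dx] K K' ->
  {within e @` B, continuous G} -> ae_eq mu B K (G \o e) ->
  {ae pi, forall p, OP p -> exists c,
    L1 L (fun s => (K' \_ O) (sg (p, s))) /\
    forall x, a <= x <= b ->
      G (e (sg (p, x))) = c + primitive (fun s => (K' \_ O) (sg (p, s))) x} /\
  {ae pi, forall p, OP p -> {ae L, forall x, a < x < b ->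
    (K \_ O) (sg (p, x)) = G (e (sg (p, x)))}}.
Proof.
move=> sK sK' wKK' cG KG.
have lK := square_integrable_L1 mO Ooo sK.
have lK' := square_integrable_L1 mO Ooo sK'.
have lF := mp_L1 mpsg lK; have lF' := mp_L1 mpsg lK'.
have out (f : T -> R) z : ~ (OP `*` (`]a, b[%classic : set R)) z -> (f \_ O) (sg z) = 0.
  move: z => [p x] nz; rewrite patchE memNset// => /sgO[Op xab]; apply: nz.
  by split => //=; rewrite in_itv.
have FF' rho phi : C rho -> tests1 a b phi ->
    \int[(pi \x L)%E]_z ((K \_ O) (sg z) * (rho (eP z.1) * 'D_(1 : R) phi z.2)) =
    - \int[(pi \x L)%E]_z ((K' \_ O) (sg z) * (rho (eP z.1) * phi z.2)).
  move=> Crho tphi; have [theta [ttheta btheta bdtheta thetaE dthetaE]] := tests_sg Crho tphi.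
  have := weak_derivativeE wKK' ttheta; rewrite /= expr1 mulN1r.
  rewrite (mp_Rint mpsg (bounded_measurable_L1 bdtheta lK)).
  rewrite (mp_Rint mpsg (bounded_measurable_L1 btheta lK')) => E.
  transitivity (\int[(pi \x L)%E]_z ((K \_ O) (sg z) * iter_derive [:: dx] theta (e (sg z)))).
    by apply: eq_Rintegral => -[p x] _; rewrite dthetaE.
  by rewrite E; congr (- _); apply: eq_Rintegral => -[p x] _; rewrite thetaE.
have KGae : {ae pi, forall p, OP p -> {ae L, forall x, a < x < b ->
    (K \_ O) (sg (p, x)) = G (e (sg (p, x)))}}.
  have := ae_section (mp_ae mpsg KG); apply: filterS => p hp Op.
  apply: filterS hp => x /= hx xab; have Ox : O (sg (p, x)) by apply/sgO.
  by rewrite patchE mem_set// hx//; exact: OB.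
split => //.
have := ae_section_primitive sfpi mOP tC dC ab lF lF' (out K) (out K') FF'.
have := ae_sections_L1 sfpi lF'.
have := KGae; apply: filterS3 => p hG lF'p [c hc] Op; exists c; split => //.
apply: (ae_eq_within_continuous ab).
- exact: section_sg.
- apply: continuous_subspaceT => x; apply: cvgD; first exact: cvg_cst.
  exact: primitive_continuous.
- by apply: leb_ae_and hc (hG Op) => x /= h1 h2 xab; rewrite -h2// h1.
Qed.

End sections_of_weak_derivatives.

(** * Integration by parts along sections *)

Section section_by_parts.
Context (R : realType).
Local Notation mR := (measurableTypeR R).
Local Notation L := (@lebesgue_measure R).
Variables (a b : R) (F F' : mR -> R) (G phi : R -> R) (c t : R).
Hypotheses (lF : L1 L F) (lF' : L1 L F') (tphi : tests1 a b phi).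
Hypothesis GE : forall x, a <= x <= b -> G x = c + primitive F' x.
Hypothesis FG : {ae L, forall x, a < x < b -> F x = G x}.
Hypothesis Fout : forall x, ~~ (a < x < b) -> F x = 0.
Hypothesis tab : a <= t <= b.

Let tD := tests1_derive tphi.

Lemma ae_section_by_parts (h : mR -> R) : measurable_fun setT h ->
  \int[L]_x (h x * (F x * 'D_(1 : R) phi x)) =
  \int[L]_x (h x * (\1_(`]a, b[%classic : set R) x * (G x * 'D_(1 : R) phi x))).
Proof.
move=> mh; have lF1 := L1_mul_tests1 lF tD.
apply: ae_eq_Rintegral; first by apply: measurable_funM => //; exact: L1_measurable lF1.
  apply: measurable_funM => //.
  have -> : (fun x => \1_(`]a, b[%classic : set R) x * (G x * 'D_(1 : R) phi x)) =
      (fun x : R => (c + primitive F' x) * 'D_(1 : R) phi x).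
    by apply: (Rint_inside tphi) => x /andP[ax xb]; rewrite GE// !ltW.
  apply: L1_measurable; under eq_fun do rewrite mulrDl; apply: L1D.
    exact/L1Z/tests1_integrable/tD.
  exact: (L1_primitive_mul lF' (tests1_integrable tD)).
apply: leb_ae_and FG FG => x Fx _ _; congr (_ * _); rewrite indicE mem_setE in_itv/=.
by have [xab|xab] := boolP (a < x < b); [rewrite Fx// mul1r|rewrite Fout// !mul0r].
Qed.

Lemma section_by_parts_above :
  \int[L]_x ((t <= x)%R%:R * (F x * 'D_(1 : R) phi x)) =
  - (G t * phi t) - \int[L]_x ((t <= x)%R%:R * (F' x * phi x)).
Proof.
rewrite ae_section_by_parts; first exact: (integration_by_parts_above lF' tphi GE tab).
by apply: (measurable_indic_le (f := fun=> t) (g := fun s : mR => s)).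
Qed.

Lemma section_by_parts_below :
  \int[L]_x ((x <= t)%R%:R * (F x * 'D_(1 : R) phi x)) =
  G t * phi t - \int[L]_x ((x <= t)%R%:R * (F' x * phi x)).
Proof.
rewrite ae_section_by_parts; first exact: (integration_by_parts_below lF' tphi GE tab).
by apply: (measurable_indic_le (f := fun s : mR => s) (g := fun=> t)).
Qed.

End section_by_parts.

Section integration_by_parts_sections.
Context d (P : measurableType d) (R : realType).
Local Notation mR := (measurableTypeR R).
Local Notation L := (@lebesgue_measure R).
Variables (pi : {measure set P -> \bar R}).
Hypothesis sfpi : sigma_finite setT pi.
Variables (a b : R).
Variables (F1 F2 F1' F2' : P * mR -> R) (G1 G2 : P -> R -> R).
Variables (U : P -> R) (tau : P -> mR) (Phi : P -> R -> R) (J : P -> R).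
Hypotheses (mtau : measurable_fun setT tau) (mJ : measurable_fun setT J).
Hypothesis Utau : forall p, U p != 0 -> a <= tau p <= b.
Hypothesis tPhi : forall p, tests1 a b (Phi p).
Hypotheses (mPhi : measurable_fun setT (fun z : P * mR => Phi z.1 z.2))
  (mDPhi : measurable_fun setT (fun z : P * mR => 'D_(1 : R) (Phi z.1) z.2)).
Hypotheses (bPhi : exists M, forall p x, `|Phi p x| <= M)
  (bDPhi : exists M, forall p x, `|'D_(1 : R) (Phi p) x| <= M).
Hypotheses (l1 : L1 (pi \x L)%E (fun z => U z.1 * F1 z))
  (l2 : L1 (pi \x L)%E (fun z => U z.1 * F2 z))
  (l1' : L1 (pi \x L)%E (fun z => U z.1 * F1' z))
  (l2' : L1 (pi \x L)%E (fun z => U z.1 * F2' z)).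
Hypotheses (F1out : forall p x, ~~ (a < x < b) -> F1 (p, x) = 0)
  (F2out : forall p x, ~~ (a < x < b) -> F2 (p, x) = 0).

(** Nothing is asked where [U p] vanishes: there the weighted integrands are zero. *)
Definition section_primitive (F F' : P * mR -> R) (G : P -> R -> R) :=
  {ae pi, forall p, U p != 0 -> [/\ L1 L (fun s => F' (p, s)),
    exists c, forall x, a <= x <= b ->
      G p x = c + primitive (fun s => F' (p, s)) x &
    {ae L, forall x, a < x < b -> F (p, x) = G p x}]}.

Hypotheses (h1 : section_primitive F1 F1' G1) (h2 : section_primitive F2 F2' G2).
Hypothesis JE : {ae pi, forall p,
  J p = U p * (G1 p (tau p) - G2 p (tau p)) * Phi p (tau p)}.

(** [F1] acts above [tau p] and [F2] below. The boundary terms have opposite signs, so they add up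
    to the difference of [G1] and [G2] at [tau p], which [J] records. *)
Lemma integration_by_parts_sections :
  \int[(pi \x L)%E]_z (((tau z.1 <= z.2)%R%:R * (U z.1 * F1 z) +
     (z.2 <= tau z.1)%R%:R * (U z.1 * F2 z)) * 'D_(1 : R) (Phi z.1) z.2) =
  - (\int[pi]_p J p) -
  \int[(pi \x L)%E]_z (((tau z.1 <= z.2)%R%:R * (U z.1 * F1' z) +
     (z.2 <= tau z.1)%R%:R * (U z.1 * F2' z)) * Phi z.1 z.2).
Proof.
have mle : measurable_fun setT (fun z : P * mR => (tau z.1 <= z.2)%R%:R : R).
  apply: measurable_indic_le => //; exact: (measurableT_comp mtau measurable_fst).
have mge : measurable_fun setT (fun z : P * mR => (z.2 <= tau z.1)%R%:R : R).
  apply: measurable_indic_le => //; exact: (measurableT_comp mtau measurable_fst).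
have lcut (f1 f2 : P * mR -> R) (psi : P -> R -> R) :
    measurable_fun setT (fun z : P * mR => psi z.1 z.2) ->
    (exists M, forall p x, `|psi p x| <= M) ->
    L1 (pi \x L)%E (fun z => U z.1 * f1 z) -> L1 (pi \x L)%E (fun z => U z.1 * f2 z) ->
    L1 (pi \x L)%E (fun z => ((tau z.1 <= z.2)%R%:R * (U z.1 * f1 z) +
     (z.2 <= tau z.1)%R%:R * (U z.1 * f2 z)) * psi z.1 z.2).
  move=> mpsi [M hM] k1 k2; under eq_fun do rewrite mulrC.
  apply: L1M_bounded => //; first by exists M => z.
  by apply: L1D; apply: L1M_bounded => //; exists 1 => z; exact: bool_bounded.
have lA := lcut _ _ _ mDPhi bDPhi l1 l2; have lB := lcut _ _ _ mPhi bPhi l1' l2'.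
have lI := L1_fubini1 sfpi lA; have lI' := L1_fubini1 sfpi lB.
rewrite -(Rfubini1 sfpi lA) -(Rfubini1 sfpi lB).
set I := fun p => _ in lI; set I' := fun p => _ in lI'.
(* The identity for a single [p], with x integrated out and solved for [J]; if [U p] is zero then so
   are all three terms. *)
have E : ae_eq pi setT (fun p => - I p - I' p) J.
  apply: filterS (filterI h1 (filterI h2 (filterI JE (filterI (ae_sections_L1 sfpi l1)
    (ae_sections_L1 sfpi l2))))) => p [H1 [H2 [-> [/= s1 s2]]]] _.
  have [U0|U0] := eqVneq (U p) 0.
    rewrite /I /I' U0 !mul0r.
    under eq_Rintegral do rewrite !mul0r !mulr0 addr0 mul0r.
    rewrite Rint_zero oppr0 sub0r.
    under eq_Rintegral do rewrite !mul0r !mulr0 addr0 mul0r.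
    by rewrite Rint_zero oppr0.
  have {H1} [lF1' [c1 GE1] FG1] := H1 U0; have {H2} [lF2' [c2 GE2] FG2] := H2 U0.
  (* Integrability is known for the weighted function; on this section the weight is a nonzero
     constant. *)
  have lF1 : L1 L (fun x => F1 (p, x)).
    have := L1Z (U p)^-1 s1; congr (L1 _ _); apply/funext => x.
    by rewrite mulrA mulVf// mul1r.
  have lF2 : L1 L (fun x => F2 (p, x)).
    have := L1Z (U p)^-1 s2; congr (L1 _ _); apply/funext => x.
    by rewrite mulrA mulVf// mul1r.
  have tab := Utau U0; have tp := tPhi p; have tD := tests1_derive tp.
  have IE (f1 f2 psi : R -> R) : L1 L f1 -> L1 L f2 -> tests1 a b psi ->
    \int[L]_x (((tau p <= x)%R%:R * (U p * f1 x) + (x <= tau p)%R%:R * (U p * f2 x)) * psi x)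
    = U p * (\int[L]_x ((tau p <= x)%R%:R * (f1 x * psi x)) +
       \int[L]_x ((x <= tau p)%R%:R * (f2 x * psi x))).
    move=> k1 k2 tpsi.
    have g1 := L1_indic_ge (tau p) (L1_mul_tests1 k1 tpsi).
    have g2 := L1_indic_le (tau p) (L1_mul_tests1 k2 tpsi).
    rewrite -RintegralD// -RintegralZl//; last exact: L1D.
    by apply: eq_Rintegral => x _; ring.
  rewrite /I /I' /= (IE _ _ _ lF1 lF2 tD) (IE _ _ _ lF1' lF2' tp).
  rewrite (section_by_parts_above lF1 lF1' tp GE1 FG1 (F1out p) tab).
  rewrite (section_by_parts_below lF2 lF2' tp GE2 FG2 (F2out p) tab).
  ring.
have lJ : L1 pi J by apply: (L1_ae_eq mJ E); apply: L1B => //; exact: L1N.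
have := ae_eq_Rintegral (L1_measurable (L1B (L1N lI) lI')) mJ E.
rewrite RintegralB//; last exact: L1N.
rewrite (_ : \int[pi]_x - I x = - \int[pi]_x I x); last first.
  by rewrite -mulN1r -RintegralZl//; apply: eq_Rintegral => p _; rewrite mulN1r.
change (- (\int[pi]_x I x) - (\int[pi]_x I' x) = \int[pi]_x J x ->
  \int[pi]_x I x = - (\int[pi]_x J x) - (\int[pi]_x I' x)).
by move=> <-; rewrite opprB opprK addrAC subrr add0r.
Qed.

End integration_by_parts_sections.

(** * Continuity and measurability on products, sections of test functions *)

Lemma continuous_pair (R : realType) (V1 V2 V3 : normedModType R) (f : V1 -> V2)
    (g : V1 -> V3) : continuous f -> continuous g -> continuous (fun x => (f x, g x)).
Proof.
move=> cf cg x; exact: (@cvg_pair _ _ _ (nbhs x) (nbhs (f x)) (nbhs (g x)) (nbhs_filter x)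
  (nbhs_filter (f x)) (nbhs_filter (g x)) f g (cf x) (cg x)).
Qed.

Lemma continuous_pair_cst (R : realType) (V1 V2 V3 : normedModType R) (f : V1 -> V2)
    (y : V3) : continuous f -> continuous (fun x => (f x, y)).
Proof. by move=> cf; apply: continuous_pair => // x; exact: cvg_cst. Qed.

Section measurable_bases.
Context {R : realType}.

(** Countably many measurable sets that refine all neighbourhoods, read through [e]. This links the
    norm topology of a product to its product sigma-algebra, and passes to products factor by
    factor. *)
Definition measurable_basis d (T : measurableType d) (V : normedModType R)
    (e : T -> V) :=
  exists (I : countType) (B : I -> set T), (forall i, measurable (B i)) /\
  forall z U, nbhs (e z) U -> exists i, B i z /\ B i `<=` e @^-1` U.

Lemma measurable_basis1 : measurable_basis (fun x : measurableTypeR R => (x : R)).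
Proof.
exists (rat * rat)%type, (fun pq => (`]ratr pq.1, ratr pq.2[%classic : set R)).
split => [pq|z U /nbhs_ballP[r /= r0 rU]]; first exact: measurable_itv.
have [p] := @rat_in_itvoo R (z - r) z ltac:(by rewrite ltrBlDr ltrDl).
have [q] := @rat_in_itvoo R z (z + r) ltac:(by rewrite ltrDl).
rewrite !in_itv/= => /andP[zq qr] /andP[pr pz]; exists (p, q); split.
  by rewrite /= in_itv/= pz.
move=> x /=; rewrite in_itv/= => /andP[px xq]; apply: rU.
by rewrite -ball_normE/= distrC ltr_distl (lt_trans pr)//= (lt_trans xq).
Qed.

Lemma measurable_basis_prod d1 d2 (T1 : measurableType d1) (T2 : measurableType d2)
    (V1 V2 : normedModType R) (e1 : T1 -> V1) (e2 : T2 -> V2) :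
  measurable_basis e1 -> measurable_basis e2 ->
  measurable_basis (fun z => (e1 z.1, e2 z.2)).
Proof.
move=> [I [B [mB hB]]] [J [D [mD hD]]].
exists (I * J)%type, (fun ij => B ij.1 `*` D ij.2); split => [ij|z U].
  exact: measurableX.
move=> [[U1 U2] /= [n1 n2] U12U].
have [i [Bi BU]] := hB _ _ n1; have [j [Dj DU]] := hD _ _ n2.
exists (i, j); split => // y [/= y1 y2]; apply: U12U; split; [exact: BU|exact: DU].
Qed.

Lemma open_measurable_basis d (T : measurableType d) (V : normedModType R) (e : T -> V)
    (A : set V) : measurable_basis e -> open A -> measurable (e @^-1` A).
Proof.
move=> [I [B [mB hB]]] oA; pose J i := B i `<=` e @^-1` A.
rewrite (_ : _ @^-1` _ = \bigcup_i (if `[< J i >] then B i else set0)).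
  apply: countable_bigcupT_measurable => [|i]; first exact: countableP.
  by case: asboolP => _; [exact: mB|exact: measurable0].
apply/seteqP; split => [z Az|z [i _]]; last by case: asboolP => // + Bz; exact.
have /hB[i [Bi BU]] : nbhs (e z) A by apply: open_nbhs_nbhs.
by exists i => //; case: asboolP.
Qed.

Lemma continuous_measurable d (T : measurableType d) (V : normedModType R) (e : T -> V)
    (f : V -> R) : measurable_basis e -> continuous f -> measurable_fun setT (f \o e).
Proof.
move=> Be cf.
apply: (@measurability _ _ T (measurableTypeR R) setT (f \o e) _ (@RGenOInfty.measurableE R)).
move=> _ [_ [r ->] <-]; rewrite setTI.
apply: (open_measurable_basis (A := f @^-1` `]r, +oo[%classic) Be).
by apply: open_comp => // z _; exact: cf.
Qed.

End measurable_bases.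

Section test_function_theory.
Context {R : realType} {V : normedModType R}.
Implicit Types (Omega : set V) (phi : V -> R).

Lemma test_function_derive Omega phi v :
  test_function Omega phi -> test_function Omega ('D_v phi).
Proof.
move=> [sphi cphi Ophi]; apply: (test_function_compact (smooth_derive v sphi) cphi Ophi).
move=> z zphi; rewrite (@near_eq_derive _ _ _ _ (cst 0)) ?derive_cst//.
have : open (~` closure [set z | phi z != 0]) by exact/closed_openC/closed_closure.
rewrite openE => /(_ _ zphi); apply: filterS => y yphi.
by apply/eqP/negPn/negP => y0; apply/yphi/subset_closure.
Qed.

Lemma continuous_bounded (K : set V) phi : continuous phi -> compact K ->
  exists M, forall z, K z -> `|phi z| <= M.
Proof.
move=> cphi cK; have := continuous_compact (continuous_subspaceT cphi) cK.
move=> /compact_bounded[M [_ hM]]; exists (M + 1) => z Kz.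
by apply: (hM (M + 1)); [rewrite ltrDl|exists z].
Qed.

Lemma test_function_bounded Omega phi : test_function Omega phi ->
  exists M, forall z, `|phi z| <= M.
Proof.
move=> [sphi cphi Ophi].
have [M hM] := continuous_bounded (smooth_continuous sphi) cphi.
exists (Num.max M 0) => z; rewrite le_max.
have [->|z0] := eqVneq (phi z) 0; first by rewrite normr0 lexx orbT.
by rewrite hM//; exact: subset_closure.
Qed.

End test_function_theory.

Lemma two_between (R : realType) (a m M b : R) : a < m -> m <= M -> M < b ->
  exists p q, [/\ a < p, p < m, M < q & q < b].
Proof. by move=> am mM Mb; exists ((a + m) / 2), ((M + b) / 2); split; lra. Qed.

Section sections_of_test_functions.
Context {R : realType}.
Variables (a b : R) (B : set R) (phi : R * R -> R).
Hypotheses (ab : a < b) (tphi : test_function (`]a, b[%classic `*` B) phi).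

(** The first coordinate attains its extreme values on the compact support, and both lie in ]a, b[;
    [p] and [q] are taken between them and the ends. *)
Lemma test_function_section y : tests1 a b (fun x => phi (x, y)).
Proof.
have [sphi cphi Ophi] := tphi; set K := closure _ in cphi Ophi; split.
  apply: (@smooth_affine _ _ _ (fun x => (x, y)) (fun x => (x, 0))) => //.
    by apply: (@continuous_pair_cst R R R R id) => x; exact: cvg_id.
  by move=> h v z; apply: injective_projections; rewrite /= ?scaler0 ?add0r.
(* With empty support [phi] is zero, and any two points around the midpoint serve. *)
have [[z0 Kz0]|noK] := pselect (K !=set0); last first.
  have [ac cb] := midf_lt ab.
  have [p [q [ap pm mq qb]]] := two_between ac (lexx _) cb.
  exists p, q; split => //; first exact: lt_trans mq.
  move=> x _.
  apply/eqP/negPn/negP => phi0; apply: noK; exists (x, y); exact: subset_closure.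
have cfst : {within K, continuous (@fst R R)}.
  by apply: continuous_subspaceT => z; exact: cvg_fst.
have [m /[!inE] Km hm] := compact_EVT_min (ex_intro _ _ Kz0) cphi cfst.
have [M /[!inE] KM hM] := compact_EVT_max (ex_intro _ _ Kz0) cphi cfst.
have [/= + _] := Ophi _ Km; have [/= + _] := Ophi _ KM.
rewrite !in_itv/= => /andP[aM Mb] /andP[am mb].
have mM : m.1 <= M.1 by apply: hm; rewrite inE.
have [p [q [ap pm Mq qb]]] := two_between am mM Mb.
exists p, q; split => //; first by rewrite (lt_trans pm) ?(le_lt_trans mM).
move=> x xout; apply/eqP/negPn/negP => phi0.
have Kx : K (x, y) by exact: subset_closure.
have := hm _ (mem_set Kx); have := hM _ (mem_set Kx) => /= xM mx.
by move: xout; rewrite (lt_le_trans pm mx) (le_lt_trans xM Mq).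
Qed.

Lemma test_function_section_derive x y :
  'D_(1 : R) (fun x => phi (x, y)) x = 'D_dx2 phi (x, y).
Proof.
apply: (@derive_affine _ _ _ (fun x => (x, y)) (fun x => (x, 0))).
by move=> h v z; apply: injective_projections; rewrite /= ?scaler0 ?add0r.
Qed.

End sections_of_test_functions.

(** * Null boundaries and permutations of coordinates *)

Section null_boundaries.
Context {R : realType}.
Local Notation L := (@lebesgue_measure R).

Lemma ae_itv_open (a b : R) : {ae L, forall x, `[a, b]%classic x -> `]a, b[%classic x}.
Proof.
exists [set a; b]; split.
- exact: measurableU.
- by apply: countable_lebesgue_measure0; apply: finite_set_countable; exact: finite_set2.
- move=> x /= /not_implyP[]; rewrite !in_itv/= => /andP[ax xb] /negP.
  by rewrite !lt_neqAle ax xb !andbT negb_and !negbK => /orP[/eqP<-|/eqP->]; [left|right].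
Qed.

Lemma ae_setX d1 d2 (T1 : measurableType d1) (T2 : measurableType d2)
    (m1 : {measure set T1 -> \bar R}) (m2 : {sigma_finite_measure set T2 -> \bar R})
    (A1 B1 : set T1) (A2 B2 : set T2) :
  {ae m1, forall x, A1 x -> B1 x} -> {ae m2, forall x, A2 x -> B2 x} ->
  {ae (m1 \x m2)%E, forall z, (A1 `*` A2) z -> (B1 `*` B2) z}.
Proof.
move=> h1 h2; apply: filterS2 (ae_fst m2 h1) (ae_snd m1 h2) => z /= k1 k2 [z1 z2].
by split; [exact: k1|exact: k2].
Qed.

Lemma finite_setX d1 d2 (T1 : measurableType d1) (T2 : measurableType d2)
    (m1 : {measure set T1 -> \bar R}) (m2 : {sigma_finite_measure set T2 -> \bar R})
    (A1 : set T1) (A2 : set T2) : measurable A1 -> measurable A2 ->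
  (m1 A1 < +oo)%E -> (m2 A2 < +oo)%E -> ((m1 \x m2)%E (A1 `*` A2) < +oo)%E.
Proof.
move=> mA1 mA2 A1oo A2oo; rewrite product_measure1E// lte_mul_pinfty//.
by rewrite ge0_fin_numE.
Qed.

Lemma finite_itv (a b : R) : (L `]a, b[%classic < +oo)%E.
Proof. by rewrite lebesgue_measure_itv/=; case: ifP => _; rewrite -?EFinB ltry. Qed.

Lemma finite_citv (a b : R) : (L `[a, b]%classic < +oo)%E.
Proof. by rewrite lebesgue_measure_itv/=; case: ifP => _; rewrite -?EFinB ltry. Qed.

Lemma ae_eq_patch d (T : measurableType d) (mu : {measure set T -> \bar R})
    (A B : set T) (f : T -> R) : A `<=` B ->
  {ae mu, forall z, B z -> A z} -> ae_eq mu setT (f \_ B) (f \_ A).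
Proof.
move=> AB; apply: filterS => z BA _; rewrite !patchE.
have [Az|Az] := pselect (A z); first by rewrite !mem_set//; exact: AB.
by rewrite (memNset Az) memNset// => /BA.
Qed.

End null_boundaries.

Section permutations.
Context {R : realType}.
Local Notation mR := (measurableTypeR R).
Local Notation L := (@lebesgue_measure R).

(* (y, t, x) |-> (x, y, t) and (y, t, v, x) |-> (x, y, t, v) *)
Definition x_last3 (z : mR * mR * mR) := (z.2, z.1.1, z.1.2).
Definition x_last4 (z : mR * mR * mR * mR) := (z.2, z.1.1.1, z.1.1.2, z.1.2).
Definition swap_xt (z : mR * mR * mR) := (z.2, z.1.2, z.1.1).
Definition swap_yv (z : mR * mR * mR) := (z.1.1, z.2, z.1.2).
Definition swap_xy_tv (z : mR * mR * mR * mR) := (z.1.2, z.2, z.1.1.1, z.1.1.2).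

Let sfL : sigma_finite setT L := sigma_finiteT _.
Let sfL2 : sigma_finite setT (L \x L)%E := sigma_finite_prod L sfL.
Let sfL3 : sigma_finite setT (L \x L \x L)%E := sigma_finite_prod L sfL2.

Lemma mp_swap_yv : measure_preserving (L \x L \x L)%E (L \x L \x L)%E swap_yv.
Proof. exact: mp_swap_last. Qed.

Lemma mp_swap12 : measure_preserving (L \x L \x L)%E (L \x L \x L)%E
  (fun z : mR * mR * mR => (z.1.2, z.1.1, z.2)).
Proof. exact: (mp_first L sfL2 (mp_swap L L)). Qed.

Lemma mp_x_last3 : measure_preserving (L \x L \x L)%E (L \x L \x L)%E x_last3.
Proof. exact: (mp_comp mp_swap_yv mp_swap12). Qed.

Lemma mp_swap_xt : measure_preserving (L \x L \x L)%E (L \x L \x L)%E swap_xt.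
Proof. exact: (mp_comp (mp_comp mp_swap12 mp_swap_yv) mp_swap12). Qed.

Lemma mp_swap34 : measure_preserving (L \x L \x L \x L)%E (L \x L \x L \x L)%E
  (fun z : mR * mR * mR * mR => (z.1.1, z.2, z.1.2)).
Proof. exact: (mp_swap_last L L sfL2). Qed.

Lemma mp_x_last4 :
  measure_preserving (L \x L \x L \x L)%E (L \x L \x L \x L)%E x_last4.
Proof. exact: (mp_comp mp_swap34 (mp_first L sfL3 mp_x_last3)). Qed.

(** The exchange of the two blocks is the product of the neighbour transpositions 23, 34, 12, 23. *)
Lemma mp_swap_xy_tv :
  measure_preserving (L \x L \x L \x L)%E (L \x L \x L \x L)%E swap_xy_tv.
Proof.
have s23 := mp_first L sfL3 mp_swap_yv; have s12 := mp_first L sfL3 mp_swap12.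
exact: (mp_comp (mp_comp (mp_comp s23 mp_swap34) s12) s23).
Qed.

End permutations.

(** * Cut-off factors in place of moving limits *)

Section cut_integrands.
Context {R : realType}.
Local Notation mR := (measurableTypeR R).
Local Notation L := (@lebesgue_measure R).

(** As a jointly measurable factor bounded by 1 it preserves integrability. [true] stands for
    integration up to [x], [false] for integration from [x] on. *)
Definition cut (below : bool) (s x : mR) : R :=
  (if below then (s <= x)%R else (x <= s)%R)%:R.

Lemma measurable_cut d (T : measurableType d) below (f g : T -> mR) :
  measurable_fun setT f -> measurable_fun setT g ->
  measurable_fun setT (fun z => cut below (f z) (g z)).
Proof. by move=> mf mg; case: below; exact: measurable_indic_le. Qed.

Lemma cut_bounded below s x : `|cut below s x| <= 1.
Proof. by case: below; exact: bool_bounded. Qed.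

Definition integrand_x below (K : mR * mR * mR -> R) (w : mR * mR -> R)
  (q : mR * mR * mR) : R := cut below q.2 q.1.1 * (K q * w (q.2, q.1.2)).

Definition integrand_y below (K : mR * mR * mR -> R) (w : mR * mR -> R)
  (q : mR * mR * mR) : R := cut below q.2 q.1.2 * (K q * w (q.1.1, q.2)).

Definition integrand_xy below below' (K : mR * mR * mR * mR -> R) (w : mR * mR -> R)
  (q : mR * mR * mR * mR) : R :=
  cut below q.1.2 q.1.1.1 * (cut below' q.2 q.1.1.2 * (K q * w (q.1.2, q.2))).

Let sfL : sigma_finite setT L := sigma_finiteT _.
Let sfL2 : sigma_finite setT (L \x L)%E := sigma_finite_prod L sfL.
Let sfL3 : sigma_finite setT (L \x L \x L)%E := sigma_finite_prod L sfL2.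

Variables (a b c d : R).
Implicit Type w : mR * mR -> R.

Lemma L2_indic_itv (p q : R) : L2 L (\1_(`[p, q]%classic : set mR)).
Proof.
apply: L2_indic; first exact: measurable_itv.
exact: finite_citv.
Qed.

(** A function of two of the three variables is not square integrable on the whole space. Since [K]
    vanishes unless the missing variable lies in [a, b], the indicator of that interval can be
    inserted, after which two square integrable functions are multiplied. *)
Lemma L1_mul_swap_xt K w : L2 (L \x L \x L)%E K -> L2 (L \x L)%E w ->
  (forall q, ~ `[a, b]%classic q.1.1 -> K q = 0) ->
  L1 (L \x L \x L)%E (fun q => K q * w (q.2, q.1.2)).
Proof.
move=> lK lw K0; have lT := L2_tensor sfL2 lw (L2_indic_itv a b).
have := L2_mul lK (mp_L2 mp_swap_xt lT); congr (L1 _ _); apply/funext => q /=.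
rewrite indicE; have [Iq|Iq] := pselect (`[a, b]%classic q.1.1).
  by rewrite mem_set// mulr1.
by rewrite K0// !mul0r.
Qed.

Lemma L1_mul_swap_yv K w : L2 (L \x L \x L)%E K -> L2 (L \x L)%E w ->
  (forall q, ~ `[c, d]%classic q.1.2 -> K q = 0) ->
  L1 (L \x L \x L)%E (fun q => K q * w (q.1.1, q.2)).
Proof.
move=> lK lw K0; have lT := L2_tensor sfL2 lw (L2_indic_itv c d).
have := L2_mul lK (mp_L2 mp_swap_yv lT); congr (L1 _ _); apply/funext => q /=.
rewrite indicE; have [Iq|Iq] := pselect (`[c, d]%classic q.1.2).
  by rewrite mem_set// mulr1.
by rewrite K0// !mul0r.
Qed.

Lemma L1_mul_swap_xy_tv K w : L2 (L \x L \x L \x L)%E K -> L2 (L \x L)%E w ->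
  (forall q, ~ `[a, b]%classic q.1.1.1 -> K q = 0) ->
  (forall q, ~ `[c, d]%classic q.1.1.2 -> K q = 0) ->
  L1 (L \x L \x L \x L)%E (fun q => K q * w (q.1.2, q.2)).
Proof.
move=> lK lw K0 K0'.
have lT := L2_tensor sfL3 (L2_tensor sfL2 lw (L2_indic_itv a b)) (L2_indic_itv c d).
have := L2_mul lK (mp_L2 mp_swap_xy_tv lT); congr (L1 _ _); apply/funext => q /=.
rewrite !indicE; have [Iq|Iq] := pselect (`[a, b]%classic q.1.1.1); last first.
  by rewrite K0// !mul0r.
have [Iq'|Iq'] := pselect (`[c, d]%classic q.1.1.2); last first.
  by rewrite K0'// !mul0r.
by rewrite !mem_set// !mulr1.
Qed.

Lemma L1_integrand_x below K w : L1 (L \x L \x L)%E (fun q => K q * w (q.2, q.1.2)) ->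
  L1 (L \x L \x L)%E (integrand_x below K w).
Proof.
move=> l; apply: L1M_bounded l.
  apply: measurable_cut => //; exact: (measurableT_comp measurable_fst measurable_fst).
by exists 1 => q; exact: cut_bounded.
Qed.

Lemma L1_integrand_y below K w : L1 (L \x L \x L)%E (fun q => K q * w (q.1.1, q.2)) ->
  L1 (L \x L \x L)%E (integrand_y below K w).
Proof.
move=> l; apply: L1M_bounded l.
  apply: measurable_cut => //; exact: (measurableT_comp measurable_snd measurable_fst).
by exists 1 => q; exact: cut_bounded.
Qed.

Lemma L1_integrand_xy below below' K w :
  L1 (L \x L \x L \x L)%E (fun q => K q * w (q.1.2, q.2)) ->
  L1 (L \x L \x L \x L)%E (integrand_xy below below' K w).
Proof.
move=> l; apply: L1M_bounded; last apply: L1M_bounded l.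
- apply: measurable_cut; first exact: (measurableT_comp measurable_snd measurable_fst).
  apply: (measurableT_comp measurable_fst).
  exact: (measurableT_comp measurable_fst measurable_fst).
- by exists 1 => q; exact: cut_bounded.
- apply: measurable_cut => //; apply: (measurableT_comp measurable_snd).
  exact: (measurableT_comp measurable_fst measurable_fst).
- by exists 1 => q; exact: cut_bounded.
Qed.

End cut_integrands.

Section pairing_of_slices.
Context d1 d2 (T1 : measurableType d1) (T2 : measurableType d2) (R : realType).
Variables (m1 : {measure set T1 -> \bar R}) (m2 : {sigma_finite_measure set T2 -> \bar R}).
Hypothesis sf1 : sigma_finite setT m1.

Lemma Rint_slice (F : T1 * T2 -> R) (chi : T1 -> R) : measurable_fun setT chi ->
  (exists M, forall z, `|chi z| <= M) -> L1 (m1 \x m2)%E F ->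
  \int[m1]_z ((\int[m2]_t F (z, t)) * chi z) = \int[(m1 \x m2)%E]_q (F q * chi q.1).
Proof.
move=> mchi bchi lF; under eq_Rintegral do rewrite mulrC.
rewrite (@Rfubini1_mul _ _ _ _ _ m1 m2 sf1 chi F)//.
by apply: eq_Rintegral => q _; rewrite mulrC.
Qed.

Lemma Rint_slice_sum (I : finType) (F : I -> T1 * T2 -> R) (chi : T1 -> R) :
  measurable_fun setT chi -> (exists M, forall z, `|chi z| <= M) ->
  (forall i, L1 (m1 \x m2)%E (F i)) ->
  \int[m1]_z ((\int[m2]_t \sum_i F i (z, t)) * chi z) =
  \sum_i \int[(m1 \x m2)%E]_q (F i q * chi q.1).
Proof.
move=> mchi bchi lF; rewrite (@Rint_slice (fun q => \sum_i F i q))//; last exact: L1_sum.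
under eq_Rintegral do rewrite mulr_suml.
rewrite Rint_sum// => i; under eq_fun do rewrite mulrC.
by apply: L1_fst_mul.
Qed.

End pairing_of_slices.

(** * The operator, entry by entry *)

Section kernel_entries.
Context {R : realType} {n m : nat}.
Local Notation mR := (measurableTypeR R).
Local Notation L := (@lebesgue_measure R).
Variables a b c d : R.

(** The booleans stand for the indices 1 ([true]) and 2 ([false]), in agreement with [cut]; all
    terms but the multiplication by [k00] become sums over booleans. *)
Definition kernel_x (K : kernel2D R n m) (s : bool) := if s then k10 K else k20 K.
Definition kernel_y (K : kernel2D R n m) (s : bool) := if s then k01 K else k02 K.
Definition kernel_xy (K : kernel2D R n m) (s s' : bool) :=
  if s then if s' then k11 K else k12 K else if s' then k21 K else k22 K.

Definition itv_cut (below : bool) (p q x : R) : set R :=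
  if below then `[p, x]%classic else `[x, q]%classic.

Lemma indic_itv_cut below p q x t : p <= x <= q ->
  \1_(itv_cut below p q x) t = cut below t x * \1_(`[p, q]%classic : set R) t.
Proof.
move=> /andP[px xq]; rewrite /cut /itv_cut; case: below;
  rewrite !indicE !mem_setE !in_itv/=.
  by have [tx|] := leP t x; rewrite ?andbF ?mul0r// (le_trans tx xq) mul1r.
by have [tx|] := leP x t; rewrite ?mul0r// (le_trans px tx) mul1r.
Qed.

Variables (K : kernel2D R n m) (u : R * R -> 'cV[R]_m) (i : 'I_n).

Lemma PI2D_entry x y : PI2D a b c d K u (x, y) i ord0 =
  \sum_j k00 K (x, y) i j * u (x, y) j ord0
  + \sum_s \int[L]_(t in itv_cut s a b x) (\sum_j kernel_x K s (x, y, t) i j * u (t, y) j ord0)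
  + \sum_s \int[L]_(v in itv_cut s c d y) (\sum_j kernel_y K s (x, y, v) i j * u (x, v) j ord0)
  + \sum_s \sum_s' \int[L]_(t in itv_cut s a b x) (\int[L]_(v in itv_cut s' c d y)
      (\sum_j kernel_xy K s s' (x, y, t, v) i j * u (t, v) j ord0)).
Proof.
have ker1 D (F : R -> 'M[R]_(n, m)) (f : R -> 'cV[R]_m) :
    mx_integral L D (fun t => F t *m f t) i ord0 =
    \int[L]_(t in D) (\sum_j F t i j * f t j ord0).
  by rewrite mxE; apply: eq_Rintegral => t _; rewrite mxE.
have ker2 D D' (F : R -> R -> 'M[R]_(n, m)) (f : R -> R -> 'cV[R]_m) :
    mx_integral L D (fun t => mx_integral L D' (fun v => F t v *m f t v)) i ord0 =
    \int[L]_(t in D) (\int[L]_(v in D') (\sum_j F t v i j * f t v j ord0)).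
  by rewrite mxE; apply: eq_Rintegral => t _; rewrite ker1.
have addE (A B : 'cV[R]_n) : (A + B) i ord0 = A i ord0 + B i ord0 by rewrite mxE.
rewrite /PI2D/=.
do 8 rewrite [in LHS]addE.
pose Ix s := \int[L]_(t in itv_cut s a b x) (\sum_j kernel_x K s (x, y, t) i j * u (t, y) j ord0).
pose Iy s := \int[L]_(v in itv_cut s c d y) (\sum_j kernel_y K s (x, y, v) i j * u (x, v) j ord0).
pose Ixy s s' := \int[L]_(t in itv_cut s a b x) (\int[L]_(v in itv_cut s' c d y)
      (\sum_j kernel_xy K s s' (x, y, t, v) i j * u (t, v) j ord0)).
transitivity (\sum_j k00 K (x, y) i j * u (x, y) j ord0 + Ix true + Ix false +
    Iy true + Iy false + Ixy true true + Ixy false true + Ixy true false + Ixy false false).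
  congr (_ + _ + _ + _ + _ + _ + _ + _ + _); [by rewrite mxE|exact: ker1|exact: ker1|
    exact: ker1|exact: ker1|exact: ker2|exact: ker2|exact: ker2|exact: ker2].
rewrite -/(\sum_s Ix s) -/(\sum_s Iy s) -/(\sum_s \sum_s' Ixy s s').
move: (\sum_j _) Ix Iy Ixy => r Ix Iy Ixy; rewrite !big_bool/=; ring.
Qed.

(** Extension by zero outside the closed boxes: together with [cut] it lets the partial integrals
    run over whole lines. *)
Definition state_entry j : mR * mR -> R := (fun z => u z j ord0) \_ (box_xy a b c d).
Definition entry_00 j : mR * mR -> R := (fun z => k00 K z i j) \_ (box_xy a b c d).
Definition entry_x s j : mR * mR * mR -> R :=
  (fun z => kernel_x K s z i j) \_ (box_xyt a b c d).
Definition entry_y s j : mR * mR * mR -> R :=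
  (fun z => kernel_y K s z i j) \_ (box_xyv a b c d).
Definition entry_xy s s' j : mR * mR * mR * mR -> R :=
  (fun z => kernel_xy K s s' z i j) \_ (box_xytv a b c d).

Definition slice_x s (z : mR * mR) : R :=
  \int[L]_t (\sum_j integrand_x s (entry_x s j) (state_entry j) (z, t)).
Definition slice_y s (z : mR * mR) : R :=
  \int[L]_v (\sum_j integrand_y s (entry_y s j) (state_entry j) (z, v)).
Definition slice_xyt s s' (q : mR * mR * mR) : R :=
  \int[L]_v (\sum_j integrand_xy s s' (entry_xy s s' j) (state_entry j) (q, v)).
Definition slice_xy s s' (z : mR * mR) : R := \int[L]_t slice_xyt s s' (z, t).

Definition slices (z : mR * mR) : R :=
  \sum_j entry_00 j z * state_entry j z + \sum_s slice_x s z + \sum_s slice_y s z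
  + \sum_s \sum_s' slice_xy s s' z.

Lemma PI2D_slices z : obox_xy a b c d z -> PI2D a b c d K u z i ord0 = slices z.
Proof.
move: z => [x y] [/=]; rewrite !in_itv/= => /andP[ax xb] /andP[cy yd].
have xab : a <= x <= b by rewrite !ltW.
have ycd : c <= y <= d by rewrite !ltW.
have Ix : `[a, b]%classic x by rewrite /= in_itv.
have Iy : `[c, d]%classic y by rewrite /= in_itv.
have Bxy : box_xy a b c d (x, y) by split.
rewrite PI2D_entry /slices; congr (_ + _ + _ + _).
- by apply: eq_bigr => j _; rewrite /entry_00 /state_entry !patchE !mem_set.
- apply: eq_bigr => s _; rewrite Rintegral_indic; apply: eq_Rintegral => t _.
  rewrite indic_itv_cut// mulr_sumr; apply: eq_bigr => j _.
  rewrite /integrand_x /= /entry_x /state_entry !patchE indicE.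
  have [It|It] := pselect (`[a, b]%classic t); last first.
    by rewrite (memNset It) !(memNset (A := box_xy _ _ _ _)) ?mulr0 ?mul0r// => -[].
  by rewrite !mem_set// mulr1.
- apply: eq_bigr => s _; rewrite Rintegral_indic; apply: eq_Rintegral => t _.
  rewrite indic_itv_cut// mulr_sumr; apply: eq_bigr => j _.
  rewrite /integrand_y /= /entry_y /state_entry !patchE indicE.
  have [It|It] := pselect (`[c, d]%classic t); last first.
    by rewrite (memNset It) !(memNset (A := box_xy _ _ _ _)) ?mulr0 ?mul0r// => -[].
  by rewrite !mem_set// mulr1.
- apply: eq_bigr => s _; apply: eq_bigr => s' _.
  rewrite Rintegral_indic; apply: eq_Rintegral => t _.
  rewrite Rintegral_indic indic_itv_cut// indicE.
  have [It|It] := pselect (`[a, b]%classic t); last first.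
    rewrite (memNset It) mulr0 mul0r -[LHS](Rint_zero L); apply: eq_Rintegral => v _.
    rewrite big1// => j _; rewrite /integrand_xy/= /state_entry patchE memNset ?mulr0//.
    by case.
  rewrite mem_set// mulr1.
  (* Pulling the factor out of the inner integral would require integrability of the inner integrand
     at this very t; its two values are treated separately instead. *)
  have [tx|tx] : cut s t x = 1 \/ cut s t x = 0.
  + by rewrite /cut; case: (if s then _ else _); [left|right].
  + rewrite tx mul1r; apply: eq_Rintegral => v _.
    rewrite indic_itv_cut// mulr_sumr; apply: eq_bigr => j _.
    rewrite /integrand_xy/= tx mul1r /entry_xy /state_entry !patchE indicE.
    have [Iv|Iv] := pselect (`[c, d]%classic v); last first.
      by rewrite (memNset Iv) !(memNset (A := box_xy _ _ _ _)) ?mulr0 ?mul0r// => -[].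
    by rewrite !mem_set// mulr1.
  + rewrite tx mul0r -[LHS](Rint_zero L); apply: eq_Rintegral => v _.
    by rewrite big1// => j _; rewrite /integrand_xy/= tx mul0r.
Qed.

Hypotheses (hK : N2D a b c d K).
Hypothesis hu : mx_square_integrable (leb2 R) (box_xy a b c d) u.

Lemma state_entry_L2 j : L2 (L \x L)%E (state_entry j).
Proof. by apply/square_integrable_L2; exact: (hu j ord0). Qed.

Lemma entry_00_L2 j : L2 (L \x L)%E (entry_00 j).
Proof. by apply/square_integrable_L2; case: hK => h _ _ _; exact: h. Qed.

Lemma entry_x_L2 s j : L2 (L \x L \x L)%E (entry_x s j).
Proof.
by apply/square_integrable_L2; case: hK => _ _ [h h'] _; case: s; [exact: h|exact: h'].
Qed.

Lemma entry_y_L2 s j : L2 (L \x L \x L)%E (entry_y s j).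
Proof.
by apply/square_integrable_L2; case: hK => _ [h h'] _ _; case: s; [exact: h|exact: h'].
Qed.

Lemma entry_xy_L2 s s' j : L2 (L \x L \x L \x L)%E (entry_xy s s' j).
Proof.
apply/square_integrable_L2; case: hK => _ _ _ [h1 h2 h3 h4].
by case: s; case: s'; [exact: h1|exact: h2|exact: h3|exact: h4].
Qed.

Let sfL : sigma_finite setT L := sigma_finiteT _.
Let sfL2 : sigma_finite setT (L \x L)%E := sigma_finite_prod L sfL.
Let sfL3 : sigma_finite setT (L \x L \x L)%E := sigma_finite_prod L sfL2.

Lemma L1_entry_00 j : L1 (L \x L)%E (fun z => entry_00 j z * state_entry j z).
Proof. exact: L2_mul (entry_00_L2 j) (state_entry_L2 j). Qed.

Lemma L1_entry_x s j : L1 (L \x L \x L)%E (integrand_x s (entry_x s j) (state_entry j)).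
Proof.
apply/L1_integrand_x/(@L1_mul_swap_xt R a b _ _ (entry_x_L2 s j) (state_entry_L2 j)) => q nI.
by rewrite /entry_x patchE memNset// => -[[]].
Qed.

Lemma L1_entry_y s j : L1 (L \x L \x L)%E (integrand_y s (entry_y s j) (state_entry j)).
Proof.
apply/L1_integrand_y/(@L1_mul_swap_yv R c d _ _ (entry_y_L2 s j) (state_entry_L2 j)) => q nI.
by rewrite /entry_y patchE memNset// => -[[]].
Qed.

Lemma L1_entry_xy s s' j :
  L1 (L \x L \x L \x L)%E (integrand_xy s s' (entry_xy s s' j) (state_entry j)).
Proof.
apply: L1_integrand_xy.
apply: (@L1_mul_swap_xy_tv R a b c d _ _ (entry_xy_L2 s s' j) (state_entry_L2 j)) => q nI;
  by rewrite /entry_xy patchE memNset// => -[[[]]].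
Qed.

Lemma L1_slice_x s : L1 (L \x L)%E (slice_x s).
Proof.
apply: (L1_fubini1 sfL2 (f := fun q => \sum_j integrand_x s (entry_x s j) (state_entry j) q)).
by apply: L1_sum => j; exact: L1_entry_x.
Qed.

Lemma L1_slice_y s : L1 (L \x L)%E (slice_y s).
Proof.
apply: (L1_fubini1 sfL2 (f := fun q => \sum_j integrand_y s (entry_y s j) (state_entry j) q)).
by apply: L1_sum => j; exact: L1_entry_y.
Qed.

Lemma L1_slice_xyt s s' : L1 (L \x L \x L)%E (slice_xyt s s').
Proof.
apply: (L1_fubini1 sfL3
  (f := fun q => \sum_j integrand_xy s s' (entry_xy s s' j) (state_entry j) q)).
by apply: L1_sum => j; exact: L1_entry_xy.
Qed.

Lemma L1_slice_xy s s' : L1 (L \x L)%E (slice_xy s s').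
Proof. exact: (L1_fubini1 sfL2 (L1_slice_xyt s s')). Qed.

Lemma L1_slices : L1 (L \x L)%E slices.
Proof.
apply: L1D; first apply: L1D; first apply: L1D.
- by apply: L1_sum => j; exact: L1_entry_00.
- by apply: L1_sum => s; exact: L1_slice_x.
- by apply: L1_sum => s; exact: L1_slice_y.
- by apply: L1_sum => s; apply: L1_sum => s'; exact: L1_slice_xy.
Qed.

End kernel_entries.

Section test_functions_of_the_plane.
Context {R : realType}.
Local Notation mR := (measurableTypeR R).

Lemma measurable_plane (phi : R * R -> R) : continuous phi ->
  measurable_fun setT (phi : mR * mR -> R).
Proof.
move=> cphi.
have := continuous_measurable (measurable_basis_prod (measurable_basis1 (R := R))
  (measurable_basis1 (R := R))) cphi.
by congr (measurable_fun _ _); apply/funext => -[x y].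
Qed.

End test_functions_of_the_plane.

(** * Integration by parts with a jump *)

Section integration_by_parts_with_jump.
Context dP (P : measurableType dP) (R : realType) (VP : normedModType R).
Context dT (T : measurableType dT) (V : normedModType R).
Local Notation mR := (measurableTypeR R).
Local Notation L := (@lebesgue_measure R).
Variables (pi : {measure set P -> \bar R}) (eP : P -> VP).
Variables (mu : {measure set T -> \bar R}) (e : T -> V).
Hypothesis sfpi : sigma_finite setT pi.
Variables (OP : set P) (C : set (VP -> R)).
Hypotheses (mOP : measurable OP).
Hypotheses (tC : tests_on pi eP OP C) (dC : dense_tests pi eP OP C).
Variables (a b : R) (Y : set R).
Hypothesis ab : a < b.
Variables (O B : set T) (dx : V) (sg : P * mR -> T).
Hypotheses (mO : measurable O) (Ooo : (mu O < +oo)%E) (OB : O `<=` B).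
Hypothesis mpsg : measure_preserving (pi \x L)%E mu sg.
Hypothesis sgO : forall p x, O (sg (p, x)) <-> OP p /\ a < x < b.
Hypothesis tests_sg : forall rho phi, C rho -> tests1 a b phi ->
  exists theta, [/\ test_function (e @` O) theta,
    bounded_measurable e theta, bounded_measurable e (iter_derive [:: dx] theta),
    forall p x, theta (e (sg (p, x))) = rho (eP p) * phi x &
    forall p x, iter_derive [:: dx] theta (e (sg (p, x))) =
      rho (eP p) * 'D_(1 : R) phi x].
Hypothesis section_sg : forall G : V -> R, {within e @` B, continuous G} ->
  forall p, OP p -> {within `[a, b], continuous (fun x => G (e (sg (p, x))))}.
Variables (K1 K2 K1' K2' : T -> R) (G1 G2 : V -> R).
Hypotheses (sK1 : square_integrable mu O K1) (sK2 : square_integrable mu O K2).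
Hypotheses (sK1' : square_integrable mu O K1') (sK2' : square_integrable mu O K2').
Hypotheses (wK1 : weak_derivative mu e O [:: dx] K1 K1')
  (wK2 : weak_derivative mu e O [:: dx] K2 K2').
Hypotheses (cG1 : {within e @` B, continuous G1}) (KG1 : ae_eq mu B K1 (G1 \o e)).
Hypotheses (cG2 : {within e @` B, continuous G2}) (KG2 : ae_eq mu B K2 (G2 \o e)).
Variables (U : P -> R) (tau eta : P -> mR) (J : P -> R) (phi : R * R -> R).
Hypotheses (mtau : measurable_fun setT tau) (meta : measurable_fun setT eta).
Hypothesis OPtau : forall p, OP p -> a <= tau p <= b.
Hypothesis tphi : test_function (`]a, b[%classic `*` Y) phi.
Hypotheses (l1 : L1 (pi \x L)%E (fun z => U z.1 * (K1 \_ O) (sg z)))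
  (l2 : L1 (pi \x L)%E (fun z => U z.1 * (K2 \_ O) (sg z)))
  (l1' : L1 (pi \x L)%E (fun z => U z.1 * (K1' \_ O) (sg z)))
  (l2' : L1 (pi \x L)%E (fun z => U z.1 * (K2' \_ O) (sg z))).
Hypothesis mJ : measurable_fun setT J.
Hypothesis JE : {ae pi, forall p, J p = \1_OP p * U p *
  (G1 (e (sg (p, tau p))) - G2 (e (sg (p, tau p)))) * phi (tau p, eta p)}.

(** Here p collects all variables but x: [tau p] is the value t where the two kernels meet, [eta p]
    the value y inside [phi], and [U] carries the state and, in four variables, the cut in the
    remaining variable. *)
Lemma integration_by_parts_with_jump :
  \int[(pi \x L)%E]_z ((cut true (tau z.1) z.2 * (U z.1 * (K1 \_ O) (sg z)) +
     cut false (tau z.1) z.2 * (U z.1 * (K2 \_ O) (sg z))) * 'D_dx2 phi (z.2, eta z.1)) =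
  - (\int[pi]_p J p) -
  \int[(pi \x L)%E]_z ((cut true (tau z.1) z.2 * (U z.1 * (K1' \_ O) (sg z)) +
     cut false (tau z.1) z.2 * (U z.1 * (K2' \_ O) (sg z))) * phi (z.2, eta z.1)).
Proof.
have [sphi _ _] := tphi; have tD := test_function_derive dx2 tphi.
have [sD _ _] := tD.
(* Restricting the weight to [OP] changes no integrand, as the kernels vanish over the complement,
   and it confines attention to sections on which the continuous versions are controlled and [tau]
   lies in [a, b]. *)
pose U1 p := \1_OP p * U p.
have U1E (f : T -> R) z : U1 z.1 * (f \_ O) (sg z) = U z.1 * (f \_ O) (sg z).
  case: z => p x; rewrite /U1/= indicE; have [Op|Op] := pselect (OP p).
    by rewrite mem_set// mul1r.
  by rewrite memNset// !mul0r patchE memNset ?mulr0// => /sgO[].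
have U1O p : U1 p != 0 -> OP p.
  by apply: contra_neqP => Op; rewrite /U1 indicE memNset// mul0r.
have DE p x : 'D_(1 : R) (fun x => phi (x, eta p)) x = 'D_dx2 phi (x, eta p).
  exact: test_function_section_derive.
have mpair : measurable_fun setT (fun z : P * mR => (z.2, eta z.1)).
  apply: measurable_fun_pair => //; exact: (measurableT_comp meta measurable_fst).
have [H1 H1'] := ae_section_continuous_version sfpi mOP tC dC ab mO Ooo OB mpsg sgO
  tests_sg section_sg sK1 sK1' wK1 cG1 KG1.
have [H2 H2'] := ae_section_continuous_version sfpi mOP tC dC ab mO Ooo OB mpsg sgO
  tests_sg section_sg sK2 sK2' wK2 cG2 KG2.
have sp (K K' : T -> R) (G : V -> R) : {ae pi, forall p, OP p -> exists c,
    L1 L (fun s => (K' \_ O) (sg (p, s))) /\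
    forall x, a <= x <= b ->
      G (e (sg (p, x))) = c + primitive (fun s => (K' \_ O) (sg (p, s))) x} ->
    {ae pi, forall p, OP p -> {ae L, forall x, a < x < b ->
      (K \_ O) (sg (p, x)) = G (e (sg (p, x)))}} ->
    section_primitive pi a b U1 (fun z => (K \_ O) (sg z)) (fun z => (K' \_ O) (sg z))
      (fun p x => G (e (sg (p, x)))).
  move=> h h'; apply: filterS2 h h' => p h h' /U1O Op.
  by have [c [h1 h2]] := h Op; split => //; [exists c|exact: h'].
have out (K : T -> R) p x : ~~ (a < x < b) -> (K \_ O) (sg (p, x)) = 0.
  by move=> /negP xab; rewrite patchE memNset// => /sgO[].
have := @integration_by_parts_sections _ P R pi sfpi a b
  (fun z => (K1 \_ O) (sg z)) (fun z => (K2 \_ O) (sg z))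
  (fun z => (K1' \_ O) (sg z)) (fun z => (K2' \_ O) (sg z))
  (fun p x => G1 (e (sg (p, x)))) (fun p x => G2 (e (sg (p, x))))
  U1 tau (fun p x => phi (x, eta p)) J mtau mJ.
have -> : (fun z : P * mR => U1 z.1 * (K1 \_ O) (sg z)) = fun z => U z.1 * (K1 \_ O) (sg z).
  by apply/funext => z; exact: U1E.
have -> : (fun z : P * mR => U1 z.1 * (K2 \_ O) (sg z)) = fun z => U z.1 * (K2 \_ O) (sg z).
  by apply/funext => z; exact: U1E.
have -> : (fun z : P * mR => U1 z.1 * (K1' \_ O) (sg z)) = fun z => U z.1 * (K1' \_ O) (sg z).
  by apply/funext => z; exact: U1E.
have -> : (fun z : P * mR => U1 z.1 * (K2' \_ O) (sg z)) = fun z => U z.1 * (K2' \_ O) (sg z).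
  by apply/funext => z; exact: U1E.
move=> ibp; transitivity (\int[(pi \x L)%E]_z
    (((tau z.1 <= z.2)%R%:R * (U1 z.1 * (K1 \_ O) (sg z)) +
     (z.2 <= tau z.1)%R%:R * (U1 z.1 * (K2 \_ O) (sg z))) *
     'D_(1 : R) (fun x => phi (x, eta z.1)) z.2)).
  by apply: eq_Rintegral => z _; rewrite !U1E DE.
rewrite ibp//.
- by congr (_ - _); apply: eq_Rintegral => z _; rewrite !U1E.
- by move=> p /U1O; exact: OPtau.
- move=> p; exact: test_function_section ab tphi (eta p).
- exact: (measurableT_comp (measurable_plane (smooth_continuous sphi)) mpair).
- rewrite (_ : (fun z : P * mR => _) = (fun z => 'D_dx2 phi (z.2, eta z.1))).
    exact: (measurableT_comp (measurable_plane (smooth_continuous sD)) mpair).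
  by apply/funext => z; exact: DE.
- by have [M hM] := test_function_bounded tphi; exists M => p x.
- by have [M hM] := test_function_bounded tD; exists M => p x; rewrite DE.
- exact: out.
- exact: out.
- exact: sp.
- exact: sp.
Qed.

End integration_by_parts_with_jump.

Lemma within_comp (R : realType) (V1 V2 : normedModType R) (I : set V1) (A : set V2)
    (h : V1 -> V2) (G : V2 -> R) : continuous h -> (forall x, I x -> A (h x)) ->
  {within A, continuous G} -> {within I, continuous (fun x => G (h x))}.
Proof.
move=> ch IA cG; suff key (x : V1) eps : 0 < eps ->
    nbhs_subspace (x : subspace I) (fun t : V1 => `|G (h x) - G (h t)| < eps).
  by move=> x; apply/cvgrPdist_lt => eps eps0; exact: key.
(* A point outside [I] is isolated in the subspace topology. *)
move=> eps0; have [Ix|nIx] := pselect (I x); last first.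
  apply: (@eq_ind _ (globally [set (x : V1)]) (fun F => F (fun t => `|G (h x) - G (h t)| < eps))
    _ _ (nbhs_subspace_out nIx)).
  by move=> y /= ->; rewrite subrr normr0.
have : nbhs_subspace (h x : subspace A) (fun t => `|G (h x) - G t| < eps).
  by have := cG (h x) => /cvgrPdist_lt/(_ _ eps0).
rewrite -(nbhs_subspace_in (IA _ Ix)) /within/= => H.
have H' : within I (nbhs x) (fun t => `|G (h x) - G (h t)| < eps).
  have H2 : nbhs x (fun t => A (h t) -> `|G (h x) - G (h t)| < eps) := ch x _ H.
  apply: (@filterS _ (nbhs x) (nbhs_filter x) _ _ _ H2) => y /= Gy Iy; exact/Gy/IA.
by move: H'; rewrite (nbhs_subspace_in Ix).
Qed.

(** * Boxes in two, three and four variables *)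

Section boxes_of_space.
Context {R : realType}.
Local Notation mR := (measurableTypeR R).
Local Notation L := (@lebesgue_measure R).

Let sfL : sigma_finite setT L := sigma_finiteT _.
Let sfL2 : sigma_finite setT (L \x L)%E := sigma_finite_prod L sfL.
Let sfL3 : sigma_finite setT (L \x L \x L)%E := sigma_finite_prod L sfL2.

Local Notation chart1 := (@chart1 R).

(** The identity written as a product of identities, the shape in which results on tensor products
    apply. *)
Lemma chart2E : @chart2 R = (fun z => (chart1 z.1, chart1 z.2)).
Proof. by apply/funext => -[]. Qed.

Lemma chart3E : @chart3 R = (fun z => (chart2 z.1, chart1 z.2)).
Proof. by apply/funext => -[]. Qed.

Lemma chart4E : @chart4 R = (fun z => (chart3 z.1, chart1 z.2)).
Proof. by apply/funext => -[]. Qed.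

Section tests.
Variables (a b c d : R).

Definition tests_xy := tensors (tests1 a b) (tests1 c d).
Definition tests_xyt := tensors tests_xy (tests1 a b).
Definition tests_xytv := tensors tests_xyt (tests1 c d).

Lemma tests_on_xy : tests_on (leb2 R) (@chart2 R) (obox_xy a b c d) tests_xy.
Proof. by rewrite chart2E; apply: tests_on_tensors => //; exact: tests1_on. Qed.

Lemma tests_on_xyt : tests_on (leb3 R) (@chart3 R) (obox_xyt a b c d) tests_xyt.
Proof.
rewrite chart3E; apply: (tests_on_tensors sfL2); first exact: tests_on_xy.
exact: tests1_on.
Qed.

Lemma tests_on_xytv : tests_on (leb4 R) (@chart4 R) (obox_xytv a b c d) tests_xytv.
Proof.
rewrite chart4E; apply: (tests_on_tensors sfL3); first exact: tests_on_xyt.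
exact: tests1_on.
Qed.

Lemma dense_tests_xy : dense_tests (leb2 R) (@chart2 R) (obox_xy a b c d) tests_xy.
Proof.
by rewrite chart2E; apply: dense_tensors => //;
  [exact: tests1_on|exact: tests1_on|exact: dense_tests1|exact: dense_tests1].
Qed.

Lemma dense_tests_xyt : dense_tests (leb3 R) (@chart3 R) (obox_xyt a b c d) tests_xyt.
Proof.
rewrite chart3E; apply: (dense_tensors sfL2);
  [exact: tests_on_xy|exact: tests1_on|exact: dense_tests_xy|exact: dense_tests1].
Qed.

Lemma dense_tests_xytv :
  dense_tests (leb4 R) (@chart4 R) (obox_xytv a b c d) tests_xytv.
Proof.
rewrite chart4E; apply: (dense_tensors sfL3);
  [exact: tests_on_xyt|exact: tests1_on|exact: dense_tests_xyt|exact: dense_tests1].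
Qed.

Lemma reproducing_xy : a < b -> c < d ->
  reproducing (leb2 R) (@chart2 R) (obox_xy a b c d) [:: (1, 0); (0, 1)] tests_xy.
Proof.
move=> ab cd; rewrite chart2E; apply: (reproducing_tensors sfL (tests1_on (a:=a) (b:=b))
  (tests1_on (a:=c) (b:=d)) (reproducing_tests1 ab) (reproducing_tests1 cd)).
Qed.

Lemma reproducing_xyt : a < b -> c < d ->
  reproducing (leb3 R) (@chart3 R) (obox_xyt a b c d) (basis3 (R := R)) tests_xyt.
Proof.
move=> ab cd; rewrite chart3E; apply: (reproducing_tensors sfL2 tests_on_xy
  (tests1_on (a:=a) (b:=b)) (reproducing_xy ab cd) (reproducing_tests1 ab)).
Qed.

Lemma reproducing_xytv : a < b -> c < d ->
  reproducing (leb4 R) (@chart4 R) (obox_xytv a b c d) (basis4 (R := R)) tests_xytv.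
Proof.
move=> ab cd; rewrite chart4E; apply: (reproducing_tensors sfL3 tests_on_xyt
  (tests1_on (a:=c) (b:=d)) (reproducing_xyt ab cd) (reproducing_tests1 cd)).
Qed.

Lemma measurable_obox_xy : measurable (obox_xy a b c d : set (mR * mR)).
Proof. by apply: measurableX; exact: measurable_itv. Qed.

Lemma measurable_obox_xyt : measurable (obox_xyt a b c d : set (mR * mR * mR)).
Proof. by apply: measurableX; [exact: measurable_obox_xy|exact: measurable_itv]. Qed.

Lemma measurable_obox_xytv : measurable (obox_xytv a b c d : set (mR * mR * mR * mR)).
Proof. by apply: measurableX; [exact: measurable_obox_xyt|exact: measurable_itv]. Qed.

Lemma finite_obox_xy : (leb2 R (obox_xy a b c d) < +oo)%E.
Proof.
by apply: finite_setX; [exact: measurable_itv|exact: measurable_itv|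
  exact: finite_itv|exact: finite_itv].
Qed.

Lemma finite_obox_xyt : (leb3 R (obox_xyt a b c d) < +oo)%E.
Proof.
by apply: finite_setX; [exact: measurable_obox_xy|exact: measurable_itv|
  exact: finite_obox_xy|exact: finite_itv].
Qed.

Lemma finite_obox_xytv : (leb4 R (obox_xytv a b c d) < +oo)%E.
Proof.
by apply: finite_setX; [exact: measurable_obox_xyt|exact: measurable_itv|
  exact: finite_obox_xyt|exact: finite_itv].
Qed.

Lemma obox_box_xy : obox_xy a b c d `<=` box_xy a b c d.
Proof. by apply: setSX; exact: subset_itv_oo_cc. Qed.

Lemma obox_box_xyt : obox_xyt a b c d `<=` box_xyt a b c d.
Proof. by apply: setSX; [exact: subset_itv_oo_cc|exact: obox_box_xy]. Qed.

Lemma obox_box_xytv : obox_xytv a b c d `<=` box_xytv a b c d.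
Proof. by apply: setSX; [exact: subset_itv_oo_cc|exact: obox_box_xyt]. Qed.

Lemma ae_obox_xy : {ae leb2 R, forall z, box_xy a b c d z -> obox_xy a b c d z}.
Proof. by apply: ae_setX; exact: ae_itv_open. Qed.

Lemma ae_obox_xyt : {ae leb3 R, forall z, box_xyt a b c d z -> obox_xyt a b c d z}.
Proof. by apply: ae_setX; [exact: ae_obox_xy|exact: ae_itv_open]. Qed.

Lemma ae_obox_xyv : {ae leb3 R, forall z, box_xyv a b c d z ->
  (obox_xy a b c d `*` `]c, d[%classic) z}.
Proof. by apply: ae_setX; [exact: ae_obox_xy|exact: ae_itv_open]. Qed.

Lemma ae_obox_xytv : {ae leb4 R, forall z, box_xytv a b c d z -> obox_xytv a b c d z}.
Proof. by apply: ae_setX; [exact: ae_obox_xyt|exact: ae_itv_open]. Qed.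

End tests.

Section lifts.
Variables (a b c d : R).

Lemma x_last3_obox (p : mR * mR) (x : mR) :
  obox_xyt a b c d (x_last3 (p, x)) <-> obox_xy c d a b p /\ a < x < b.
Proof.
rewrite /x_last3/=; split => [[/= [/= xI yI] tI]|[[/= yI tI] xI]].
  by split; [split|rewrite in_itv in xI].
by split => //; split => //=; rewrite in_itv.
Qed.

Lemma x_last4_obox (p : mR * mR * mR) (x : mR) :
  obox_xytv a b c d (x_last4 (p, x)) <-> obox_xyt c d a b p /\ a < x < b.
Proof.
rewrite /x_last4/=; split => [[/= [/= [/= xI yI] tI] vI]|[[/= [/= yI tI] vI] xI]].
  by split; [split|rewrite in_itv in xI].
by split => //; split => //; split => //=; rewrite in_itv.
Qed.

Lemma x_last3_section (G : R * R * R -> R) :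
  {within @chart3 R @` box_xyt a b c d, continuous G} ->
  forall p : mR * mR, obox_xy c d a b p ->
  {within `[a, b], continuous (fun x => G (chart3 (x_last3 (p, x))))}.
Proof.
move=> cG [y t] /obox_box_xy[/= yI tI].
apply: (within_comp (h := fun x => (x, y, t)) _ _ cG) => x.
  by apply: continuous_pair_cst; apply: (@continuous_pair_cst R R R R id) => z; exact: cvg_id.
by move=> xI; exists (x, y, t).
Qed.

Lemma x_last4_section (G : R * R * R * R -> R) :
  {within @chart4 R @` box_xytv a b c d, continuous G} ->
  forall p : mR * mR * mR, obox_xyt c d a b p ->
  {within `[a, b], continuous (fun x => G (chart4 (x_last4 (p, x))))}.
Proof.
move=> cG [[y t] v] /obox_box_xyt[/= [/= yI tI] vI].
apply: (within_comp (h := fun x => (x, y, t, v)) _ _ cG) => x.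
  apply: continuous_pair_cst; apply: continuous_pair_cst.
  apply: (@continuous_pair_cst R R R R id) => z; exact: cvg_id.
by move=> xI; exists (x, y, t, v).
Qed.

(** As [rho] is itself a product f(y) g(t), the function rho phi can be rebracketed in the order x,
    y, t, and [dx3] differentiates only its first factor. *)
Lemma x_last3_tests rho (phi : R -> R) : tests_xy c d a b rho -> tests1 a b phi ->
  exists theta, [/\ test_function (@chart3 R @` obox_xyt a b c d) theta,
    bounded_measurable (@chart3 R) theta,
    bounded_measurable (@chart3 R) (iter_derive [:: dx3] theta),
    forall (p : mR * mR) x, theta (chart3 (x_last3 (p, x))) = rho (chart2 p) * phi x &
    forall (p : mR * mR) x, iter_derive [:: dx3] theta (chart3 (x_last3 (p, x))) =
      rho (chart2 p) * 'D_(1 : R) phi x].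
Proof.
move=> [f tf [g tg ->]] tphi.
have T h : tests1 a b h -> tests_xyt a b c d (tensor (tensor h f) g).
  by move=> th; exists (tensor h f); [exists h => //; exists f|exists g].
have DE : iter_derive [:: dx3] (tensor (tensor phi f) g) =
    tensor (tensor ('D_(1 : R) phi) f) g.
  have [sphi _] := tphi; have [sf _] := tf; have [sg _] := tg.
  rewrite -(@iter_derive_tensor R R R [:: 1] [::] _ _ sphi sf).
  by rewrite -(iter_derive_tensor [:: (1 : R, 0 : R)] [::] (smooth_tensor sphi sf) sg).
have [t1 b1 _] := tests_on_xyt (T _ tphi).
have [t2 b2 _] := tests_on_xyt (T _ (tests1_derive tphi)).
exists (tensor (tensor phi f) g); split => //; first by rewrite DE.
  by move=> [y t] x; rewrite /tensor/=; ring.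
by move=> [y t] x; rewrite DE /tensor/=; ring.
Qed.

Lemma x_last4_tests rho (phi : R -> R) : tests_xyt c d a b rho -> tests1 a b phi ->
  exists theta, [/\ test_function (@chart4 R @` obox_xytv a b c d) theta,
    bounded_measurable (@chart4 R) theta,
    bounded_measurable (@chart4 R) (iter_derive [:: dx4] theta),
    forall (p : mR * mR * mR) x, theta (chart4 (x_last4 (p, x))) = rho (chart3 p) * phi x &
    forall (p : mR * mR * mR) x, iter_derive [:: dx4] theta (chart4 (x_last4 (p, x))) =
      rho (chart3 p) * 'D_(1 : R) phi x].
Proof.
move=> [_ [f tf [g tg ->]] [k tk ->]] tphi.
have T h : tests1 a b h -> tests_xytv a b c d (tensor (tensor (tensor h f) g) k).
  move=> th; exists (tensor (tensor h f) g); last by exists k.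
  by exists (tensor h f); [exists h => //; exists f|exists g].
have DE : iter_derive [:: dx4] (tensor (tensor (tensor phi f) g) k) =
    tensor (tensor (tensor ('D_(1 : R) phi) f) g) k.
  have [sphi _] := tphi; have [sf _] := tf; have [sg _] := tg; have [sk _] := tk.
  rewrite -(@iter_derive_tensor R R R [:: 1] [::] _ _ sphi sf).
  rewrite -(iter_derive_tensor [:: (1 : R, 0 : R)] [::] (smooth_tensor sphi sf) sg).
  by rewrite -(iter_derive_tensor [:: (1 : R, 0 : R, 0 : R)] [::]
    (smooth_tensor (smooth_tensor sphi sf) sg) sk).
have [t1 b1 _] := tests_on_xytv (T _ tphi).
have [t2 b2 _] := tests_on_xytv (T _ (tests1_derive tphi)).
exists (tensor (tensor (tensor phi f) g) k); split => //; first by rewrite DE.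
  by move=> [[y t] v] x; rewrite /tensor/=; ring.
by move=> [[y t] v] x; rewrite DE /tensor/=; ring.
Qed.

End lifts.

End boxes_of_space.

(** * The derivative of each pair of terms *)

Section derivative_of_slices.
Context {R : realType}.
Local Notation mR := (measurableTypeR R).
Local Notation L := (@lebesgue_measure R).
Variables (a b c d : R).
Hypothesis ab : a < b.

Let sfL : sigma_finite setT L := sigma_finiteT _.
Let sfL2 : sigma_finite setT (L \x L)%E := sigma_finite_prod L sfL.
Let sfL3 : sigma_finite setT (L \x L \x L)%E := sigma_finite_prod L sfL2.

Local Notation O2 := (obox_xy a b c d).
Local Notation O3 := (obox_xyt a b c d).
Local Notation O4 := (obox_xytv a b c d).
Local Notation Ov := (obox_xy a b c d `*` (`]c, d[%classic : set R)).

Lemma L1M_fst d1 d2 (T1 : measurableType d1) (T2 : measurableType d2)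
    (m1 : {measure set T1 -> \bar R}) (m2 : {sigma_finite_measure set T2 -> \bar R})
    (f : T1 * T2 -> R) (chi : T1 -> R) : measurable_fun setT chi ->
  (exists M, forall z, `|chi z| <= M) -> L1 (m1 \x m2)%E f ->
  L1 (m1 \x m2)%E (fun q => f q * chi q.1).
Proof. by move=> mchi bchi lf; under eq_fun do rewrite mulrC; exact: L1_fst_mul. Qed.

Variables (u phi : R * R -> R).
Hypothesis lu : L2 (leb2 R) (u \_ O2).
Hypothesis tphi : test_function O2 phi.

Let sphi : smooth phi. Proof. by case: tphi. Qed.
Let tD := test_function_derive dx2 tphi.
Let sD : smooth ('D_dx2 phi). Proof. by case: tD. Qed.
Let mphi := measurable_plane (smooth_continuous sphi).
Let mD := measurable_plane (smooth_continuous sD).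
Let bphi := test_function_bounded tphi.
Let bD := test_function_bounded tD.

Lemma L1_integrand_x_obox s (K : mR * mR * mR -> R) (chi : mR * mR -> R) :
  L2 (leb3 R) (K \_ O3) -> measurable_fun setT chi -> (exists M, forall z, `|chi z| <= M) ->
  L1 (leb3 R) (fun q => integrand_x s (K \_ O3) (u \_ O2) q * chi q.1).
Proof.
move=> lK mchi bchi; apply: L1M_fst => //; apply: L1_integrand_x.
apply: (@L1_mul_swap_xt R a b _ _ lK lu) => q nI.
by rewrite patchE memNset// => -[[/= + _] _] => /subset_itv_oo_cc.
Qed.

Lemma L1_integrand_xy_obox s s' (K : mR * mR * mR * mR -> R) (chi : mR * mR -> R) :
  L2 (leb4 R) (K \_ O4) -> measurable_fun setT chi -> (exists M, forall z, `|chi z| <= M) ->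
  L1 (leb4 R) (fun q => integrand_xy s s' (K \_ O4) (u \_ O2) q * chi q.1.1).
Proof.
move=> lK mchi [M hM]; apply: (L1M_fst (chi := chi \o fst)).
- exact: measurableT_comp.
- by exists M => z; exact: hM.
apply: L1_integrand_xy; apply: (@L1_mul_swap_xy_tv R a b c d _ _ lK lu) => q nI;
  rewrite patchE memNset// => -[[[/= x1 x2] _] _]; exact/nI/subset_itv_oo_cc.
Qed.

(** With p = (y, t) the boundary term is the integral of J(t, y) u(t, y) phi(t, y): the variable t
    takes over the place of x, and a kernel in theta leaves behind a multiplication operator. *)
Lemma derivative_of_slice_x (K1 K2 K1' K2' : R * R * R -> R) (G1 G2 : R * R * R -> R)
    (J : R * R -> R) :
  square_integrable (leb3 R) O3 K1 -> square_integrable (leb3 R) O3 K2 ->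
  square_integrable (leb3 R) O3 K1' -> square_integrable (leb3 R) O3 K2' ->
  weak_derivative (leb3 R) chart3 O3 [:: dx3] K1 K1' ->
  weak_derivative (leb3 R) chart3 O3 [:: dx3] K2 K2' ->
  {within @chart3 R @` box_xyt a b c d, continuous G1} ->
  {within @chart3 R @` box_xyt a b c d, continuous G2} ->
  ae_eq (leb3 R) (box_xyt a b c d) K1 (G1 \o chart3) ->
  ae_eq (leb3 R) (box_xyt a b c d) K2 (G2 \o chart3) ->
  L2 (leb2 R) (J \_ O2) ->
  {ae leb2 R, forall z, O2 z -> J z = G1 (z.1, z.2, z.1) - G2 (z.1, z.2, z.1)} ->
  \int[leb3 R]_q (integrand_x true (K1 \_ O3) (u \_ O2) q * 'D_dx2 phi q.1) +
  \int[leb3 R]_q (integrand_x false (K2 \_ O3) (u \_ O2) q * 'D_dx2 phi q.1) =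
  - (\int[leb2 R]_z ((J \_ O2) z * (u \_ O2) z * phi z)) -
  (\int[leb3 R]_q (integrand_x true (K1' \_ O3) (u \_ O2) q * phi q.1) +
   \int[leb3 R]_q (integrand_x false (K2' \_ O3) (u \_ O2) q * phi q.1)).
Proof.
move=> s1 s2 s1' s2' w1 w2 cG1 cG2 KG1 KG2 lJ JE.
have [l1 l2] := ((square_integrable_L2 _ _ _).1 s1, (square_integrable_L2 _ _ _).1 s2).
have [l1' l2'] := ((square_integrable_L2 _ _ _).1 s1', (square_integrable_L2 _ _ _).1 s2').
have lUK (K : mR * mR * mR -> R) : L2 (leb3 R) (K \_ O3) -> L1 (leb3 R)
    (fun z => (u \_ O2) (z.1.2, z.1.1) * (K \_ O3) (x_last3 z)).
  move=> lK; have lKu : L1 (leb3 R) (fun q => (K \_ O3) q * (u \_ O2) (q.2, q.1.2)).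
    apply: (@L1_mul_swap_xt R a b _ _ lK lu) => q nI.
    by rewrite patchE memNset// => -[[/= + _] _] => /subset_itv_oo_cc.
  have := mp_L1 mp_x_last3 lKu; congr (L1 _ _); apply/funext => z /=.
  by rewrite mulrC.
have lJu : L1 (leb2 R) (fun z => (J \_ O2) z * (u \_ O2) z * phi z).
  have := L1M_bounded mphi bphi (L2_mul lJ lu).
  by congr (L1 _ _); apply/funext => z; rewrite mulrC.
have lJs := mp_L1 (mp_swap L L) lJu.
have ibp := @integration_by_parts_with_jump _ _ R _ _ _ _ (leb2 R) chart2 (leb3 R) chart3
  sfL2 (obox_xy c d a b) (tests_xy c d a b) (measurable_obox_xy _ _ _ _)
  (tests_on_xy (a:=c) (b:=d) (c:=a) (d:=b)) (dense_tests_xy (a:=c) (b:=d) (c:=a) (d:=b))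
  a b `]c, d[%classic ab O3 (box_xyt a b c d) dx3 x_last3 (measurable_obox_xyt _ _ _ _)
  (finite_obox_xyt _ _ _ _) (obox_box_xyt (a:=a) (b:=b) (c:=c) (d:=d)) mp_x_last3
  (x_last3_obox a b c d) (x_last3_tests (a:=a) (b:=b) (c:=c) (d:=d))
  (x_last3_section (a:=a) (b:=b) (c:=c) (d:=d)) K1 K2 K1' K2' G1 G2 s1 s2 s1' s2' w1 w2
  cG1 KG1 cG2 KG2 (fun p => (u \_ O2) (p.2, p.1)) snd fst
  (fun p => (J \_ O2) (p.2, p.1) * (u \_ O2) (p.2, p.1) * phi (p.2, p.1)) phi
  (@measurable_snd _ _ _ _) (@measurable_fst _ _ _ _) _ tphi
  (lUK _ l1) (lUK _ l2) (lUK _ l1') (lUK _ l2') (L1_measurable lJs).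
(* Used with [chi] equal to ['D_dx2 phi] and to [phi]: it merges the two terms and moves x to the
   last place. *)
have two (chi : R * R -> R) (f1 f2 : mR * mR * mR -> R) :
    measurable_fun setT (chi : mR * mR -> R) -> (exists M, forall z, `|chi z| <= M) ->
    L2 (leb3 R) (f1 \_ O3) -> L2 (leb3 R) (f2 \_ O3) ->
  \int[leb3 R]_q (integrand_x true (f1 \_ O3) (u \_ O2) q * chi q.1) +
  \int[leb3 R]_q (integrand_x false (f2 \_ O3) (u \_ O2) q * chi q.1) =
  \int[leb3 R]_z ((cut true z.1.2 z.2 * ((u \_ O2) (z.1.2, z.1.1) * (f1 \_ O3) (x_last3 z)) +
     cut false z.1.2 z.2 * ((u \_ O2) (z.1.2, z.1.1) * (f2 \_ O3) (x_last3 z))) *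
      chi (z.2, z.1.1)).
  move=> mchi bchi k1 k2.
  rewrite -RintegralD//; [|exact: L1_integrand_x_obox|exact: L1_integrand_x_obox].
  rewrite (mp_Rint mp_x_last3); last by apply: L1D; exact: L1_integrand_x_obox.
  by apply: eq_Rintegral => z _; rewrite /integrand_x/=; ring.
rewrite (two _ _ _ mD bD l1 l2) (two _ _ _ mphi bphi l1' l2') ibp.
- by rewrite -(mp_Rint (mp_swap L L) lJu).
- by move=> p [_ /=]; rewrite in_itv/= => /andP[? ?]; rewrite !ltW.
- have := mp_ae (mp_swap L L) JE; apply: filterS => p hJ; rewrite indicE !patchE.
  have [Op|Op] := pselect (obox_xy c d a b p).
    have Op' : O2 (p.2, p.1) by case: Op.
    by rewrite !mem_set// hJ//= /x_last3 /=; ring.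
  have Op' : ~ O2 (p.2, p.1) by move=> [? ?]; apply: Op.
  by rewrite (memNset Op) (memNset Op') !mul0r.
Qed.

(** With p = (y, t, v) the boundary term is the integral of J(t, y, v) u(t, v) phi(t, y), with the
    cut between v and y intact. Renaming t to x shows the integrand of a kernel in nu alone. *)
Lemma derivative_of_slice_xy s' (K1 K2 K1' K2' : R * R * R * R -> R)
    (G1 G2 : R * R * R * R -> R) (J : R * R * R -> R) :
  square_integrable (leb4 R) O4 K1 -> square_integrable (leb4 R) O4 K2 ->
  square_integrable (leb4 R) O4 K1' -> square_integrable (leb4 R) O4 K2' ->
  weak_derivative (leb4 R) chart4 O4 [:: dx4] K1 K1' ->
  weak_derivative (leb4 R) chart4 O4 [:: dx4] K2 K2' ->
  {within @chart4 R @` box_xytv a b c d, continuous G1} ->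
  {within @chart4 R @` box_xytv a b c d, continuous G2} ->
  ae_eq (leb4 R) (box_xytv a b c d) K1 (G1 \o chart4) ->
  ae_eq (leb4 R) (box_xytv a b c d) K2 (G2 \o chart4) ->
  L2 (leb3 R) (J \_ Ov) ->
  {ae leb3 R, forall z, Ov z -> J z =
    G1 (z.1.1, z.1.2, z.1.1, z.2) - G2 (z.1.1, z.1.2, z.1.1, z.2)} ->
  \int[leb4 R]_q (integrand_xy true s' (K1 \_ O4) (u \_ O2) q * 'D_dx2 phi q.1.1) +
  \int[leb4 R]_q (integrand_xy false s' (K2 \_ O4) (u \_ O2) q * 'D_dx2 phi q.1.1) =
  - (\int[leb3 R]_q (integrand_y s' (J \_ Ov) (u \_ O2) q * phi q.1)) -
  (\int[leb4 R]_q (integrand_xy true s' (K1' \_ O4) (u \_ O2) q * phi q.1.1) +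
   \int[leb4 R]_q (integrand_xy false s' (K2' \_ O4) (u \_ O2) q * phi q.1.1)).
Proof.
move=> s1 s2 s1' s2' w1 w2 cG1 cG2 KG1 KG2 lJ JE.
have [l1 l2] := ((square_integrable_L2 _ _ _).1 s1, (square_integrable_L2 _ _ _).1 s2).
have [l1' l2'] := ((square_integrable_L2 _ _ _).1 s1', (square_integrable_L2 _ _ _).1 s2').
have lUK (K : mR * mR * mR * mR -> R) : L2 (leb4 R) (K \_ O4) -> L1 (leb4 R)
    (fun z => (cut s' z.1.2 z.1.1.1 * (u \_ O2) (z.1.1.2, z.1.2)) * (K \_ O4) (x_last4 z)).
  move=> lK; have lKu : L1 (leb4 R) (fun q => (K \_ O4) q * (u \_ O2) (q.1.2, q.2)).
    apply: (@L1_mul_swap_xy_tv R a b c d _ _ lK lu) => q nI;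
      rewrite patchE memNset// => -[[[/= x1 x2] _] _]; exact/nI/subset_itv_oo_cc.
  have lc : L1 (leb4 R) (fun q => cut s' q.2 q.1.1.2 * ((K \_ O4) q * (u \_ O2) (q.1.2, q.2))).
    apply: L1M_bounded lKu; last by exists 1 => q; exact: cut_bounded.
    apply: measurable_cut => //; apply: (measurableT_comp measurable_snd).
    exact: (measurableT_comp measurable_fst measurable_fst).
  have := mp_L1 mp_x_last4 lc; congr (L1 _ _); apply/funext => z /=.
  by rewrite mulrA mulrAC.
have lJu : L1 (leb3 R) (fun q => integrand_y s' (J \_ Ov) (u \_ O2) q * phi q.1).
  apply: L1M_fst => //; apply: L1_integrand_y.
  apply: (@L1_mul_swap_yv R c d _ _ lJ lu) => q nI.
  by rewrite patchE memNset// => -[[/= _ +] _] => /subset_itv_oo_cc.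
have lJs := mp_L1 (mp_swap12 (R := R)) lJu.
have mtau : measurable_fun setT (fun p : mR * mR * mR => p.1.2).
  exact: (measurableT_comp measurable_snd measurable_fst).
have meta : measurable_fun setT (fun p : mR * mR * mR => p.1.1).
  exact: (measurableT_comp measurable_fst measurable_fst).
have ibp := @integration_by_parts_with_jump _ _ R _ _ _ _ (leb3 R) chart3 (leb4 R) chart4
  sfL3 (obox_xyt c d a b) (tests_xyt c d a b) (measurable_obox_xyt _ _ _ _)
  (tests_on_xyt (a:=c) (b:=d) (c:=a) (d:=b)) (dense_tests_xyt (a:=c) (b:=d) (c:=a) (d:=b))
  a b `]c, d[%classic ab O4 (box_xytv a b c d) dx4 x_last4 (measurable_obox_xytv _ _ _ _)
  (finite_obox_xytv _ _ _ _) (obox_box_xytv (a:=a) (b:=b) (c:=c) (d:=d)) mp_x_last4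
  (x_last4_obox a b c d) (x_last4_tests (a:=a) (b:=b) (c:=c) (d:=d))
  (x_last4_section (a:=a) (b:=b) (c:=c) (d:=d)) K1 K2 K1' K2' G1 G2 s1 s2 s1' s2' w1 w2
  cG1 KG1 cG2 KG2 (fun p => cut s' p.2 p.1.1 * (u \_ O2) (p.1.2, p.2)) _ _
  (fun p => integrand_y s' (J \_ Ov) (u \_ O2) (p.1.2, p.1.1, p.2) * phi (p.1.2, p.1.1)) phi
  mtau meta _ tphi
  (lUK _ l1) (lUK _ l2) (lUK _ l1') (lUK _ l2') (L1_measurable lJs).
have two (chi : R * R -> R) (f1 f2 : mR * mR * mR * mR -> R) :
    measurable_fun setT (chi : mR * mR -> R) -> (exists M, forall z, `|chi z| <= M) ->
    L2 (leb4 R) (f1 \_ O4) -> L2 (leb4 R) (f2 \_ O4) ->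
  \int[leb4 R]_q (integrand_xy true s' (f1 \_ O4) (u \_ O2) q * chi q.1.1) +
  \int[leb4 R]_q (integrand_xy false s' (f2 \_ O4) (u \_ O2) q * chi q.1.1) =
  \int[leb4 R]_z ((cut true z.1.1.2 z.2 * ((cut s' z.1.2 z.1.1.1 *
       (u \_ O2) (z.1.1.2, z.1.2)) * (f1 \_ O4) (x_last4 z)) +
     cut false z.1.1.2 z.2 * ((cut s' z.1.2 z.1.1.1 *
       (u \_ O2) (z.1.1.2, z.1.2)) * (f2 \_ O4) (x_last4 z))) *
      chi (z.2, z.1.1.1)).
  move=> mchi bchi k1 k2.
  rewrite -RintegralD//; [|exact: L1_integrand_xy_obox|exact: L1_integrand_xy_obox].
  rewrite (mp_Rint mp_x_last4); last by apply: L1D; exact: L1_integrand_xy_obox.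
  by apply: eq_Rintegral => z _; rewrite /integrand_xy/=; ring.
rewrite (two _ _ _ mD bD l1 l2) (two _ _ _ mphi bphi l1' l2') ibp.
- by rewrite -(mp_Rint (mp_swap12 (R := R)) lJu).
- by move=> p [[_ /=]]; rewrite in_itv/= => /andP[? ?]; rewrite !ltW.
- have := mp_ae (mp_swap12 (R := R)) JE; apply: filterS => p hJ.
  rewrite indicE /integrand_y /= ![(_ \_ _) _]patchE.
  have [Op|Op] := pselect (obox_xyt c d a b p).
    have Op' : Ov (p.1.2, p.1.1, p.2) by case: Op => -[].
    have Op2 : O2 (p.1.2, p.2) by case: Op => -[].
    by rewrite !mem_set// hJ//= /x_last4 /=; ring.
  have Op' : ~ Ov (p.1.2, p.1.1, p.2) by move=> [[? ?] ?]; apply: Op.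
  by rewrite (memNset Op) (memNset Op') !mul0r mulr0 mul0r.
Qed.

End derivative_of_slices.

(* Typeclass search fails to find [ae_filter] on [R * R] in place of
   [measurableTypeR R * measurableTypeR R]. *)
Lemma ae_sub d (T : measurableType d) (R : realType) (mu : {measure set T -> \bar R})
    (P Q : set T) : {ae mu, forall x, P x} -> P `<=` Q -> {ae mu, forall x, Q x}.
Proof. by move=> aeP PQ; exact: filterS PQ aeP. Qed.

Section restrictions.
Context d (T : measurableType d) (R : realType) (mu : {measure set T -> \bar R}).

Lemma L2_restrict (A B : set T) (f : T -> R) : measurable A -> A `<=` B ->
  L2 mu (f \_ B) -> L2 mu (f \_ A).
Proof.
move=> mA AB lf; have := L2M_bounded (measurable_indic mA) (indic_bounded R A) lf.
congr (L2 _ _); apply/funext => z; rewrite indicE !patchE.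
have [Az|Az] := pselect (A z); last by rewrite memNset// mul0r.
by rewrite !mem_set ?mul1r//; exact: AB.
Qed.

Lemma Rint_ae_zero (f : T -> R) : measurable_fun setT f ->
  {ae mu, forall z, f z = 0} -> \int[mu]_z f z = 0.
Proof.
move=> mf f0; rewrite -[RHS](Rint_zero mu); apply: ae_eq_Rintegral => //.
by apply: filterS f0 => z /= ->.
Qed.

End restrictions.

(** * Pairing the operator with a test function *)

Section pairings.
Context {R : realType} {n m : nat}.
Local Notation mR := (measurableTypeR R).
Local Notation L := (@lebesgue_measure R).
Variables a b c d : R.
Local Notation O2 := (obox_xy a b c d).
Local Notation O3 := (obox_xyt a b c d).
Local Notation O4 := (obox_xytv a b c d).
Local Notation Ov := (obox_xy a b c d `*` (`]c, d[%classic : set R)).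

Let sfL : sigma_finite setT L := sigma_finiteT _.
Let sfL2 : sigma_finite setT (L \x L)%E := sigma_finite_prod L sfL.
Let sfL3 : sigma_finite setT (L \x L \x L)%E := sigma_finite_prod L sfL2.

Variables (K : kernel2D R n m) (u : R * R -> 'cV[R]_m) (i : 'I_n).
Hypotheses (hK : N2D a b c d K).
Hypothesis hu : mx_square_integrable (leb2 R) (box_xy a b c d) u.

Local Notation uo j := ((fun z => u z j ord0) \_ O2).

Lemma state_L2_obox j : L2 (leb2 R) (uo j).
Proof.
exact: L2_restrict (measurable_obox_xy _ _ _ _) (@obox_box_xy _ _ _ _ _) (state_entry_L2 hu j).
Qed.

Lemma kernel_00_L2_obox j : L2 (leb2 R) ((fun z => k00 K z i j) \_ O2).
Proof.
exact: L2_restrict (measurable_obox_xy _ _ _ _) (@obox_box_xy _ _ _ _ _) (entry_00_L2 i hK j).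
Qed.

Lemma kernel_x_L2_obox s j : L2 (leb3 R) ((fun z => kernel_x K s z i j) \_ O3).
Proof.
exact: L2_restrict (measurable_obox_xyt _ _ _ _) (@obox_box_xyt _ _ _ _ _)
  (entry_x_L2 i hK s j).
Qed.

Lemma obox_box_xyv : Ov `<=` box_xyv a b c d.
Proof. by apply: setSX; [exact: subset_itv_oo_cc|exact: obox_box_xy]. Qed.

Lemma kernel_y_L2_obox s j : L2 (leb3 R) ((fun z => kernel_y K s z i j) \_ Ov).
Proof.
apply: L2_restrict (entry_y_L2 i hK s j); last exact: obox_box_xyv.
by apply: measurableX; [exact: measurable_obox_xy|exact: measurable_itv].
Qed.

Lemma kernel_xy_L2_obox s s' j : L2 (leb4 R) ((fun z => kernel_xy K s s' z i j) \_ O4).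
Proof.
exact: L2_restrict (measurable_obox_xytv _ _ _ _) (@obox_box_xytv _ _ _ _ _)
  (entry_xy_L2 i hK s s' j).
Qed.

Variable chi : mR * mR -> R.
Hypotheses (mchi : measurable_fun setT chi) (bchi : exists M, forall z, `|chi z| <= M).

(** Weak derivatives are given on open boxes, the operator on closed ones. The pairings use the open
    boxes; the difference is a null set. *)
Definition pairing00 j := \int[leb2 R]_z (((fun z => k00 K z i j) \_ O2) z * uo j z * chi z).
Definition pairing_x s j := \int[leb3 R]_q
  (integrand_x s ((fun z => kernel_x K s z i j) \_ O3) (uo j) q * chi q.1).
Definition pairing_y s j := \int[leb3 R]_q
  (integrand_y s ((fun z => kernel_y K s z i j) \_ Ov) (uo j) q * chi q.1).
Definition pairing_xy s s' j := \int[leb4 R]_q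
  (integrand_xy s s' ((fun z => kernel_xy K s s' z i j) \_ O4) (uo j) q * chi q.1.1).

Definition pairing := \sum_j pairing00 j + \sum_s \sum_j pairing_x s j +
  \sum_s \sum_j pairing_y s j + \sum_s \sum_s' \sum_j pairing_xy s s' j.

(** Wherever the kernel factor is nonzero, the argument of the state already lies in the smaller
    set, so the restriction of the state may be changed. *)
Let mul_patch d1 d2 (S : measurableType d1) (S' : measurableType d2) (A : set S) (B B' : set S')
    (h : S -> S') (f : S -> R) (g : S' -> R) q : B' `<=` B -> (forall q, A q -> B' (h q)) ->
  (f \_ A) q * (g \_ B) (h q) = (f \_ A) q * (g \_ B') (h q).
Proof.
move=> BB AB; rewrite ![(f \_ _) _]patchE; have [Aq|Aq] := pselect (A q).
  by rewrite !patchE !mem_set//; [exact: AB|exact/BB/AB].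
by rewrite memNset// !mul0r.
Qed.

Lemma pairing00E j :
  \int[leb2 R]_z (entry_00 a b c d K i j z * state_entry a b c d u j z * chi z) = pairing00 j.
Proof.
have lo := kernel_00_L2_obox j; have luo := state_L2_obox j.
apply: ae_eq_Rintegral.
- by apply: measurable_funM => //; exact: L1_measurable (L1_entry_00 i hK hu j).
- by apply: measurable_funM => //; exact: L1_measurable (L2_mul lo luo).
have := ae_eq_patch (mu := leb2 R) (fun z => k00 K z i j)
  (@obox_box_xy R a b c d) (@ae_obox_xy R a b c d).
apply: filterS => z /= /(_ Logic.I) E _; rewrite /entry_00 E; congr (_ * _).
by apply: (mul_patch (h := id)) => //; exact: obox_box_xy.
Qed.

Lemma pairing_xE s j : \int[leb3 R]_q
  (integrand_x s (entry_x a b c d K i s j) (state_entry a b c d u j) q * chi q.1) = pairing_x s j.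
Proof.
have lo := kernel_x_L2_obox s j; have luo := state_L2_obox j.
apply: ae_eq_Rintegral.
- by apply: L1_measurable (L1M_fst mchi bchi (L1_entry_x i hK hu s j)).
- by apply: L1_measurable; exact: L1_integrand_x_obox.
have := ae_eq_patch (mu := leb3 R) (fun z => kernel_x K s z i j)
  (@obox_box_xyt R a b c d) (@ae_obox_xyt R a b c d).
apply: filterS => q /= /(_ Logic.I) E _; rewrite /integrand_x /entry_x E.
rewrite (mul_patch (h := fun q : mR * mR * mR => (q.2, q.1.2)) (B' := O2))//.
  exact: obox_box_xy.
by move=> p [[? ?] ?].
Qed.

Lemma pairing_yE s j : \int[leb3 R]_q
  (integrand_y s (entry_y a b c d K i s j) (state_entry a b c d u j) q * chi q.1) = pairing_y s j.
Proof.
have lo := kernel_y_L2_obox s j; have luo := state_L2_obox j.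
apply: ae_eq_Rintegral.
- by apply: L1_measurable (L1M_fst mchi bchi (L1_entry_y i hK hu s j)).
- apply: L1_measurable (L1M_fst mchi bchi _); apply: L1_integrand_y.
  apply: (@L1_mul_swap_yv R c d _ _ lo luo) => q nI.
  by rewrite patchE memNset// => -[[/= _ +] _] => /subset_itv_oo_cc.
have := ae_eq_patch (mu := leb3 R) (fun z => kernel_y K s z i j) obox_box_xyv (@ae_obox_xyv R a b c d).
apply: filterS => q /= /(_ Logic.I) E _; rewrite /integrand_y /entry_y E.
rewrite (mul_patch (h := fun q : mR * mR * mR => (q.1.1, q.2)) (B' := O2))//.
  exact: obox_box_xy.
by move=> p [[? ?] ?].
Qed.

Lemma pairing_xyE s s' j : \int[leb4 R]_q
  (integrand_xy s s' (entry_xy a b c d K i s s' j) (state_entry a b c d u j) q * chi q.1.1) =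
  pairing_xy s s' j.
Proof.
have lo := kernel_xy_L2_obox s s' j; have luo := state_L2_obox j.
have bchi1 : exists M, forall z : mR * mR * mR, `|(chi \o fst) z| <= M.
  by have [M hM] := bchi; exists M => z; exact: hM.
apply: ae_eq_Rintegral.
- exact: L1_measurable (L1M_fst (measurableT_comp mchi measurable_fst) bchi1
    (L1_entry_xy i hK hu s s' j)).
- by apply: L1_measurable; exact: L1_integrand_xy_obox.
have := ae_eq_patch (mu := leb4 R) (fun z => kernel_xy K s s' z i j) (@obox_box_xytv R a b c d)
  (@ae_obox_xytv R a b c d).
apply: filterS => q /= /(_ Logic.I) E _; rewrite /integrand_xy /entry_xy E.
rewrite (mul_patch (h := fun q : mR * mR * mR * mR => (q.1.2, q.2)) (B' := O2))//.
  exact: obox_box_xy.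
by move=> p [[_ ?] ?].
Qed.

Lemma slices_pairing :
  \int[leb2 R]_z (slices a b c d K u i z * chi z) = pairing.
Proof.
have lM (f : mR * mR -> R) : L1 (leb2 R) f -> L1 (leb2 R) (fun z => f z * chi z).
  by move=> lf; under eq_fun do rewrite mulrC; exact: L1M_bounded.
have bchi1 : exists M, forall z : mR * mR * mR, `|(chi \o fst) z| <= M.
  by have [M hM] := bchi; exists M => z; exact: hM.
have mchi1 : measurable_fun setT (chi \o fst : mR * mR * mR -> R).
  exact: (measurableT_comp mchi measurable_fst).
have l00 : L1 (leb2 R) (fun z => \sum_j entry_00 a b c d K i j z * state_entry a b c d u j z).
  by apply: L1_sum => j; exact: L1_entry_00.
have lx := L1_slice_x i hK hu; have ly := L1_slice_y i hK hu.
have lxyt := L1_slice_xyt i hK hu; have lxy := L1_slice_xy i hK hu.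
have px s : \int[leb2 R]_z (slice_x a b c d K u i s z * chi z) = \sum_j pairing_x s j.
  rewrite /slice_x (Rint_slice_sum sfL2 mchi bchi (L1_entry_x i hK hu s)).
  by apply: eq_bigr => j _; exact: pairing_xE.
have py s : \int[leb2 R]_z (slice_y a b c d K u i s z * chi z) = \sum_j pairing_y s j.
  rewrite /slice_y (Rint_slice_sum sfL2 mchi bchi (L1_entry_y i hK hu s)).
  by apply: eq_bigr => j _; exact: pairing_yE.
have pxy s s' : \int[leb2 R]_z (slice_xy a b c d K u i s s' z * chi z) =
    \sum_j pairing_xy s s' j.
  rewrite /slice_xy (Rint_slice sfL2 mchi bchi (lxyt s s')).
  rewrite /slice_xyt (Rint_slice_sum sfL3 mchi1 bchi1 (L1_entry_xy i hK hu s s')).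
  by apply: eq_bigr => j _; exact: pairing_xyE.
rewrite /slices /pairing.
under eq_Rintegral do rewrite !mulrDl 3!mulr_suml.
rewrite RintegralD//; last 2 first.
- apply: L1D; first apply: L1D.
  + by under eq_fun do rewrite -mulr_suml; exact: lM.
  + by apply: L1_sum => s; exact: lM.
  + by apply: L1_sum => s; exact: lM.
- by under eq_fun do rewrite mulr_suml; apply: L1_sum => s; exact/lM/L1_sum.
rewrite RintegralD//; last 2 first.
- apply: L1D.
  + by under eq_fun do rewrite -mulr_suml; exact: lM.
  + by apply: L1_sum => s; exact: lM.
- by apply: L1_sum => s; exact: lM.
rewrite RintegralD//; last 2 first.
- by under eq_fun do rewrite -mulr_suml; exact: lM.
- by apply: L1_sum => s; exact: lM.
congr (_ + _ + _ + _).
- rewrite Rint_sum; last by move=> j; exact/lM/L1_entry_00.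
  by apply: eq_bigr => j _; exact: pairing00E.
- rewrite Rint_sum; last by move=> s; exact: lM.
  by apply: eq_bigr => s _; exact: px.
- rewrite Rint_sum; last by move=> s; exact: lM.
  by apply: eq_bigr => s _; exact: py.
- under eq_Rintegral do rewrite mulr_suml.
  rewrite Rint_sum; last by move=> s; exact/lM/L1_sum.
  apply: eq_bigr => s _; under eq_Rintegral do rewrite mulr_suml.
  rewrite Rint_sum; last by move=> s'; exact: lM.
  by apply: eq_bigr => s' _; exact: pxy.
Qed.

End pairings.

(** Regrouping of indices: the hypotheses join first index 1 to first index 2, for each column and
    each second index, while the operator sums over all indices of one shape at a time. *)
Lemma jump_sums (R : realType) (J : finType) (p00 : J -> R) (px px' py : bool -> J -> R)
    (pxy pxy' : bool -> bool -> J -> R) :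
  (forall j, px true j + px false j = - p00 j - (px' true j + px' false j)) ->
  (forall s j, pxy true s j + pxy false s j = - py s j - (pxy' true s j + pxy' false s j)) ->
  \sum_s \sum_j px s j + \sum_s \sum_s' \sum_j pxy s s' j =
  - (\sum_j p00 j + \sum_s \sum_j px' s j + \sum_s \sum_j py s j +
     \sum_s \sum_s' \sum_j pxy' s s' j).
Proof.
move=> hx hxy.
have Ex : \sum_j px true j + \sum_j px false j =
    - (\sum_j p00 j + (\sum_j px' true j + \sum_j px' false j)).
  by rewrite -!big_split/= -sumrN; apply: eq_bigr => j _; rewrite hx; ring.
have Exy s : \sum_j pxy true s j + \sum_j pxy false s j =
    - (\sum_j py s j + (\sum_j pxy' true s j + \sum_j pxy' false s j)).
  by rewrite -!big_split/= -sumrN; apply: eq_bigr => j _; rewrite hxy; ring.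
have := Exy true; have := Exy false; move: Ex; rewrite !big_bool /=.
do 12 (let s := fresh "s" in move: (\sum_j _) => s); lra.
Qed.

(** * The weak derivative of the operator *)

Section derivative.
Context {R : realType} {n m : nat}.
Local Notation mR := (measurableTypeR R).
Local Notation L := (@lebesgue_measure R).
Variables a b c d : R.
Hypothesis ab : a < b.
Local Notation O2 := (obox_xy a b c d).
Local Notation O3 := (obox_xyt a b c d).
Local Notation O4 := (obox_xytv a b c d).
Local Notation Ov := (obox_xy a b c d `*` (`]c, d[%classic : set R)).

Lemma loc_integrable_PI2D (K : kernel2D R n m) (u : R * R -> 'cV[R]_m) i :
  N2D a b c d K -> mx_square_integrable (leb2 R) (box_xy a b c d) u ->
  loc_integrable (leb2 R) (@chart2 R) O2 (fun z => PI2D a b c d K u z i ord0).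
Proof.
move=> hK hu; have lS := L1_slices i hK hu; split.
  apply: (@eq_measurable_fun _ _ _ _ O2 (slices a b c d K u i)).
    by move=> z /[!inE] Oz; rewrite PI2D_slices.
  by apply: (measurable_funS measurableT (@subsetT _ O2)); exact: L1_measurable lS.
(* Compactness refers to the norm topology of the image: compact sets are closed there, and the
   countable measurable basis brings this back to the product sigma-algebra. *)
move=> D DO cD; have mD : measurable (D : set (mR * mR)).
  have -> : D = ~` ((fun z : mR * mR => (z.1 : R, z.2 : R)) @^-1` (~` (chart2 @` D))).
    apply/seteqP; split => [[x y] Dz /=|[x y] /= nD]; first by move=> h; apply: h; exists (x, y).
    by apply: contrapT => Dz; apply: nD => -[z Dz' zE]; apply: Dz; rewrite -zE.
  apply: measurableC.
  apply: (@open_measurable_basis _ _ _ _ (fun z : mR * mR => (z.1 : R, z.2 : R))).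
    exact: (measurable_basis_prod (measurable_basis1 (R := R)) (measurable_basis1 (R := R))).
  exact/closed_openC/(compact_closed (@norm_hausdorff _ _)).
apply: (@eq_integrable _ _ _ (leb2 R) D mD (EFin \o slices a b c d K u i)).
  by move=> z /[!inE] Dz /=; rewrite PI2D_slices//; exact: DO.
by apply: (integrableS measurableT) => //; exact: lS.
Qed.

Lemma Rint_PI2D (K : kernel2D R n m) (u : R * R -> 'cV[R]_m) i (chi : R * R -> R) :
  N2D a b c d K -> mx_square_integrable (leb2 R) (box_xy a b c d) u ->
  test_function O2 chi ->
  \int[leb2 R]_(z in O2) (PI2D a b c d K u z i ord0 * chi z) =
  pairing a b c d K u i chi.
Proof.
move=> hK hu tchi; have [schi _ _] := tchi.
rewrite -(slices_pairing i hK hu (measurable_plane (smooth_continuous schi))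
  (test_function_bounded tchi)).
rewrite Rintegral_indic; apply: eq_Rintegral => z _; rewrite indicE.
have [Oz|Oz] := pselect (O2 z); first by rewrite mem_set// mul1r PI2D_slices.
by rewrite memNset// mul0r (test_function_out tchi Oz) mulr0.
Qed.

Variables (N M : kernel2D R n m) (u : R * R -> 'cV[R]_m).
Hypotheses (hN : N2D a b c d N) (hM : N2D a b c d M).
Hypotheses (hN00 : k00 N = cst 0 %[ae leb2 R in box_xy a b c d])
  (hN01 : k01 N = cst 0 %[ae leb3 R in box_xyv a b c d])
  (hN02 : k02 N = cst 0 %[ae leb3 R in box_xyv a b c d]).
Hypothesis hNM : dx_kernels a b c d N M.
Hypothesis hu : mx_square_integrable (leb2 R) (box_xy a b c d) u.
Variables (i : 'I_n) (phi : R * R -> R).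
Hypothesis tphi : test_function O2 phi.

Let sphi : smooth phi. Proof. by case: tphi. Qed.
Let tD := test_function_derive dx2 tphi.
Let sD : smooth ('D_dx2 phi). Proof. by case: tD. Qed.
Let mphi := measurable_plane (smooth_continuous sphi).
Let mD := measurable_plane (smooth_continuous sD).
Let bphi := test_function_bounded tphi.
Let bD := test_function_bounded tD.

Local Notation uo j := ((fun z => u z j ord0) \_ O2).

Let luo := state_L2_obox hu.

Lemma pairing00_0 j : pairing00 a b c d N u i ('D_dx2 phi) j = 0.
Proof.
apply: Rint_ae_zero.
  by apply: measurable_funM => //; exact: L1_measurable (L2_mul (kernel_00_L2_obox i hN j) (luo j)).
apply: (ae_sub (mu := leb2 R) hN00) => z N0; rewrite patchE.
have [Oz|Oz] := pselect (O2 z); last by rewrite memNset// !mul0r.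
by rewrite mem_set// N0 ?mxE ?mul0r//; exact: obox_box_xy.
Qed.

Lemma pairing_y_0 s j : pairing_y a b c d N u i ('D_dx2 phi) s j = 0.
Proof.
apply: Rint_ae_zero.
  apply: L1_measurable (L1M_fst mD bD _); apply: L1_integrand_y.
  apply: (@L1_mul_swap_yv R c d _ _ (kernel_y_L2_obox i hN s j) (luo j)) => q nI.
  by rewrite patchE memNset// => -[[/= _ +] _] => /subset_itv_oo_cc.
have ky0 : {ae leb3 R, forall z, box_xyv a b c d z -> kernel_y N s z = 0}.
  by case: s; [exact: hN01|exact: hN02].
apply: (ae_sub (mu := leb3 R) ky0) => z N0; rewrite /integrand_y patchE.
have [Oz|Oz] := pselect (Ov z); last by rewrite memNset// mul0r mulr0 mul0r.
rewrite mem_set// N0 ?mxE ?mul0r ?mulr0 ?mul0r//.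
exact: obox_box_xyv.
Qed.

Lemma pairing_x_derivative j :
  pairing_x a b c d N u i ('D_dx2 phi) true j +
  pairing_x a b c d N u i ('D_dx2 phi) false j =
  - pairing00 a b c d M u i phi j -
  (pairing_x a b c d M u i phi true j + pairing_x a b c d M u i phi false j).
Proof.
have [[G1 [G2 [[cG1 KG1] [cG2 KG2] JE]]] _ _ [w1 w2] _] := hNM.
apply: (derivative_of_slice_x ab (luo j) tphi ((square_integrable_L2 _ _ _).2 (kernel_x_L2_obox i hN true j)) ((square_integrable_L2 _ _ _).2 (kernel_x_L2_obox i hN false j))
  ((square_integrable_L2 _ _ _).2 (kernel_x_L2_obox i hM true j)) ((square_integrable_L2 _ _ _).2 (kernel_x_L2_obox i hM false j)) (w1 i j) (w2 i j) (cG1 i j) (cG2 i j) _ _ (kernel_00_L2_obox i hM j)).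
- by apply: (ae_sub (mu := leb3 R) KG1) => z E Bz; rewrite /= /kernel_x E.
- by apply: (ae_sub (mu := leb3 R) KG2) => z E Bz; rewrite /= /kernel_x E.
- apply: (ae_sub (mu := leb2 R) JE) => -[x y] E Oz; rewrite E ?mxE//; exact: obox_box_xy.
Qed.

Lemma pairing_xy_derivative s' j :
  pairing_xy a b c d N u i ('D_dx2 phi) true s' j +
  pairing_xy a b c d N u i ('D_dx2 phi) false s' j =
  - pairing_y a b c d M u i phi s' j -
  (pairing_xy a b c d M u i phi true s' j + pairing_xy a b c d M u i phi false s' j).
Proof.
have [_ j1 j2 _ [w11 w12 w21 w22]] := hNM.
have [G1 [G2 [[cG1 KG1] [cG2 KG2] JE]]] :
    is_jump_xytv a b c d (kernel_xy N true s') (kernel_xy N false s') (kernel_y M s').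
  by clear -j1 j2; case: s'.
have w1 : is_dx_xytv a b c d (kernel_xy N true s') (kernel_xy M true s').
  by clear -w11 w12; case: s'.
have w2 : is_dx_xytv a b c d (kernel_xy N false s') (kernel_xy M false s').
  by clear -w21 w22; case: s'.
apply: (derivative_of_slice_xy ab (luo j) tphi s' ((square_integrable_L2 _ _ _).2 (kernel_xy_L2_obox i hN true s' j)) ((square_integrable_L2 _ _ _).2 (kernel_xy_L2_obox i hN false s' j))
  ((square_integrable_L2 _ _ _).2 (kernel_xy_L2_obox i hM true s' j)) ((square_integrable_L2 _ _ _).2 (kernel_xy_L2_obox i hM false s' j)) (w1 i j) (w2 i j) (cG1 i j) (cG2 i j) _ _
  (kernel_y_L2_obox i hM s' j)).
- apply: (ae_sub (mu := leb4 R) KG1) => z E Bz.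
  exact: (congr1 (fun A => fun_of_matrix A i j) (E Bz)).
- apply: (ae_sub (mu := leb4 R) KG2) => z E Bz.
  exact: (congr1 (fun A => fun_of_matrix A i j) (E Bz)).
- apply: (ae_sub (mu := leb3 R) JE) => -[[x y] v] E Oz; rewrite E ?mxE//.
  exact: obox_box_xyv.
Qed.

Lemma pairing_derivative :
  pairing a b c d N u i ('D_dx2 phi) = - pairing a b c d M u i phi.
Proof.
rewrite /pairing big1; last by move=> j _; exact: pairing00_0.
rewrite [X in _ + X + _]big1; last by move=> s _; apply: big1 => j _; exact: pairing_y_0.
by rewrite add0r addr0 (jump_sums pairing_x_derivative pairing_xy_derivative).
Qed.

End derivative.

Lemma PI2D_weak_derivative (R : realType) (n m : nat) (a b c d : R) (ab : a < b)
    (N M : kernel2D R n m) (u : R * R -> 'cV[R]_m) :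
  N2D a b c d N -> N2D a b c d M ->
  k00 N = cst 0 %[ae leb2 R in box_xy a b c d] ->
  k01 N = cst 0 %[ae leb3 R in box_xyv a b c d] ->
  k02 N = cst 0 %[ae leb3 R in box_xyv a b c d] ->
  dx_kernels a b c d N M ->
  mx_square_integrable (leb2 R) (box_xy a b c d) u ->
  mx_weak_derivative (leb2 R) chart2 (obox_xy a b c d) [:: dx2]
    (PI2D a b c d N u) (PI2D a b c d M u).
Proof.
move=> hN hM hN00 hN01 hN02 hNM hu i j; rewrite (ord1 j); split.
- exact: loc_integrable_PI2D.
- exact: loc_integrable_PI2D.
move=> phi; rewrite /chart2 image_id => tphi /=.
rewrite expr1 mulN1r (Rint_PI2D i hM hu tphi).
rewrite (Rint_PI2D i hN hu (test_function_derive dx2 tphi)).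
exact: (pairing_derivative ab hN hM hN00 hN01 hN02 hNM hu i tphi).
Qed.

(** * Existence of the kernels of the derivative *)

Section weak_derivatives_of_matrices.
Context d (T : measurableType d) (R : realType) (V : normedModType R).
Variables (mu : {measure set T -> \bar R}) (e : T -> V) (Omega : set T).

Lemma weak_derivative_patch vs (f g : T -> R) : weak_derivative mu e Omega vs f g ->
  weak_derivative mu e Omega vs f (g \_ Omega).
Proof.
have gE z : z \in Omega -> (g \_ Omega) z = g z by move=> Oz; rewrite patchE Oz.
move=> [lf [mg lg] fg]; split => //.
  split; first by apply: eq_measurable_fun mg => z /gE.
  move=> K KO cK; have /integrableP[mgK gK] := lg K KO cK; apply/integrableP; split.
    by apply: eq_measurable_fun mgK => z /[!inE] Kz /=; rewrite gE// inE; exact: KO.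
  rewrite (eq_integral (fun z => `|(EFin \o g) z|)%E)// => z /[!inE] Kz /=.
  by rewrite gE// inE; exact: KO.
move=> phi tphi; rewrite fg//; congr (_ * _); apply: eq_Rintegral => z Oz.
by rewrite gE.
Qed.

Variables (p q : nat) (basis : seq V) (B : set T).
Hypotheses (OB : Omega `<=` B).

(** Entries are chosen on [Omega] and extended by zero. Square integrability over [B] then reduces
    to that over [Omega], and the weak derivative on [Omega] is unaffected. *)
Lemma exists_mx_weak_derivative vs (K : T -> 'M[R]_(p, q)) : subseq vs basis ->
  mx_H1 mu e Omega basis K -> exists2 K' : T -> 'M[R]_(p, q),
    mx_square_integrable mu B K' & mx_weak_derivative mu e Omega vs K K'.
Proof.
move=> svs hK; have [g hg] : {g : 'I_p * 'I_q -> T -> R & forall ij,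
    square_integrable mu Omega (g ij) /\
    weak_derivative mu e Omega vs (fun z => K z ij.1 ij.2) (g ij)}.
  apply: (@choice _ _ (fun ij g => square_integrable mu Omega g /\
    weak_derivative mu e Omega vs (fun z => K z ij.1 ij.2) g)) => ij.
  by have [_ h] := hK ij.1 ij.2; have [g sg wg] := h _ svs; exists g.
exists (fun z => \matrix_(i, j) (g (i, j) \_ Omega) z) => i j.
  have [sg _] := hg (i, j).
  rewrite /square_integrable (_ : _ \_ B = g (i, j) \_ Omega)//.
  apply/funext => z; rewrite [LHS]patchE !mxE; have [Bz|Bz] := pselect (B z).
    by rewrite mem_set.
  by rewrite memNset// patchE memNset// => /OB.
have [_ /weak_derivative_patch] := hg (i, j).
by congr weak_derivative; apply/funext => z; rewrite mxE.
Qed.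

Hypothesis einj : injective e.
Hypothesis sfmu : sigma_finite setT mu.
Variable C : set (V -> R).
Hypotheses (mO : measurable Omega) (Ooo : (mu Omega < +oo)%E).
Hypotheses (tC : tests_on mu e Omega C) (dC : dense_tests mu e Omega C).
Hypothesis rC : reproducing mu e Omega basis C.
Hypothesis aeBO : {ae mu, forall z, B z -> Omega z}.

Lemma exists_mx_continuous_version (K : T -> 'M[R]_(p, q)) :
  mx_H1 mu e Omega basis K -> exists G : V -> 'M[R]_(p, q),
    (forall i j, continuous (fun v => G v i j)) /\ continuous_version mu e B K G.
Proof.
move=> hK; have [g hg] : {g : 'I_p * 'I_q -> V -> R & forall ij,
    continuous (g ij) /\ ae_eq mu Omega (fun z => K z ij.1 ij.2) (g ij \o e)}.
  apply: (@choice _ _ (fun ij g => continuous g /\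
    ae_eq mu Omega (fun z => K z ij.1 ij.2) (g \o e))) => ij.
  have [g cg gE] := exists_continuous_representative einj sfmu mO Ooo tC dC rC (hK ij.1 ij.2).
  by exists g.
have cG i j : continuous (fun v => (\matrix_(i, j) g (i, j) v) i j : R).
  by under eq_fun do rewrite mxE; case: (hg (i, j)).
exists (fun v => \matrix_(i, j) g (i, j) v); split => //; split.
  by move=> i j; exact: continuous_subspaceT.
(* There are finitely many entries, so their exceptional sets unite to a null set. *)
have gE := filter_forall (ae_filter_ringOfSetsType mu) (fun ij => (hg ij).2).
apply: filterS2 gE aeBO => z KE BO /BO Oz; apply/matrixP => i j.
by rewrite !mxE (KE (i, j) Oz).
Qed.

End weak_derivatives_of_matrices.

Lemma continuous_square_integrable d (T : measurableType d) (R : realType)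
    (V : normedModType R) (mu : {measure set T -> \bar R}) (e : T -> V) (B : set T)
    (f : V -> R) : measurable_basis e -> measurable B -> (mu B < +oo)%E ->
  compact (e @` B) -> continuous f -> square_integrable mu B (f \o e).
Proof.
move=> be mB Boo cB cf; apply/square_integrable_L2.
have [M hM] := continuous_bounded cf cB.
have mf : measurable_fun setT ((f \o e) \_ B).
  by apply/(measurable_restrictT _ mB).1; exact: measurable_funS (continuous_measurable be cf).
split => //; apply: (@L1_le _ _ _ mu _ (fun z => M ^+ 2 * \1_B z)).
- exact: measurable_funX.
- move=> z; rewrite patchE indicE; have [Bz|Bz] := pselect (B z); last first.
    by rewrite memNset// expr0n mulr0 normr0.
  rewrite mem_set// mulr1 !normrX lerXn2r ?nnegrE//.
  by rewrite (le_trans _ (ler_norm M))//; apply: hM; exists z.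
- exact/L1Z/L1_indic.
Qed.

Section existence.
Context {R : realType} {n m : nat}.
Local Notation mR := (measurableTypeR R).
Local Notation L := (@lebesgue_measure R).
Variables a b c d : R.
Hypotheses (ab : a < b) (cd : c < d).

Let sfL : sigma_finite setT L := sigma_finiteT _.
Let sfL2 : sigma_finite setT (L \x L)%E := sigma_finite_prod L sfL.
Let sfL3 : sigma_finite setT (L \x L \x L)%E := sigma_finite_prod L sfL2.
Let sfL4 : sigma_finite setT (L \x L \x L \x L)%E := sigma_finite_prod L sfL3.

Lemma measurable_basis2 : measurable_basis (@chart2 R).
Proof. by rewrite chart2E; apply: measurable_basis_prod; exact: measurable_basis1. Qed.

Lemma measurable_basis3 : measurable_basis (@chart3 R).
Proof.
by rewrite chart3E; apply: measurable_basis_prod;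
  [exact: measurable_basis2|exact: measurable_basis1].
Qed.

Lemma square_integrable_box_xy (f : R * R -> R) : continuous f ->
  square_integrable (leb2 R) (box_xy a b c d) f.
Proof.
move=> cf; apply: (continuous_square_integrable (e := @chart2 R) measurable_basis2) => //.
- by apply: measurableX; exact: measurable_itv.
- by apply: finite_setX; [exact: measurable_itv|exact: measurable_itv|
    exact: finite_citv|exact: finite_citv].
- by rewrite image_id; apply: compact_setX; exact: segment_compact.
Qed.

Lemma square_integrable_box_xyv (f : R * R * R -> R) : continuous f ->
  square_integrable (leb3 R) (box_xyv a b c d) f.
Proof.
have mxy : measurable (box_xy a b c d : set (mR * mR)).
  by apply: measurableX; exact: measurable_itv.
move=> cf; apply: (continuous_square_integrable (e := @chart3 R) measurable_basis3) => //.
- by apply: measurableX => //; exact: measurable_itv.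
- apply: finite_setX; [exact: mxy|exact: measurable_itv| |exact: finite_citv].
  by apply: finite_setX; [exact: measurable_itv|exact: measurable_itv|
    exact: finite_citv|exact: finite_citv].
- rewrite image_id; apply: compact_setX; last exact: segment_compact.
  by apply: compact_setX; exact: segment_compact.
Qed.

Variable N : kernel2D R n m.
Hypotheses (hN10 : kernel_H1_xyt a b c d (k10 N)) (hN20 : kernel_H1_xyt a b c d (k20 N)).
Hypotheses (hN11 : kernel_H1_xytv a b c d (k11 N)) (hN12 : kernel_H1_xytv a b c d (k12 N)).
Hypotheses (hN21 : kernel_H1_xytv a b c d (k21 N)) (hN22 : kernel_H1_xytv a b c d (k22 N)).

Lemma exists_dx_kernels :
  exists2 M : kernel2D R n m, N2D a b c d M & dx_kernels a b c d N M.
Proof.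
have inj3 : injective (@chart3 R) by move=> ? ?.
have inj4 : injective (@chart4 R) by move=> ? ?.
have dx3E : subseq [:: dx3] (basis3 (R := R)) by rewrite /= eqxx.
have dx4E : subseq [:: dx4] (basis4 (R := R)) by rewrite /= eqxx.
have D3 K := @exists_mx_weak_derivative _ _ R _ (leb3 R) (@chart3 R) _ n m _ _
  (obox_box_xyt (a:=a) (b:=b) (c:=c) (d:=d)) _ K dx3E.
have D4 K := @exists_mx_weak_derivative _ _ R _ (leb4 R) (@chart4 R) _ n m _ _
  (obox_box_xytv (a:=a) (b:=b) (c:=c) (d:=d)) _ K dx4E.
have C3 K := @exists_mx_continuous_version _ _ R _ (leb3 R) (@chart3 R) _ n m _ _
  inj3 sfL3 _ (measurable_obox_xyt _ _ _ _) (finite_obox_xyt a b c d)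
  (tests_on_xyt (a:=a) (b:=b) (c:=c) (d:=d)) (dense_tests_xyt (a:=a) (b:=b) (c:=c) (d:=d))
  (reproducing_xyt ab cd) (ae_obox_xyt a b c d) K.
have C4 K := @exists_mx_continuous_version _ _ R _ (leb4 R) (@chart4 R) _ n m _ _
  inj4 sfL4 _ (measurable_obox_xytv _ _ _ _) (finite_obox_xytv a b c d)
  (tests_on_xytv (a:=a) (b:=b) (c:=c) (d:=d)) (dense_tests_xytv (a:=a) (b:=b) (c:=c) (d:=d))
  (reproducing_xytv ab cd) (ae_obox_xytv a b c d) K.
have [M10 s10 w10] := D3 _ hN10; have [M20 s20 w20] := D3 _ hN20.
have [M11 s11 w11] := D4 _ hN11; have [M12 s12 w12] := D4 _ hN12.
have [M21 s21 w21] := D4 _ hN21; have [M22 s22 w22] := D4 _ hN22.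
have [G10 [c10 v10]] := C3 _ hN10; have [G20 [c20 v20]] := C3 _ hN20.
have [G11 [c11 v11]] := C4 _ hN11; have [G12 [c12 v12]] := C4 _ hN12.
have [G21 [c21 v21]] := C4 _ hN21; have [G22 [c22 v22]] := C4 _ hN22.
(* The jumps are traced along theta = x. The continuous versions found here are continuous on the
   whole space, so their composites with these maps are continuous, hence square integrable over the
   compact boxes. *)
pose diag3 (z : R * R) := (z.1, z.2, z.1).
pose diag4 (z : R * R * R) := (z.1.1, z.1.2, z.1.1, z.2).
have cdiag3 : continuous diag3.
  apply: continuous_pair; last by move=> z; exact: cvg_fst.
  by apply: continuous_pair => z; [exact: cvg_fst|exact: cvg_snd].
have cx : continuous (fun z : R * R * R => z.1.1).
  by move=> z; apply: (@continuous_comp _ _ _ fst fst); exact: cvg_fst.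
have cy : continuous (fun z : R * R * R => z.1.2).
  by move=> z; apply: (@continuous_comp _ _ _ fst snd); [exact: cvg_fst|exact: cvg_snd].
have cdiag4 : continuous diag4.
  apply: continuous_pair; last by move=> z; exact: cvg_snd.
  by apply: continuous_pair => //; exact: continuous_pair.
have cdiff (V1 V2 : normedModType R) (h : V1 -> V2) (G1 G2 : V2 -> 'M[R]_(n, m)) i j :
    continuous h -> (forall i j, continuous (fun v => G1 v i j)) ->
    (forall i j, continuous (fun v => G2 v i j)) ->
    continuous (fun z => (G1 (h z) - G2 (h z)) i j).
  move=> ch cG1 cG2; under eq_fun do rewrite !mxE.
  move=> z; apply: cvgB.
    exact: (@continuous_comp _ _ _ h (fun v => G1 v i j) z (ch z) (cG1 i j (h z))).
  exact: (@continuous_comp _ _ _ h (fun v => G2 v i j) z (ch z) (cG2 i j (h z))).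
exists (Kernel2D (fun z => G10 (diag3 z) - G20 (diag3 z))
  (fun z => G11 (diag4 z) - G21 (diag4 z)) (fun z => G12 (diag4 z) - G22 (diag4 z))
  M10 M20 M11 M12 M21 M22).
  split => //; [|split].
  - by move=> i j; apply: square_integrable_box_xy; exact: cdiff.
  - by move=> i j; apply: square_integrable_box_xyv; exact: cdiff.
  - by move=> i j; apply: square_integrable_box_xyv; exact: cdiff.
split => //=.
- by exists G10, G20; split => //; apply: aeW => -[x y].
- by exists G11, G21; split => //; apply: aeW => -[[x y] v].
- by exists G12, G22; split => //; apply: aeW => -[[x y] v].
Qed.

End existence.

(** Weak derivatives and traces fix the entries of [M] only up to null sets, so [M] is described by
    a relation: the first half provides a solution, the second holds for every solution. *)
Theorem lemma6 (R : realType) (n m : nat) (a b c d : R)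
    (hab : a < b) (hcd : c < d)
    (N : kernel2D R n m) (hN : N2D a b c d N)
    (hN00 : k00 N = cst 0 %[ae leb2 R in box_xy a b c d])
    (hN01 : k01 N = cst 0 %[ae leb3 R in box_xyv a b c d])
    (hN02 : k02 N = cst 0 %[ae leb3 R in box_xyv a b c d])
    (hN10 : kernel_H1_xyt a b c d (k10 N))
    (hN20 : kernel_H1_xyt a b c d (k20 N))
    (hN11 : kernel_H1_xytv a b c d (k11 N))
    (hN12 : kernel_H1_xytv a b c d (k12 N))
    (hN21 : kernel_H1_xytv a b c d (k21 N))
    (hN22 : kernel_H1_xytv a b c d (k22 N)) :
  (exists2 M : kernel2D R n m, N2D a b c d M & dx_kernels a b c d N M) /\
  (forall M : kernel2D R n m, N2D a b c d M -> dx_kernels a b c d N M ->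
   forall u : R * R -> 'cV[R]_m,
     mx_square_integrable (leb2 R) (box_xy a b c d) u ->
     mx_weak_derivative (leb2 R) chart2 (obox_xy a b c d) [:: dx2]
       (PI2D a b c d N u) (PI2D a b c d M u)).
Proof.
split; first exact: exists_dx_kernels.
by move=> M hM hNM u hu; exact: PI2D_weak_derivative.
Qed.
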